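(* Let $d\ge 1$ and let $F$ be a probability distribution on $\mathbb{R}^d$ admitting a bounded density $f\colon\mathbb{R}^d\to[0,\infty[$ with respect to the Lebesgue measure. Let $\mathcal{U}^d$ denote the uniform distribution on $[0,1]^d$. Then the expected Euler characteristic curve in the thermodynamic limit satisfies, for all $\Lambda\ge 0$, $$\overline{\chi}_F(\Lambda)=\int_{\mathbb{R}^d} f(x)\,\overline{\chi}_{\mathcal{U}^d}(\Lambda f(x))\,\mathrm{d}x .$$ In addition, for all $\Lambda\ge 0$, $$\overline{\chi}_F(\Lambda)=-\int_0^{\|f\|_\infty}\hat f'(y)\,\overline{\chi}_{\mathcal{U}^d}(\Lambda y)\,\mathrm{d}y ,$$ where $\hat f'$ is the derivative, understood in the distributional sense, of the excess mass transform $\hat f$ of $f$.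
   Context: Čech complex: for a finite set $X\subset\mathbb{R}^d$ and $r\ge 0$, $\mathcal{C}_r(X)$ is the simplicial complex with vertex set $X$ in which a nonempty subset $\sigma\subseteq X$ is a simplex iff $\bigcap_{x\in\sigma}\overline{B}_r(x)\neq\emptyset$ (closed Euclidean balls). Its Euler characteristic is $\chi(\mathcal{C}_r(X))=\sum_{\sigma\in\mathcal{C}_r(X)}(-1)^{|\sigma|-1}$. Expected Euler characteristic curve (EECC): let $F$ be a probability distribution on $\mathbb{R}^d$ with bounded density $f$. Let $X_n$ be either $n$ i.i.d. samples from $F$ (Bernoulli setting) or a Poisson point process of intensity $nf$ (Poisson setting). Let $\omega_d$ be the volume of the unit ball in $\mathbb{R}^d$. Define $\overline{\chi}_F\colon[0,\infty[\to\mathbb{R}$ by $\overline{\chi}_F(0)=1$ and, for $\Lambda>0$, $\overline{\chi}_F(\Lambda)=\lim_{n\to\infty}n^{-1}\mathbb{E}[\chi(\mathcal{C}_{r_n}(X_n))]$, where $(r_n)_n$ is a sequence of positive radii with $n\omega_d r_n^d\to\Lambda$ as $n\to\infty$ (thermodynamic limit). It is known that this limit exists. Excess mass transform: $\hat f(t)=\int_{\mathbb{R}^d}\mathbbm{1}_{[t,\infty[}(f(x))\,f(x)\,\mathrm{d}x$ for $t\ge 0$; thus $\hat f(0)=1$ and $\hat f(t)=0$ for $t>\|f\|_\infty$. The derivative $\hat f'$ is understood distributionally via integration by parts: for continuously differentiable $\varphi$ on $[0,\|f\|_\infty]$, $\int_0^{\|f\|_\infty}\hat f'(y)\varphi(y)\,\mathrm{d}y:=-\varphi(0)-\int_0^{\|f\|_\infty}\hat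 f(y)\varphi'(y)\,\mathrm{d}y$ (so a possible atom of $\hat f'$ at $\|f\|_\infty$ is included; e.g. for the uniform distribution on $[0,1]^d$, $-\hat f'$ is the unit point mass at $1$). *)

(* Defs.v *)
From HB Require Import structures.
From mathcomp Require Import all_boot all_order all_algebra finmap.
From mathcomp Require Import all_classical all_reals all_analysis.

Set Implicit Arguments.
Unset Strict Implicit.
Unset Printing Implicit Defensive.

Import Order.TTheory GRing.Theory Num.Theory.
Import numFieldNormedType.Exports.

Local Open Scope classical_set_scope.
Local Open Scope ring_scope.

(* R^d is [d.-tuple (measurableTypeR R)], with the product of the Borel
   sigma-algebras.  Its Lebesgue measure is not in the library and is built
   by recursion on d, transporting the product of the one-dimensional measure
   with the (d-1)-dimensional one along (x, t) |-> x :: t. *)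

Notation Rn R d := (d.-tuple (measurableTypeR R)).

Section lebesgue_tuple.
Variable R : realType.

Definition tcons d (p : measurableTypeR R * Rn R d) : Rn R d.+1 :=
  [tuple of p.1 :: p.2].

Definition tuncons d (t : Rn R d.+1) : measurableTypeR R * Rn R d :=
  (thead t, [tuple of behead t]).

Lemma tconsK d : cancel (@tuncons d) (@tcons d).
Proof. by move=> t; rewrite [RHS]tuple_eta; apply: val_inj. Qed.

Lemma tunconsK d : cancel (@tcons d) (@tuncons d).
Proof. by move=> [x t]; congr pair; apply: val_inj. Qed.

Lemma measurable_tcons d : measurable_fun setT (@tcons d).
Proof. exact: measurable_cons. Qed.

Lemma measurable_tuncons d : measurable_fun setT (@tuncons d).
Proof.
apply/measurable_fun_pair; first exact: measurable_tnth.
apply/measurable_fun_tnthP => i.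
rewrite (_ : _ \o _ = (fun t : Rn R d.+1 => tnth t (lift ord0 i))).
  exact: measurable_tnth.
apply/funext => t /=; rewrite tnth_behead; congr tnth.
by apply: ord_inj; rewrite /= inordK // ltnS.
Qed.

Section step.
Variables (d : nat) (m : {sigma_finite_measure set (Rn R d) -> \bar R}).

Definition lebesgue_step : set (Rn R d.+1) -> \bar R :=
  pushforward (@lebesgue_measure R \x m)%E (@tcons d).

Let lebesgue_step0 : lebesgue_step set0 = 0%E.
Proof. by rewrite /lebesgue_step /pushforward preimage_set0 measure0. Qed.

Let lebesgue_step_ge0 A : (0 <= lebesgue_step A)%E.
Proof. by rewrite /lebesgue_step /pushforward; exact: measure_ge0. Qed.

Let lebesgue_step_sigma_additive : semi_sigma_additive lebesgue_step.
Proof.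
move=> F mF tF mUF; rewrite /lebesgue_step /pushforward preimage_bigcup.
apply: measure_semi_sigma_additive.
- by move=> n; rewrite -[X in measurable X]setTI; exact: measurable_tcons.
- apply/trivIsetP => /= i j _ _ ij; rewrite -preimage_setI.
  by move/trivIsetP : tF => /(_ _ _ _ _ ij) ->//; rewrite preimage_set0.
- by rewrite -preimage_bigcup -[X in measurable X]setTI; exact: measurable_tcons.
Qed.

HB.instance Definition _ := isMeasure.Build _ _ _
  lebesgue_step lebesgue_step0 lebesgue_step_ge0 lebesgue_step_sigma_additive.

Lemma lebesgue_step_sigma_finite : sigma_finite setT lebesgue_step.
Proof.
have /sigma_finiteP[F [FT ndF Foo]] := sigma_finiteT (@lebesgue_measure R).
have /sigma_finiteP[G [GT ndG Goo]] := sigma_finiteT m.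
exists (fun n => @tuncons d @^-1` (F n `*` G n)).
  rewrite -preimage_bigcup (_ : \bigcup_n (F n `*` G n) = setT) ?preimage_setT//.
  apply/seteqP; split => // -[x y] _.
  have [n _ Fx] : (\bigcup_n F n) x by rewrite -FT.
  have [k _ Gy] : (\bigcup_n G n) y by rewrite -GT.
  exists (maxn n k) => //; split => /=.
    by move: x Fx; exact/subsetPset/ndF/leq_maxl.
  by move: y Gy; exact/subsetPset/ndG/leq_maxr.
move=> n; have [mF Fn] := Foo n; have [mG Gn] := Goo n; split.
  rewrite -[X in measurable X]setTI; apply: measurable_tuncons => //.
  exact: measurableX.
rewrite /lebesgue_step /pushforward (_ : _ @^-1` _ = F n `*` G n).
  by rewrite product_measure1E// lte_mul_pinfty// ge0_fin_numE.
by apply/funext => p; rewrite /preimage /mkset tunconsK.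
Qed.

HB.instance Definition _ := Measure_isSigmaFinite.Build _ _ _
  lebesgue_step lebesgue_step_sigma_finite.

Definition lebesgue_step_measure : {sigma_finite_measure set (Rn R d.+1) -> \bar R} :=
  lebesgue_step.

End step.

Fixpoint lebesgue_tuple d : {sigma_finite_measure set (Rn R d) -> \bar R} :=
  if d is e.+1 then lebesgue_step_measure (lebesgue_tuple e)
  else \d_([tuple] : Rn R 0).

End lebesgue_tuple.

Arguments lebesgue_tuple {R d}.

Section cech.
Variables (R : realType) (d : nat).

Definition eucl_dist (x y : Rn R d) : R :=
  Num.sqrt (\sum_(i < d) ((tnth x i : R) - tnth y i) ^+ 2).

Definition eucl_ball (x : Rn R d) (r : R) : set (Rn R d) :=
  [set y | eucl_dist x y <= r].

Definition cech (r : R) (X : {fset Rn R d}) : {fset {fset Rn R d}} :=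
  [fset s in fpowerset X |
     (s != fset0) && `[< \bigcap_(x in [set` s]) eucl_ball x r !=set0 >]]%fset.

Definition euler (K : {fset {fset Rn R d}}) : R :=
  \sum_(s <- K) (-1) ^+ (#|` s|).-1.

(* omega_d *)
Definition unit_ball_volume : R :=
  fine (lebesgue_tuple (eucl_ball [tuple 0 | _ < d] 1)).

Definition bounded_density (f : Rn R d -> R) : Prop :=
  [/\ measurable_fun setT f,
      forall x, 0 <= f x,
      exists M, forall x, f x <= M
    & (\int[lebesgue_tuple]_x (f x)%:E = 1)%E].

Definition unit_cube : set (Rn R d) :=
  [set x | forall i : 'I_d, 0 <= (tnth x i : R) <= 1].

Definition uniform_density : Rn R d -> R := \1_unit_cube.

Definition mass (f : Rn R d -> R) (A : set (Rn R d)) : R :=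
  \int[lebesgue_tuple]_(x in A) f x.

Definition excess_mass (f : Rn R d -> R) (t : R) : R :=
  mass f [set x | t <= f x].

Definition sup_norm (f : Rn R d -> R) : R :=
  fine ('N[lebesgue_tuple]_+oo[EFin \o f])%E.

(* A finite point process, given by its number of points N and an enumeration
   X 0, ..., X (N - 1) of them; only these first N points matter. *)
Record point_process := PointProcess {
  pp_display : measure_display;
  pp_space : measurableType pp_display;
  pp_prob : probability pp_space R;
  pp_size : {mfun pp_space >-> nat};
  pp_point : nat -> {mfun pp_space >-> Rn R d} }.

Definition pp_config (X : point_process) (w : pp_space X) : {fset Rn R d} :=
  [fset x in [seq pp_point X i w | i <- iota 0 (pp_size X w)]]%fset.

Definition pp_count (X : point_process) (A : set (Rn R d)) (w : pp_space X) : nat :=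
  (\sum_(i < pp_size X w) (pp_point X i w \in A))%N.

Definition iid_sample (f : Rn R d -> R) (n : nat) (X : point_process) : Prop :=
  [/\ forall w, pp_size X w = n,
      forall (i : 'I_n) A, measurable A ->
        pp_prob X (pp_point X i @^-1` A) = (mass f A)%:E
    & forall A : 'I_n -> set (Rn R d), (forall i, measurable (A i)) ->
        pp_prob X (\bigcap_(i in [set: 'I_n]) pp_point X i @^-1` A i) =
        (\prod_(i < n) fine (pp_prob X (pp_point X i @^-1` A i)))%:E].

(* Intensity n f.  The law is written out because [poisson_pmf] is 1, and not
   the Dirac mass at 0, for a null rate. *)
Definition poisson_sample (f : Rn R d -> R) (n : nat) (X : point_process) : Prop :=
  (forall A k, measurable A ->
     pp_prob X [set w | pp_count A w = k] =
     (expR (- (n%:R * mass f A)) * (n%:R * mass f A) ^+ k / k`!%:R)%:E) /\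
  (forall m (A : 'I_m -> set (Rn R d)) (k : 'I_m -> nat),
     (forall i, measurable (A i)) -> trivIset setT A ->
     pp_prob X (\bigcap_(i in [set: 'I_m]) [set w | pp_count (A i) w = k i]) =
     (\prod_(i < m) fine (pp_prob X [set w | pp_count (A i) w = k i]))%:E).

Inductive setting := Bernoulli | Poisson.

Definition is_sample (s : setting) :=
  match s with Bernoulli => iid_sample | Poisson => poisson_sample end.

(* [get] picks an element of a set; here the set has exactly one element for
   samples of a bounded density and L > 0. *)
Definition EECC (X : nat -> point_process) (L : R) : R :=
  if L == 0 then 1 else
  get [set l : R | forall r : nat -> R, (forall n, 0 < r n) ->
    n%:R * unit_ball_volume * r n ^+ d @[n --> \oo] --> L ->
    ((n%:R^-1)%:E *
      'E_(pp_prob (X n))[fun w => euler (cech (r n) (pp_config w))])%E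
      @[n --> \oo] --> l%:E].

End cech.

Section distributional_derivative.
Variable R : realType.

Definition C1_itv (M : R) (phi : R -> R) : Prop :=
  exists dphi : R -> R,
    [/\ {within `[0, M], continuous phi},
        {within `[0, M], continuous dphi}
      & forall y, y \in `]0, M[ -> is_derive y 1 phi (dphi y)].

(* int_0^M g'(y) phi(y) dy, for g with g(0) = 1 and g = 0 beyond M, and for phi
   such that [C1_itv M phi]. *)
Definition distr_deriv_integral (g : R -> R) (M : R) (phi : R -> R) : R :=
  - phi 0 - \int[@lebesgue_measure R]_(y in `[0, M]) (g y * derive1 phi y).

End distributional_derivative.

(* Main.v *)
(* Grouping simplices by dimension, the Euler characteristic of the Cech complex
   of N distinct points is a sum over k of (-1)^k / (k+1)! times the number of
   (k+1)-tuples of distinct points whose balls of radius r meet.  In both settings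
   the expectation of such a count is a factorial moment: a_n(k+1) times the
   integral of f(x_0) ... f(x_k) over the tuples whose balls meet, with
   a_n(k) = n (n - 1) ... (n - k + 1) or n^k.  The substitution x_i = x_0 + r z_i
   extracts a factor r^(dk), and as r -> 0 the L^1-continuity of translations
   replaces f(x_0 + r z_i) by f(x_0); so only the integral of f^(k+1) remains,
   times a constant c_k that does not depend on f.  As c_k <= 4^(dk), Tannery's
   theorem applies to the sum over k and gives EECC at L as the power series
   sum_k e_k (int f^(k+1)) L^k, with e_k = (-1)^k c_k / (omega_d^k (k+1)!).
   The moments of the uniform density are all 1, so integrating f(x) times the
   series of the uniform distribution at L f(x) gives back this series.  The
   second formula follows from the first by Fubini applied to the indicator of
   y <= f x: the integral over y of its product with the derivative of phi is
   phi (f x) - phi 0. *)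

Require Import Defs.
From HB Require Import structures.
From mathcomp Require Import all_boot all_order all_algebra finmap.
From mathcomp Require Import all_classical all_reals all_analysis.
From mathcomp Require Import measurable_realfun ess_sup_inf ring lra.

Set Implicit Arguments.
Unset Strict Implicit.
Unset Printing Implicit Defensive.

Import Order.TTheory GRing.Theory Num.Theory.
Import numFieldNormedType.Exports.

Local Open Scope classical_set_scope.
Local Open Scope ring_scope.

(** * Product measures on tuples *)

(** Both settings are reduced to [has_factorial_moments], an identity between measures on k-tuples
    that only has to be checked on products of sets. For i.i.d. points this is independence; Poisson
    counts are independent on disjoint sets only, so the space is first cut into the cells generated
    by the given sets. Three obstacles shape the rest. The complex is built on a set of points while
    the moments count tuples of indices: the two agree only off the null event that two points
    coincide, and integrals are compared off that event without measurability of the Euler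
    characteristic. The set of tuples whose balls meet is a projection, since it asks for a common
    point; a grid and a compactness argument make it measurable. Finally, the EECC is known to be
    the power series at nonnegative arguments only, so derivatives are taken of the series, which is
    defined on the whole line. The bound 4^(dk) on c_k comes from the cube [-2, 2]^d: a unit ball
    centred at z_i meets the one centred at 0 only if every coordinate of z_i lies in [-2, 2]. *)

Section tuple_measure.
Context {dT : measure_display} {T : measurableType dT} {R : realType}.

Definition consp k (p : T * k.-tuple T) : k.+1.-tuple T :=
  [the k.+1.-tuple T of p.1 :: p.2].

Definition unconsp k (t : k.+1.-tuple T) : T * k.-tuple T :=
  (thead t, [tuple of behead t]).

Lemma conspK k : cancel (@consp k) (@unconsp k).
Proof. by move=> [x t]; congr pair; apply: val_inj. Qed.

Lemma measurable_consp k : measurable_fun setT (@consp k).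
Proof. exact: measurable_cons. Qed.

Lemma measurable_unconsp k : measurable_fun setT (@unconsp k).
Proof.
by apply/measurable_fun_pair; [exact: measurable_tnth|exact: measurable_behead].
Qed.

Section step.
Variables (mu : {sigma_finite_measure set T -> \bar R}) (k : nat).
Variable m : {sigma_finite_measure set (k.-tuple T) -> \bar R}.

Definition tuple_step : set (k.+1.-tuple T) -> \bar R :=
  pushforward (mu \x m)%E (@consp k).

Let tuple_step0 : tuple_step set0 = 0%E.
Proof. by rewrite /tuple_step /pushforward preimage_set0 measure0. Qed.

Let tuple_step_ge0 A : (0 <= tuple_step A)%E.
Proof. by rewrite /tuple_step /pushforward; exact: measure_ge0. Qed.

Let tuple_step_sigma_additive : semi_sigma_additive tuple_step.
Proof.
move=> F mF tF mUF; rewrite /tuple_step /pushforward preimage_bigcup.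
apply: measure_semi_sigma_additive.
- by move=> n; rewrite -[X in measurable X]setTI; exact: measurable_consp.
- apply/trivIsetP => /= i j _ _ ij; rewrite -preimage_setI.
  by move/trivIsetP : tF => /(_ _ _ _ _ ij) ->//; rewrite preimage_set0.
- by rewrite -preimage_bigcup -[X in measurable X]setTI; exact: measurable_consp.
Qed.

HB.instance Definition _ := isMeasure.Build _ _ _
  tuple_step tuple_step0 tuple_step_ge0 tuple_step_sigma_additive.

Lemma tuple_step_sigma_finite : sigma_finite setT tuple_step.
Proof.
have /sigma_finiteP[F [FT ndF Foo]] := sigma_finiteT mu.
have /sigma_finiteP[G [GT ndG Goo]] := sigma_finiteT m.
exists (fun n => @unconsp k @^-1` (F n `*` G n)).
  rewrite -preimage_bigcup (_ : \bigcup_n (F n `*` G n) = setT) ?preimage_setT//.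
  apply/seteqP; split => // -[x y] _.
  have [n _ Fx] : (\bigcup_n F n) x by rewrite -FT.
  have [j _ Gy] : (\bigcup_n G n) y by rewrite -GT.
  exists (maxn n j) => //; split => /=.
    by move: x Fx; exact/subsetPset/ndF/leq_maxl.
  by move: y Gy; exact/subsetPset/ndG/leq_maxr.
move=> n; have [mF Fn] := Foo n; have [mG Gn] := Goo n; split.
  rewrite -[X in measurable X]setTI; apply: measurable_unconsp => //.
  exact: measurableX.
rewrite /tuple_step /pushforward (_ : _ @^-1` _ = F n `*` G n).
  by rewrite product_measure1E// lte_mul_pinfty// ge0_fin_numE.
by apply/funext => p; rewrite /preimage /mkset conspK.
Qed.

HB.instance Definition _ := Measure_isSigmaFinite.Build _ _ _
  tuple_step tuple_step_sigma_finite.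

Definition tuple_step_measure : {sigma_finite_measure set (k.+1.-tuple T) -> \bar R} :=
  tuple_step.

End step.

(** The recursion of [lebesgue_tuple] over an arbitrary base space. With base R^d it turns integrals
    over k-tuples of points into iterated integrals over R^d. *)
Fixpoint tuple_measure (mu : {sigma_finite_measure set T -> \bar R}) k :
    {sigma_finite_measure set (k.-tuple T) -> \bar R} :=
  if k is j.+1 then tuple_step_measure mu (tuple_measure mu j)
  else \d_([tuple] : 0%N.-tuple T).

Lemma integral_tuple0 (mu : {sigma_finite_measure set T -> \bar R})
    (g : 0.-tuple T -> \bar R) :
  (\int[tuple_measure mu 0]_t g t = g [tuple])%E.
Proof.
have -> : g = cst (g [tuple]) by apply/funext => t; rewrite tuple0.
by rewrite integral_dirac// diracT mul1e.
Qed.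

Lemma ge0_integral_tupleS (mu : {sigma_finite_measure set T -> \bar R}) k (g : k.+1.-tuple T -> \bar R) :
  measurable_fun setT g -> (forall t, 0 <= g t)%E ->
  (\int[tuple_measure mu k.+1]_t g t =
   \int[mu]_x \int[tuple_measure mu k]_t g (consp (x, t)))%E.
Proof.
move=> mg g0 /=; rewrite ge0_integral_pushforward//; last exact: measurable_consp.
rewrite preimage_setT fubini_tonelli1//; last by move=> ?; exact: g0.
by apply: measurableT_comp => //; exact: measurable_consp.
Qed.

End tuple_measure.

Section lebesgue_tuple_tonelli.
Variables (R : realType).

Lemma integral_lebesgue_tuple0 (g : Rn R 0 -> \bar R) :
  (\int[lebesgue_tuple]_t g t = g [tuple])%E.
Proof.
have -> : g = cst (g [tuple]) by apply/funext => t; rewrite tuple0.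
by rewrite integral_dirac// diracT mul1e.
Qed.

Lemma ge0_integral_lebesgue_tupleS d (g : Rn R d.+1 -> \bar R) :
  measurable_fun setT g -> (forall t, 0 <= g t)%E ->
  (\int[lebesgue_tuple]_t g t =
   \int[lebesgue_measure]_x \int[lebesgue_tuple]_t g (tcons (x, t)))%E.
Proof.
move=> mg g0 /=; rewrite ge0_integral_pushforward//; last exact: measurable_tcons.
rewrite preimage_setT fubini_tonelli1//; last by move=> ?; exact: g0.
by apply: measurableT_comp => //; exact: measurable_tcons.
Qed.

(** The other order of integration, needed when the first coordinate is translated with the
    remaining ones fixed. *)
Lemma ge0_integral_lebesgue_tupleSr d (g : Rn R d.+1 -> \bar R) :
  measurable_fun setT g -> (forall t, 0 <= g t)%E ->
  (\int[lebesgue_tuple]_t g t =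
   \int[lebesgue_tuple]_t \int[lebesgue_measure]_x g (tcons (x, t)))%E.
Proof.
move=> mg g0 /=; rewrite ge0_integral_pushforward//; last exact: measurable_tcons.
rewrite preimage_setT fubini_tonelli2//; last by move=> ?; exact: g0.
by apply: measurableT_comp => //; exact: measurable_tcons.
Qed.

End lebesgue_tuple_tonelli.

(** * Affine changes of variables *)

Section affine.
Variable R : realType.

(** The image of the Lebesgue measure under z |-> x + r z, scaled by r, gives ]a, b] the length b -
    a, and this determines the Lebesgue measure. *)
Lemma ge0_integral_affine1 (x r : R) (g : measurableTypeR R -> \bar R) :
  0 < r -> measurable_fun setT g -> (forall y, 0 <= g y)%E ->
  (\int[lebesgue_measure]_y g y =
   r%:E * \int[lebesgue_measure]_z g (x + r * z)%R)%E.
Proof.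
move=> r0 mg g0.
have mphi : measurable_fun setT (fun z : measurableTypeR R => x + r * z : measurableTypeR R).
  by apply: measurable_funD => //; apply: measurable_funM.
pose phi := fun z : measurableTypeR R => x + r * z : measurableTypeR R.
pose nu_of : {measure set (measurableTypeR R) -> \bar R} :=
  mscale (NngNum (ltW r0)) (pushforward lebesgue_measure phi).
pose nu := nu_of mphi.
rewrite (@eq_measure_integral _ _ _ _ nu); last first.
  move=> A mA _; apply: lebesgue_measure_unique => // _ [[a b] _ <-] /=.
  rewrite /mscale /= /pushforward.
  have -> : phi @^-1` `]a, b] = `](a - x) / r, (b - x) / r]%classic.
    apply/seteqP; split => z /=; rewrite !in_itv/= ltr_pdivrMr// ler_pdivlMr//
      ltrBlDl lerBrDl (mulrC z); exact: id.
  rewrite !lebesgue_measure_itv /= !lte_fin ltr_pM2r ?invr_gt0// ltrD2r.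
  case: ifPn => _; last by rewrite mule0.
  by rewrite -!EFinD -EFinM -mulrBl opprB addrA subrK mulrC divfK// gt_eqF.
by rewrite /nu/= ge0_integral_mscale//= ge0_integral_pushforward.
Qed.

Definition aff d (x : Rn R d) (r : R) (z : Rn R d) : Rn R d :=
  [tuple (tnth x i + r * tnth z i)%R | i < d].

Lemma aff_tcons d (x z : R) (t u : Rn R d) r :
  aff (tcons (x, t)) r (tcons (z, u)) = tcons (x + r * z, aff t r u).
Proof.
apply: eq_from_tnth => i; rewrite tnth_mktuple.
case: (unliftP ord0 i) => [j|] ->; last by rewrite !tnth0.
by rewrite !tnthS tnth_mktuple.
Qed.

Lemma measurable_aff d : measurable_fun setT
  (fun p : Rn R d * R * Rn R d => aff p.1.1 p.1.2 p.2).
Proof.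
apply/measurable_fun_tnthP => i.
rewrite (_ : _ \o _ = fun p : Rn R d * R * Rn R d =>
    tnth p.1.1 i + p.1.2 * tnth p.2 i); last first.
  by apply/funext => p /=; rewrite tnth_mktuple.
have mt : measurable_fun setT (fun t : Rn R d => tnth t i : R) by exact: measurable_tnth.
apply: measurable_funD.
  by apply: (measurableT_comp mt); exact: measurableT_comp.
apply: measurable_funM; first exact: measurableT_comp.
by apply: (measurableT_comp mt); exact: measurable_snd.
Qed.

Lemma measurable_affl d r (z : Rn R d) : measurable_fun setT (fun x => aff x r z).
Proof.
apply: (measurableT_comp (@measurable_aff d) (g := fun x => (x, r, z))).
by apply: measurable_fun_pair => //; exact: measurable_fun_pair.
Qed.

Lemma measurable_affr d (x : Rn R d) r : measurable_fun setT (aff x r).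
Proof.
apply: (measurableT_comp (@measurable_aff d) (g := fun z => (x, r, z))).
by apply: measurable_fun_pair.
Qed.

Lemma ge0_integral_aff d (x : Rn R d) (r : R) (g : Rn R d -> \bar R) :
  0 < r -> measurable_fun setT g -> (forall y, 0 <= g y)%E ->
  (\int[lebesgue_tuple]_y g y =
   (r ^+ d)%:E * \int[lebesgue_tuple]_z g (aff x r z))%E.
Proof.
move=> r0; elim: d x g => [|d IH] x g mg g0.
  by rewrite !integral_lebesgue_tuple0 expr0 mul1e (tuple0 (aff _ _ _)).
have rd0 : 0 <= r ^+ d by rewrite exprn_ge0// ltW.
rewrite -(tconsK x); set x1 := (tuncons x).1; set x' := (tuncons x).2.
have -> : tuncons x = (x1, x') by [].
have mgc : measurable_fun setT (g \o @tcons R d).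
  by apply: measurableT_comp => //; exact: measurable_tcons.
have mgca : measurable_fun setT (fun p => g (tcons (p.1, aff x' r p.2))).
  apply: (measurableT_comp mgc (g := fun p => (p.1, aff x' r p.2))).
  apply: measurable_fun_pair => //.
  by apply: measurableT_comp; [exact: measurable_affr|].
rewrite ge0_integral_lebesgue_tupleS//.
rewrite (eq_integral (fun y => (r ^+ d)%:E *
    \int[lebesgue_tuple]_u g (tcons (y, aff x' r u)))%E); last first.
  move=> y _; rewrite (IH x')//.
  exact: (measurableT_comp mgc (pair1_measurable _)).
have mF : measurable_fun setT
    (fun y => \int[lebesgue_tuple]_u g (tcons (y, aff x' r u)))%E.
  exact: (measurable_fun_fubini_tonelli_F
    (fun p : measurableTypeR R * Rn R d => g (tcons (p.1, aff x' r p.2)))).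
rewrite ge0_integralZl//; last by move=> y _; apply: integral_ge0.
rewrite (@ge0_integral_affine1 x1 r)//; last by move=> y; apply: integral_ge0.
rewrite muleA -EFinM -exprSr; congr (_ * _)%E.
rewrite [RHS]ge0_integral_lebesgue_tupleS//.
  by apply: eq_integral => z _; apply: eq_integral => u _; rewrite aff_tcons.
by apply: measurableT_comp => //; exact: measurable_affr.
Qed.

End affine.

Lemma measurable_map_tuple d1 d2 (T1 : measurableType d1) (T2 : measurableType d2)
    k (phi : T1 -> T2) :
  measurable_fun setT phi -> measurable_fun setT (fun t : k.-tuple T1 => map_tuple phi t).
Proof.
move=> mphi; apply/measurable_fun_tnthP => i.
rewrite (_ : _ \o _ = phi \o (fun t : k.-tuple T1 => tnth t i)).
  by apply: measurableT_comp => //; exact: measurable_tnth.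
by apply/funext => t /=; rewrite tnth_map.
Qed.

(** The change of variables for one point enters as a hypothesis. It is used with [phi] the map
    [aff x r] and c = r^d; each of the k points contributes one factor c. *)
Lemma ge0_integral_map_tuple dT (T : measurableType dT) (R : realType)
    (mu : {sigma_finite_measure set T -> \bar R}) (phi : T -> T) (c : R) k
    (g : k.-tuple T -> \bar R) :
  0 <= c -> measurable_fun setT phi ->
  (forall h : T -> \bar R, measurable_fun setT h -> (forall x, 0 <= h x)%E ->
     (\int[mu]_x h x = c%:E * \int[mu]_x h (phi x))%E) ->
  measurable_fun setT g -> (forall t, 0 <= g t)%E ->
  (\int[tuple_measure mu k]_t g t =
   (c ^+ k)%:E * \int[tuple_measure mu k]_t g (map_tuple phi t))%E.
Proof.
move=> c0 mphi cphi; elim: k g => [|k IH] g mg g0.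
  by rewrite !integral_tuple0 expr0 mul1e (tuple0 (map_tuple _ _)).
have ck0 : 0 <= c ^+ k by rewrite exprn_ge0.
have mgc : measurable_fun setT (g \o @consp _ T k).
  by apply: measurableT_comp => //; exact: measurable_consp.
have mgca : measurable_fun setT (fun p => g (consp (p.1, map_tuple phi p.2))).
  apply: (measurableT_comp mgc (g := fun p => (p.1, map_tuple phi p.2))).
  apply: measurable_fun_pair => //.
  by apply: measurableT_comp; [exact: measurable_map_tuple|].
rewrite ge0_integral_tupleS//.
rewrite (eq_integral (fun y => (c ^+ k)%:E *
    \int[tuple_measure mu k]_u g (consp (y, map_tuple phi u)))%E); last first.
  move=> y _; rewrite IH//.
  exact: (measurableT_comp mgc (pair1_measurable _)).
have mF : measurable_fun setT
    (fun y => \int[tuple_measure mu k]_u g (consp (y, map_tuple phi u)))%E.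
  exact: (measurable_fun_fubini_tonelli_F
    (fun p : T * k.-tuple T => g (consp (p.1, map_tuple phi p.2)))).
rewrite ge0_integralZl//; last by move=> y _; apply: integral_ge0.
rewrite cphi//; last by move=> y; apply: integral_ge0.
rewrite muleA -EFinM -exprSr; congr (_ * _)%E.
rewrite [RHS]ge0_integral_tupleS//.
  apply: eq_integral => z _; apply: eq_integral => u _; congr g.
  exact: val_inj.
by apply: measurableT_comp => //; exact: measurable_map_tuple.
Qed.

(* Rectangles form a pi-system generating the product sigma-algebra. *)
Lemma tuple_measure_unique dT (T : measurableType dT) (R : realType) k
    (m1 m2 : {measure set (k.-tuple T) -> \bar R}) :
  (m1 setT < +oo)%E ->
  (forall A : 'I_k -> set T, (forall i, measurable (A i)) ->
    m1 [set t | forall i, A i (tnth t i)] = m2 [set t | forall i, A i (tnth t i)]) ->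
  forall B, measurable B -> m1 B = m2 B.
Proof.
move=> m1oo m12; pose G := [set [set t : k.-tuple T | forall i, A i (tnth t i)] |
  A in [set A : 'I_k -> set T | forall i, measurable (A i)]].
have GT : G setT.
  exists (fun=> setT) => //=; exact/seteqP.
apply: (@measure_unique _ _ _ G (fun=> setT)) => //.
- apply/seteqP; split; last first.
    apply: smallest_sub; first exact: sigma_algebra_measurable.
    move=> _ [A mA <-].
    rewrite (_ : [set _ | _] = \bigcap_(i in [set: 'I_k]) ((fun t => tnth t i) @^-1` A i)).
      apply: fin_bigcap_measurable => // i _; rewrite -[X in measurable X]setTI.
      exact: measurable_tnth.
    by apply/seteqP; split => t At; [move=> i _; exact: At|move=> i; exact: At].
  apply: smallest_sub; first exact: smallest_sigma_algebra.
  move=> B; rewrite -bigcup_seq => -[i _ [A mA <-]].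
  apply: sub_sigma_algebra; exists (fun j => if j == i then A else setT).
    by move=> j /=; case: ifP.
  rewrite setTI; apply/seteqP; split => t /=.
    by move=> /(_ i); rewrite eqxx.
  by move=> At j; case: eqP => // ->.
- move=> _ _ [A mA <-] [B mB <-]; exists (fun i => A i `&` B i).
    by move=> i; exact: measurableI.
  apply/seteqP; split => t /=.
    by move=> AB; split=> i; have [] := AB i.
  by move=> [At Bt] i; split.
- by rewrite bigcup_const//; exists 0%N.
- by move=> _ [A mA <-]; exact: m12.
Qed.

(** * Continuity of translations in L^1 *)

Section limits.
Context (R : realType).
Implicit Types u v : (\bar R)^nat.

Lemma cvge0_near_le u : (forall n, 0 <= u n)%E ->
  (forall e : R, 0 < e -> \forall n \near \oo, (u n <= e%:E)%E) ->
  u n @[n --> \oo] --> 0%E.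
Proof.
move=> u0 ue.
have ufin : \forall n \near \oo, u n \is a fin_num.
  near=> n; rewrite ge0_fin_numE//; apply: (@le_lt_trans _ _ 1%:E); last exact: ltry.
  by near: n; exact: ue.
apply/fine_cvgP; split => //; apply/cvgr0Pnorm_le => e e0; near=> n.
have un : u n \is a fin_num by near: n.
rewrite /= ger0_norm ?fine_ge0// -lee_fin fineK//.
by near: n; exact: ue.
Unshelve. all: by end_near. Qed.

Lemma cvge0_approx u : (forall n, 0 <= u n)%E ->
  (forall e : R, 0 < e -> exists2 v, v n @[n --> \oo] --> 0%E &
    forall n, (u n <= e%:E + v n)%E) ->
  u n @[n --> \oo] --> 0%E.
Proof.
move=> u0 uv; apply: cvge0_near_le => // e e0.
have e20 : 0 < e / 2 by rewrite divr_gt0.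
have [v v0 uev] := uv _ e20.
have /fine_cvgP[vfin /cvgr0Pnorm_le vcvg] := v0.
near=> n; apply: (le_trans (uev n)).
have vn : v n \is a fin_num by near: n.
rewrite -(fineK vn) -EFinD lee_fin [leRHS](splitr e) lerD2l.
apply: (le_trans (ler_norm _)).
by near: n; exact: vcvg.
Unshelve. all: by end_near. Qed.

Lemma dominated_cvge0 d (T : measurableType d) (mu : {measure set T -> \bar R})
    (u : nat -> T -> \bar R) (g : T -> \bar R) :
  (forall n, measurable_fun setT (u n)) -> (forall n x, 0 <= u n x)%E ->
  mu.-integrable setT g ->
  {ae mu, forall x n, (u n x <= g x)%E} ->
  {ae mu, forall x, u n x @[n --> \oo] --> 0%E} ->
  (\int[mu]_x u n x)%E @[n --> \oo] --> 0%E.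
Proof.
move=> mu_ u0 ig ug uc.
have [//| | | _ _] := @dominated_convergence _ _ _ mu setT measurableT u (cst 0%E) g mu_ _ _ ig.
- by apply: filterS uc => x xc _.
- by apply: filterS ug => x xg n _; rewrite gee0_abs.
- by rewrite integral0.
Qed.

Lemma cvgn_norm_bound (u : R^nat) (l : R) : u n @[n --> \oo] --> l ->
  exists2 H, 0 < H & forall n, `|u n| <= H.
Proof.
move=> ul; have cu : cvgn u by apply: (cvgP l).
have [M [_ HM]] := cvg_seq_bounded cu.
exists (`|M| + 1); first by rewrite ltr_wpDl.
by move=> n; apply: HM => //; rewrite (le_lt_trans (ler_norm _))// ltrDl.
Qed.

Lemma cvge0_le_eps u (e : R) : u n @[n --> \oo] --> 0%E -> 0 < e ->
  exists n, (u n <= e%:E)%E.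
Proof.
move=> /fine_cvgP[ufin /cvgr0Pnorm_le ucvg] e0.
suff /filter_ex : \forall n \near \oo, (u n <= e%:E)%E by [].
near=> n; have un : u n \is a fin_num by near: n.
rewrite -(fineK un) lee_fin (le_trans (ler_norm _))//.
by near: n; exact: ucvg.
Unshelve. all: by end_near. Qed.

End limits.

Section translation.
Variable R : realType.
Notation leb := (@lebesgue_measure R).
Implicit Types (f g : measurableTypeR R -> R) (h : R^nat).

Let measurable_shift (a : R) :
  measurable_fun setT (fun x : measurableTypeR R => x + a : measurableTypeR R).
Proof. by apply: measurable_funD. Qed.

Let ge0_integral_shift (a : R) (g : measurableTypeR R -> \bar R) :
  measurable_fun setT g -> (forall y, 0 <= g y)%E ->
  (\int[leb]_y g (y + a)%R = \int[leb]_y g y)%E.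
Proof.
move=> mg g0; rewrite [RHS](@ge0_integral_affine1 _ a 1)// mul1e.
by apply: eq_integral => y _; rewrite mul1r addrC.
Qed.

Let measurable_transl f (a : R) : measurable_fun setT f ->
  measurable_fun setT (fun x : measurableTypeR R => `|f (x + a) - f x|%:E).
Proof.
move=> mf; apply/measurable_EFinP; apply: measurableT_comp => //.
apply: measurable_funB => //.
exact: (measurableT_comp mf (measurable_shift a)).
Qed.

Let measurable_dist f g : measurable_fun setT f -> measurable_fun setT g ->
  measurable_fun setT (fun x : measurableTypeR R => `|f x - g x|%:E).
Proof.
move=> mf mg; apply/measurable_EFinP; apply: measurableT_comp => //.
exact: measurable_funB.
Qed.

(** Triangle inequality through g (x + a) and g x. By translation invariance the two differences
    between f and g have the same integral, whence the factor 2. *)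
Let transl_le f g (a : R) : measurable_fun setT f -> measurable_fun setT g ->
  (\int[leb]_x `|f (x + a)%R - f x|%:E <=
    2%:E * \int[leb]_x `|f x - g x|%:E + \int[leb]_x `|g (x + a)%R - g x|%:E)%E.
Proof.
move=> mf mg.
have mfg := measurable_dist mf mg.
have mga := @measurable_transl g a mg.
have mfga : measurable_fun setT (fun x : measurableTypeR R => `|f (x + a) - g (x + a)|%:E).
  exact: (measurableT_comp mfg (measurable_shift a)).
rewrite mule_natl mule2n -{1}(ge0_integral_shift a mfg)//.
rewrite -ge0_integralD// -ge0_integralD//; last 2 first.
- by move=> x _; rewrite adde_ge0.
- exact: emeasurable_funD.
apply: ge0_le_integral => //.
- exact: measurable_transl.
- by apply: emeasurable_funD => //; exact: emeasurable_funD.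
move=> x _; rewrite -!EFinD lee_fin.
rewrite (_ : f (x + a) - f x = (f (x + a) - g (x + a)) + (g x - f x) + (g (x + a) - g x)).
  by rewrite (le_trans (ler_normD _ _))// lerD2r (le_trans (ler_normD _ _))// lerD2l distrC.
by ring.
Qed.

Let transl_trunc (g : R -> R) (K : R) h : 0 < K -> continuous g ->
  h n @[n --> \oo] --> 0 ->
  let gK : measurableTypeR R -> R := fun x => g x * \1_(`[- K, K] : set R) x in
  (\int[leb]_x `|gK (x + h n)%R - gK x|%:E)%E @[n --> \oo] --> 0%E.
Proof.
move=> K0 cg h0 gK.
have [H H0 hH] := cvgn_norm_bound h0.
have [c _ gc] : exists2 c, c \in `[- K, K] & forall t, t \in `[- K, K] -> `|g t| <= `|g c|.
  apply: EVT_max; first by rewrite ge0_cp// ltW.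
  by apply: continuous_subspaceT => x; apply: continuous_comp; [exact: cg|exact: norm_continuous].
have gKc x : `|gK x| <= `|g c|.
  rewrite /gK indicE; case: (boolP (x \in _)) => [|_]; last by rewrite mulr0 normr0.
  by rewrite inE mulr1; exact: gc.
have gK0 x : K < `|x| -> gK x = 0.
  move=> Kx; rewrite /gK indicE memNset ?mulr0//= in_itv/= -ler_norml.
  by apply/negP; rewrite -ltNge.
have gKg x : `|x| < K -> gK x = g x.
  by move=> xK; rewrite /gK indicE mem_set ?mulr1//= in_itv/= -ler_norml ltW.
have mg : measurable_fun setT gK.
  apply: measurable_funM; first exact: continuous_measurable_fun.
  exact: measurable_indic.
(* H bounds all shifts, so every translate of [gK] vanishes outside [-(K + H), K + H], and |g c| is
   the maximum of |g| on [-K, K]. *)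
apply: (@dominated_cvge0 _ _ _ leb _
    (EFin \o (fun x => 2 * `|g c| * \1_(`[- (K + H), K + H] : set R) x))) => //.
- by move=> n; exact: measurable_transl.
- apply/integrableP; split.
    by apply/measurable_EFinP; apply: measurable_funM => //; exact: measurable_indic.
  under eq_integral => x _ do rewrite /= ger0_norm ?mulr_ge0// EFinM.
  rewrite ge0_integralZl_EFin//; last first.
    by apply/measurable_EFinP; exact: measurable_indic.
  rewrite integral_indic// setIT [X in (_ * X)%E]lebesgue_measure_itv/= lte_fin.
  by case: ifPn => _; rewrite ?mule0// -EFinB -EFinM ltry.
- apply: aeW => x n; rewrite lee_fin.
  rewrite indicE; case: (boolP (x \in _)) => [_|].
    by rewrite mulr1 (le_trans (ler_normB _ _))// mulr2n mulrDl !mul1r lerD.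
  rewrite notin_setE/= in_itv/= -ler_norml => /negP; rewrite -ltNge => KHx.
  rewrite !gK0 ?subrr ?normr0 ?mulr0//.
    by rewrite (le_lt_trans _ KHx)// lerDl ltW.
  rewrite -(ltrD2r H) (lt_le_trans KHx)//.
  rewrite -[X in `|X| <= _](addrK (h n)) (le_trans (ler_normB _ _))//.
  by rewrite lerD2l.
(* Truncation makes [gK] jump at -K and K only; elsewhere it is continuous. *)
- exists ([set - K] `|` [set K]); split.
  + by apply: measurableU; exact: measurable_set1.
  + apply/eqP; rewrite eq_le measure_ge0 andbT.
    rewrite (le_trans (measureU2 _ _ _))//; try exact: measurable_set1.
    by rewrite [X in (X + _)%E]lebesgue_measure_set1 [X in (_ + X)%E]lebesgue_measure_set1 adde0.
  move=> x /=; apply: contra_notP => /not_orP[/eqP xNK /eqP xK].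
  have xh : (x : R) + h n @[n --> \oo] --> (x : R).
    by rewrite -[X in _ --> X]addr0; apply: cvgD => //; exact: cvg_cst.
  have nxh : `|(x : R) + h n| @[n --> \oo] --> `|x : R| by exact: cvg_norm.
  have -> : 0%E = `|gK x - gK x|%:E :> \bar R by rewrite subrr normr0.
  apply: cvg_EFin; first exact: nearW.
  apply: cvg_norm; apply: cvgB; last exact: cvg_cst.
  have [Kx|xK'] := ltP K `|x|.
    rewrite gK0//; apply: cvg_near_cst; near=> n; apply: gK0.
    by near: n; exact: (cvgr_gt _ nxh).
  have {}xK' : `|x| < K.
    rewrite lt_neqAle xK' andbT; apply/eqP => xKE.
    move: xNK xK; rewrite -xKE; case: (ger0P x) => _; rewrite ?eqxx//.
    by rewrite opprK eqxx.
  rewrite gKg//; apply: (cvg_trans _ (continuous_cvg _ (cg x) xh)).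
  apply: near_eq_cvg; near=> n; apply/esym/gKg.
  by near: n; exact: (cvgr_lt _ nxh).
Unshelve. all: by end_near. Qed.

(** Integrable functions are approximated in L^1 by truncations of continuous functions, for which
    dominated convergence applies ([transl_trunc]). *)
Lemma cvg_L1_translation1 f h : leb.-integrable setT (EFin \o f) ->
  h n @[n --> \oo] --> 0 ->
  (\int[leb]_x `|f (x + h n)%R - f x|%:E)%E @[n --> \oo] --> 0%E.
Proof.
move=> intf h0.
have mf : measurable_fun setT f by apply/measurable_EFinP; exact: measurable_int intf.
apply: cvge0_approx => [n|e e0]; first by apply: integral_ge0.
(* Truncating f and replacing it by a continuous function cost e / 4 each, and [transl_le] counts
   their sum twice. *)
have e40 : 0 < e / 4 by rewrite divr_gt0.
have mtr (g : measurableTypeR R -> R) (K : R) : measurable_fun setT g ->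
    measurable_fun setT (fun x : measurableTypeR R => g x * \1_(`[- K, K] : set R) x).
  by move=> mg; apply: measurable_funM => //; exact: measurable_indic.
have [k fk] : exists k : nat,
    (\int[leb]_x `|f x - f x * \1_(`[- k.+1%:R, k.+1%:R] : set R) x|%:E <= (e / 4)%:E)%E.
  apply: cvge0_le_eps => //.
  apply: (@dominated_cvge0 _ _ _ leb _ (fun x => `|f x|%:E)) => //.
  - by move=> n; apply: measurable_dist => //; exact: mtr.
  - exact: integrable_abse intf.
  - apply: aeW => x n; rewrite lee_fin indicE; case: (x \in _).
      by rewrite mulr1 subrr normr0.
    by rewrite mulr0 subr0.
  - apply: aeW => x; apply: cvg_near_cst; near=> n.
    rewrite indicE mem_set ?mulr1 ?subrr ?normr0//= in_itv/= -ler_norml.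
    rewrite (@le_trans _ _ n%:R)// ?ler_nat//.
    by near: n; exact: nbhs_infty_ger.
set K : R := k.+1%:R in fk; have K0 : 0 < K by [].
pose I : set R := `[- K, K]%classic.
have leK : (leb I < +oo)%E.
  by rewrite /I lebesgue_measure_itv/=; case: ifP => // _; rewrite -EFinB ltry.
have [|g [cg ig gcv]] := approximation_continuous_integrable
    (measurable_itv _) leK (_ : leb.-integrable _ (EFin \o f)).
  exact: integrableS intf.
have [n gn] := cvge0_le_eps gcv e40.
have mg : measurable_fun setT (g n : measurableTypeR R -> R).
  exact: continuous_measurable_fun.
pose fK : measurableTypeR R -> R := fun x => f x * \1_(`[- K, K] : set R) x.
pose gK : measurableTypeR R -> R := fun x => g n x * \1_(`[- K, K] : set R) x.
exists (fun m => \int[leb]_x `|gK (x + h m)%R - gK x|%:E)%E.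
  exact: transl_trunc.
move=> m; apply: (le_trans (@transl_le f gK (h m) mf (mtr _ _ mg))).
rewrite leeD2r//.
have -> : e%:E = (2%:E * (e / 4 + e / 4)%:E)%E by rewrite -EFinM; congr EFin; field.
rewrite lee_pmul2l// EFinD.
apply: (@le_trans _ _ (\int[leb]_x (`|f x - fK x|%:E + `|fK x - gK x|%:E))%E).
  apply: ge0_le_integral => //.
  - by apply: measurable_dist => //; exact: mtr.
  - by apply: emeasurable_funD; apply: measurable_dist => //; exact: mtr.
  by move=> x _; rewrite -EFinD lee_fin ler_distD.
rewrite ge0_integralD//; last 2 first.
- by apply: measurable_dist => //; exact: mtr.
- by apply: measurable_dist => //; exact: mtr.
rewrite leeD//; apply: le_trans gn; rewrite [leRHS]integral_mkcond.
rewrite le_eqVlt; apply/orP; left; apply/eqP; apply: eq_integral => x _.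
rewrite /fK /gK patchE indicE -/I; case: (x \in I) => /=.
  by rewrite !mulr1.
by rewrite !mulr0 subrr normr0.
Unshelve. all: by end_near. Qed.

Lemma L1_translation_le1 f (a : R) : measurable_fun setT f ->
  (\int[leb]_x `|f (x + a)%R - f x|%:E <= 2%:E * \int[leb]_x `|f x|%:E)%E.
Proof.
move=> mf; have := @transl_le f (cst 0) a mf (measurable_cst _).
under [X in (_ * X + _)%E]eq_integral do rewrite /= subr0.
under [X in (_ + X)%E]eq_integral do rewrite /= subr0 normr0.
by rewrite integral0 adde0.
Qed.

End translation.

(** As a function of x, [aff x r z] is the translation by r z, that is, an affine map of ratio 1. *)
Lemma ge0_integral_affl (R : realType) d (r : R) (z : Rn R d) (g : Rn R d -> \bar R) :
  measurable_fun setT g -> (forall y, 0 <= g y)%E ->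
  (\int[lebesgue_tuple]_x g (aff x r z) = \int[lebesgue_tuple]_x g x)%E.
Proof.
move=> mg g0.
rewrite [RHS](@ge0_integral_aff _ _ (aff [tuple 0 | _ < d] r z) 1)// expr1n mul1e.
apply: eq_integral => x _; congr g; apply: eq_from_tnth => i.
by rewrite !tnth_mktuple add0r mul1r addrC.
Qed.

Lemma L1_aff_le (R : realType) d (r : R) (z : Rn R d) (f : Rn R d -> R) :
  measurable_fun setT f ->
  (\int[lebesgue_tuple]_x `|f (aff x r z) - f x|%:E <=
   2%:E * \int[lebesgue_tuple]_x `|f x|%:E)%E.
Proof.
move=> mf.
have maf : measurable_fun setT (fun x => `|f x|%:E).
  by apply/measurable_EFinP; exact: measurableT_comp.
have maff := measurableT_comp maf (@measurable_affl R d r z).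
rewrite mule_natl mule2n -[X in (X + _)%E](@ge0_integral_affl _ _ r z)//.
rewrite -ge0_integralD//; apply: ge0_le_integral => //.
- apply/measurable_EFinP; apply: measurableT_comp => //; apply: measurable_funB => //.
  exact: (measurableT_comp mf (@measurable_affl R d r z)).
- exact: emeasurable_funD.
by move=> x _; rewrite -EFinD lee_fin ler_normB.
Qed.

(** Induction on the dimension. The translation is split into one of the first coordinate ([A]) and
    one of the others ([B]); in [A] the shift of the other coordinates is absorbed by translation
    invariance. Each part integrates the translation errors of slices, which are dominated by twice
    the L^1 norm of the slice. *)
Lemma cvg_L1_aff (R : realType) d (z : Rn R d) (f : Rn R d -> R) (r : R^nat) :
  measurable_fun setT f -> (\int[lebesgue_tuple]_x `|f x|%:E < +oo)%E ->
  r n @[n --> \oo] --> 0 ->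
  (\int[lebesgue_tuple]_x `|f (aff x (r n) z) - f x|%:E)%E @[n --> \oo] --> 0%E.
Proof.
move=> + + r0; elim: d z f => [|d IH] z f mf fi.
  under eq_fun do rewrite integral_lebesgue_tuple0 (tuple0 (aff _ _ _)) subrr normr0.
  exact: cvg_cst.
rewrite -(tconsK z); set z1 := (tuncons z).1; set z' := (tuncons z).2.
have -> : tuncons z = (z1, z') by [].
have mabs (g : Rn R d.+1 -> R) : measurable_fun setT g ->
  measurable_fun setT (fun x => `|g x|%:E).
  by move=> mg; apply/measurable_EFinP; exact: measurableT_comp.
have mfc : measurable_fun setT (f \o @tcons R d).
  by apply: measurableT_comp => //; exact: measurable_tcons.
have mc1 (a : R) : measurable_fun setT
    (fun p : measurableTypeR R * Rn R d => (p.1 + a : measurableTypeR R, p.2)).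
  apply: measurable_fun_pair => //.
  by apply: measurable_funD => //; exact: measurable_fst.
have mc2 (s : R) : measurable_fun setT
    (fun p : measurableTypeR R * Rn R d => (p.1, aff p.2 s z')).
  apply: measurable_fun_pair => //.
  by apply: (measurableT_comp (@measurable_affl R d s z')).
pose A n := (\int[lebesgue_tuple]_t \int[lebesgue_measure]_x
  `|f (tcons ((x + r n * z1)%R, t)) - f (tcons (x, t))|%:E)%E.
pose B n := (\int[lebesgue_measure]_x \int[lebesgue_tuple]_t
  `|f (tcons (x, aff t (r n) z')) - f (tcons (x, t))|%:E)%E.
pose Ap n (p : measurableTypeR R * Rn R d) :=
  `|f (tcons (p.1 + r n * z1, p.2)) - f (tcons p)|%:E.
pose Bp n (p : measurableTypeR R * Rn R d) :=
  `|f (tcons (p.1, aff p.2 (r n) z')) - f (tcons p)|%:E.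
have Ap0 n p : (0 <= Ap n p)%E by rewrite lee_fin.
have Bp0 n p : (0 <= Bp n p)%E by rewrite lee_fin.
have mAp n : measurable_fun setT (Ap n).
  apply/measurable_EFinP; apply: measurableT_comp => //; apply: measurable_funB => //.
  exact: (measurableT_comp mfc (mc1 (r n * z1))).
have mBp n : measurable_fun setT (Bp n).
  apply/measurable_EFinP; apply: measurableT_comp => //; apply: measurable_funB => //.
  exact: (measurableT_comp mfc (mc2 (r n))).
have mfp : measurable_fun setT (fun p : measurableTypeR R * Rn R d => `|f (tcons p)|%:E).
  by apply/measurable_EFinP; exact: measurableT_comp.
have intf : (\int[lebesgue_measure]_x \int[lebesgue_tuple]_t `|f (tcons (x, t))|%:E < +oo)%E.
  by rewrite -(ge0_integral_lebesgue_tupleS (mabs _ mf)).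
have intf' : (\int[lebesgue_tuple]_t \int[lebesgue_measure]_x `|f (tcons (x, t))|%:E < +oo)%E.
  by rewrite -(ge0_integral_lebesgue_tupleSr (mabs _ mf)).
suff : (A n + B n)%E @[n --> \oo] --> (0 + 0)%E.
  rewrite adde0; apply: squeeze_cvge; last exact: cvg_cst.
  apply: nearW => n; apply/andP; split; first exact: integral_ge0.
  have mF : measurable_fun setT (fun x : Rn R d.+1 =>
      `|f (aff x (r n) (tcons (z1, z'))) - f x|%:E).
    apply: (mabs (fun x => f (aff x (r n) (tcons (z1, z'))) - f x)).
    apply: measurable_funB => //.
    exact: (measurableT_comp mf (@measurable_affl R d.+1 (r n) _)).
  rewrite ge0_integral_lebesgue_tupleS//.
  have mApn : measurable_fun setT (fun p : measurableTypeR R * Rn R d =>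
     Ap n (p.1, aff p.2 (r n) z')).
    exact: (measurableT_comp (mAp n) (mc2 (r n))).
  apply: (@le_trans _ _ (\int[lebesgue_measure]_x \int[lebesgue_tuple]_t
      (Ap n (x, aff t (r n) z') + Bp n (x, t)))%E).
    apply: ge0_le_integral => //.
    - by move=> x _; exact: integral_ge0.
    - exact: (measurable_fun_fubini_tonelli_F (fun p : measurableTypeR R * Rn R d =>
        `|f (aff (tcons p) (r n) (tcons (z1, z'))) - f (tcons p)|%:E)
        (measurableT_comp mF (@measurable_tcons R d))).
    - apply: (measurable_fun_fubini_tonelli_F (fun p : measurableTypeR R * Rn R d =>
        (Ap n (p.1, aff p.2 (r n) z') + Bp n p))%E).
      + exact: emeasurable_funD.
      + by move=> p; exact: adde_ge0.
    move=> x _; apply: ge0_le_integral => //.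
    - exact: (measurableT_comp (measurableT_comp mF (@measurable_tcons R d))
        (pair1_measurable _)).
    - apply: emeasurable_funD.
        exact: (measurableT_comp mApn (pair1_measurable _)).
      exact: (measurableT_comp (mBp n) (pair1_measurable _)).
    move=> t _; rewrite -EFinD lee_fin aff_tcons mulrC.
    exact: ler_distD.
  under eq_integral => x _.
    rewrite ge0_integralD//; last 2 first.
    - exact: (measurableT_comp mApn (pair1_measurable _)).
    - exact: (measurableT_comp (mBp n) (pair1_measurable _)).
    rewrite (@ge0_integral_affl _ _ _ _ (fun t => Ap n (x, t)))//; last first.
      exact: (measurableT_comp (mAp n) (pair1_measurable _)).
    over.
  rewrite /= ge0_integralD//.
  - by rewrite leeD// /A (fubini_tonelli (Ap n)).
  - by move=> x _; exact: integral_ge0.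
  - exact: measurable_fun_fubini_tonelli_F.
  - by move=> x _; exact: integral_ge0.
  - exact: (measurable_fun_fubini_tonelli_F (Bp n)).
apply: cvgeD => //.
- apply: (@dominated_cvge0 _ _ _ lebesgue_tuple _
    (fun t => 2%:E * \int[lebesgue_measure]_x `|f (tcons (x, t))|%:E)%E) => //.
  + by move=> n; exact: (measurable_fun_fubini_tonelli_G (Ap n)).
  + by move=> n t; exact: integral_ge0.
  + apply: integrableZl => //; apply/integrableP; split.
      exact: (measurable_fun_fubini_tonelli_G _ mfp).
    by under eq_integral do rewrite gee0_abs ?integral_ge0//.
  + apply: aeW => t n.
    exact: (L1_translation_le1 _ (measurableT_comp mfc (pair2_measurable _))).
  (* By Tonelli almost every slice of f is integrable, and the one-dimensional result applies to
     such slices. *)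
  + have : lebesgue_tuple.-integrable setT
        (fun t => \int[lebesgue_measure]_x `|f (tcons (x, t))|%:E)%E.
      apply/integrableP; split; first exact: (measurable_fun_fubini_tonelli_G _ mfp).
      by under eq_integral do rewrite gee0_abs ?integral_ge0//.
    move/(integrable_ae measurableT); apply: filterS => t /(_ I) tfin.
    apply: (@cvg_L1_translation1 _ (fun x => f (tcons (x, t)))).
      apply/integrableP; split.
        apply/measurable_EFinP; exact: (measurableT_comp mfc (pair2_measurable _)).
      by rewrite /= -ge0_fin_numE// integral_ge0.
    by rewrite -[X in _ --> X](mul0r z1); apply: cvgM => //; exact: cvg_cst.
- apply: (@dominated_cvge0 _ _ _ lebesgue_measure _
    (fun x => 2%:E * \int[lebesgue_tuple]_t `|f (tcons (x, t))|%:E)%E) => //.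
  + by move=> n; exact: (measurable_fun_fubini_tonelli_F (Bp n)).
  + by move=> n t; exact: integral_ge0.
  + apply: integrableZl => //; apply/integrableP; split.
      exact: (measurable_fun_fubini_tonelli_F _ mfp).
    by under eq_integral do rewrite gee0_abs ?integral_ge0//.
  + apply: aeW => x n.
    exact: (L1_aff_le _ _ (measurableT_comp mfc (pair1_measurable _))).
  + have : lebesgue_measure.-integrable setT
        (fun x => \int[lebesgue_tuple]_t `|f (tcons (x, t))|%:E)%E.
      apply/integrableP; split; first exact: (measurable_fun_fubini_tonelli_F _ mfp).
      by under eq_integral do rewrite gee0_abs ?integral_ge0//.
    move/(integrable_ae measurableT); apply: filterS => x /(_ I) tfin.
    apply: (IH z' (fun t => f (tcons (x, t)))).
      exact: (measurableT_comp mfc (pair1_measurable _)).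
    by rewrite -ge0_fin_numE// integral_ge0.
Qed.

(** * Factorial moments of the samples *)

Section tuple_bigops.
Local Close Scope classical_set_scope.

Lemma big_tupleS (M : Type) (idx : M) (op : Monoid.com_law idx) (J : finType) k
    (F : k.+1.-tuple J -> M) :
  \big[op/idx]_(t : k.+1.-tuple J) F t =
  \big[op/idx]_(x : J) \big[op/idx]_(t : k.-tuple J) F [tuple of x :: t].
Proof.
rewrite pair_big /=.
rewrite (reindex (fun p : J * k.-tuple J => [tuple of p.1 :: p.2]))//=.
exists (fun t => (thead t, [tuple of behead t])) => [[x t] _|t _].
  by congr pair; apply: val_inj.
by rewrite [RHS]tuple_eta; apply: val_inj.
Qed.

(* Such a tuple is given by one repetition-free tuple in each fibre of l.  When
   l x records to which of the given sets x belongs, the fibres are disjoint, so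
   their Poisson counts are independent. *)
Lemma card_uniq_label (J I : finType) (l : J -> I) k (s : 'I_k -> I) (V : {set J}) :
  (\sum_(t : k.-tuple J)
     [&& uniq t, all (mem V) t & [forall j, l (tnth t j) == s j]] =
   \prod_(a : I) #|[set x in V | l x == a]| ^_ #|[set j | s j == a]|)%N.
Proof.
elim: k s V => [|k IH] s V.
  rewrite (big_pred1 [tuple]); last by move=> t; apply/esym/eqP; exact: tuple0.
  rewrite /= (_ : [forall j, _]); last by apply/forallP => -[].
  by rewrite big1// => a _; rewrite [X in _ ^_ X]eq_card0// => -[].
rewrite big_tupleS.
pose s' j := s (lift ord0 j).
(* Once x is the first entry, the others form a repetition-free tuple in V without x. Only the fibre
   of s ord0 loses an element, in accordance with m ^_ (c + 1) = m * (m - 1) ^_ c. *)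
have inner x : (\sum_(t : k.-tuple J) [&& uniq [tuple of x :: t],
     all (mem V) [tuple of x :: t] & [forall j, l (tnth [tuple of x :: t] j) == s j]] =
   if (x \in V) && (l x == s ord0) then
    \prod_(a : I) #|[set y in V :\ x | l y == a]| ^_ #|[set j | s' j == a]| else 0)%N.
  rewrite -IH; case: ifP => xV.
    apply: eq_bigr => t _ /=; congr (nat_of_bool _).
    move/andP : xV => [xV lx].
    rewrite xV /= -!andbA.
    have -> : [forall j, l (tnth [tuple of x :: t] j) == s j] =
              [forall j, l (tnth t j) == s' j].
      apply/forallP/forallP => lt j; first by have := lt (lift ord0 j); rewrite tnthS.
      by case: (unliftP ord0 j) => [i|] ->; rewrite ?tnthS ?tnth0.
    have -> : all (mem (V :\ x)) t = (x \notin t) && all (mem V) t.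
      apply/allP/andP => [tV|[xt /allP tV] y yt].
        split; last by apply/allP => y /tV; rewrite !inE => /andP[].
        by apply/negP => /tV; rewrite !inE eqxx.
      by rewrite !inE; move: (tV y yt) => /= ->; rewrite andbT; apply: contraNneq xt => <-.
    by case: (x \in t); case: (uniq t); case: (all (mem V) t).
  apply: big1 => t _; apply/eqP; rewrite eqb0; apply/negP.
  move=> /and3P[_ /andP[xVV _] /forallP/(_ ord0)]; rewrite tnth0 => lx.
  by move: xV; rewrite (xVV : x \in V) lx.
under eq_bigr do rewrite inner.
rewrite -big_mkcond /= (bigD1 (s ord0))//=.
have cs a : #|[set j | s j == a]| = ((s ord0 == a) + #|[set j | s' j == a]|)%N.
  by rewrite -!sum1dep_card big_mkcond big_ord_recl /= -big_mkcond /=; congr addn.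
rewrite cs eqxx add1n ffactnS.
pose m := #|[set x in V | l x == s ord0]|.
rewrite (eq_bigr (fun=> m.-1 ^_ #|[set j | s' j == s ord0]| *
   \prod_(a | a != s ord0) #|[set x in V | l x == a]| ^_ #|[set j | s j == a]|)%N).
  rewrite sum_nat_const mulnA; congr (_ * _ * _)%N.
  by apply: eq_card => x; rewrite !inE.
move=> x /andP[xV /eqP lx]; rewrite (bigD1 (s ord0))//=; congr (_ ^_ _ * _)%N.
  rewrite /m (cardsD1 x [set x in V | l x == s ord0]) inE xV lx eqxx /=.
  by apply: eq_card => y; rewrite !inE andbA.
apply: eq_bigr => a as0; rewrite cs eq_sym (negbTE as0) add0n; congr (_ ^_ _).
apply: eq_card => y; rewrite !inE; case: (eqVneq y x) => //= ->.
by rewrite lx eq_sym (negbTE as0) andbF.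
Qed.

End tuple_bigops.

Lemma ge0_integral_tuple_prod dT (T : measurableType dT) (R : realType)
    (mu : {sigma_finite_measure set T -> \bar R}) k (g : 'I_k -> T -> R) (c : 'I_k -> R) :
  (forall i, measurable_fun setT (g i)) -> (forall i x, 0 <= g i x) ->
  (forall i, (\int[mu]_x (g i x)%:E = (c i)%:E)%E) ->
  (\int[tuple_measure mu k]_t (\prod_(i < k) g i (tnth t i))%:E =
   (\prod_(i < k) c i)%:E)%E.
Proof.
move=> mg g0; elim: k g c mg g0 => [|k IH] g c mg g0 gc.
  by rewrite integral_tuple0 !big_ord0.
rewrite ge0_integral_tupleS; last 2 first.
- apply/measurable_EFinP; apply: measurable_prod => i _.
  by apply: (measurableT_comp (mg i)); exact: measurable_tnth.
- by move=> t; rewrite lee_fin prodr_ge0.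
transitivity (\int[mu]_x ((g ord0 x)%:E * (\prod_(i < k) c (lift ord0 i))%:E))%E.
  apply: eq_integral => x _.
  transitivity (\int[tuple_measure mu k]_t
      ((g ord0 x)%:E * (\prod_(i < k) g (lift ord0 i) (tnth t i))%:E))%E.
    apply: eq_integral => t _; rewrite -EFinM; congr EFin; rewrite big_ord_recl tnth0.
    by congr (_ * _); apply: eq_bigr => i _; rewrite tnthS.
  rewrite ge0_integralZl//; last 3 first.
  - apply/measurable_EFinP; apply: measurable_prod => i _.
    by apply: (measurableT_comp (mg _)); exact: measurable_tnth.
  - by move=> t _; rewrite lee_fin prodr_ge0.
  - by rewrite lee_fin.
  by rewrite (IH (fun i => g (lift ord0 i)) (fun i => c (lift ord0 i))).
have c0 i : 0 <= c i by rewrite -lee_fin -gc; apply: integral_ge0 => x _; rewrite lee_fin.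
rewrite ge0_integralZr//; last 3 first.
- exact/measurable_EFinP.
- by move=> x _; rewrite lee_fin.
- by rewrite lee_fin prodr_ge0.
by rewrite gc -EFinM big_ord_recl.
Qed.

Lemma measurable_comp_nat d dU (T : measurableType d) (U : measurableType dU)
    (N : T -> nat) (g : nat -> U) :
  (forall k, measurable (N @^-1` [set k])) -> measurable_fun setT (fun w => g (N w)).
Proof.
move=> mN _ Y mY; rewrite setTI.
rewrite (_ : _ @^-1` _ = \bigcup_(k in [set k | Y (g k)]) N @^-1` [set k]).
  exact: bigcup_measurable.
by apply/seteqP; split => [w Yw|w [k /= Yk ->]//]; exists (N w).
Qed.

Section independence.
Context d (T : measurableType d) (R : realType) (P : {measure set T -> \bar R}).

(** D and c serve the induction on m: fixing N ord0 = k replaces D by its intersection with that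
    event and c by c * p ord0 k. *)
Lemma ge0_integral_indep_prod m (N : 'I_m -> T -> nat) (g : 'I_m -> nat -> R)
    (p : 'I_m -> nat -> R) (s : 'I_m -> R) (c : R) (D : set T) :
  (forall i k, measurable (N i @^-1` [set k])) -> measurable D ->
  (forall i k, 0 <= g i k) -> (forall i k, 0 <= p i k) -> 0 <= c ->
  (forall k : 'I_m -> nat,
    P (D `&` \bigcap_(i in [set: 'I_m]) N i @^-1` [set k i]) =
      (c * \prod_(i < m) p i (k i))%:E) ->
  (forall i, (\sum_(k <oo) (g i k * p i k)%:E = (s i)%:E)%E) ->
  (\int[P]_(w in D) (\prod_(i < m) g i (N i w))%:E = (c * \prod_(i < m) s i)%:E)%E.
Proof.
move=> + + + + + +; elim: m N g p s c D => [|m IH] N g p s c D mN mD g0 p0 c0 indep sE.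
  under eq_integral do rewrite big_ord0.
  rewrite big_ord0 integral_cst// mul1e mulr1; have := indep (fun=> 0%N).
  rewrite big_ord0 mulr1 => <-; congr (P _).
  by apply/seteqP; split => [w Dw|w []//]; split=> // -[].
pose D_ k := D `&` N ord0 @^-1` [set k].
have mD_ k : measurable (D_ k) by exact: measurableI.
have DE : D = \bigcup_k D_ k.
  by apply/seteqP; split => [w Dw|w [k _ []]//]; exists (N ord0 w).
have mgN i : measurable_fun setT (fun w => g i (N i w)).
  exact: measurable_comp_nat.
rewrite {1}DE ge0_integral_bigcup//; last 3 first.
- apply: (measurable_funS measurableT) => //; apply/measurable_EFinP.
  by apply: measurable_prod => i _.
- by move=> w _; rewrite lee_fin prodr_ge0.
- by apply/trivIsetP => i j _ _ /eqP ij; rewrite -subset0 => w [[_ /= Ni] [_ /= Nj]]; apply: ij; rewrite -Ni -Nj.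
rewrite (eq_eseriesr (g := fun k => ((g ord0 k * p ord0 k)%:E *
    (c * \prod_(i < m) s (lift ord0 i))%:E)%E)); last first.
  move=> k _.
  transitivity (\int[P]_(w in D_ k)
     ((g ord0 k)%:E * (\prod_(i < m) g (lift ord0 i) (N (lift ord0 i) w))%:E))%E.
    by apply: eq_integral => w; rewrite inE => -[_ /= Nw]; rewrite big_ord_recl Nw EFinM.
  rewrite ge0_integralZl//; last 3 first.
  - apply: (measurable_funS measurableT) => //; apply/measurable_EFinP.
    by apply: measurable_prod => i _.
  - by move=> w _; rewrite lee_fin prodr_ge0.
  - by rewrite lee_fin.
  rewrite (IH (fun i => N (lift ord0 i)) (fun i => g (lift ord0 i)) (fun i => p (lift ord0 i))
      (fun i => s (lift ord0 i)) (c * p ord0 k))//.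
  - by rewrite -!EFinM; congr EFin; ring.
  - by rewrite mulr_ge0.
  move=> k'; pose kk (i : 'I_m.+1) := if unlift ord0 i is Some j then k' j else k.
  have kk0 : kk ord0 = k by rewrite /kk unlift_none.
  have kkS i : kk (lift ord0 i) = k' i by rewrite /kk liftK.
  have := indep kk; rewrite big_ord_recl kk0 mulrA.
  under eq_bigr do rewrite kkS.
  move=> <-; congr (P _); apply/seteqP; split => w.
    move=> [[Dw Nw] Nw']; split => // i _ /=.
    by case: (unliftP ord0 i) => [j|] ->; rewrite ?kk0 ?kkS//; exact: Nw'.
  move=> [Dw Nw]; split; first by split => //; rewrite -kk0; exact: Nw.
  by move=> i _; rewrite -kkS; exact: Nw.
under eq_eseriesr do rewrite muleC.
rewrite nneseriesZl//; last first.
  by move=> k _; rewrite lee_fin mulr_ge0.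
rewrite sE -EFinM; congr EFin; rewrite [in RHS]big_ord_recl; ring.
Qed.

End independence.

(** The factorial moments of a Poisson law of rate l: terms with k < j vanish, and (k + j) ^_ j / (k
    + j)! = 1 / k! turns the others into l^j times the exponential series. *)
Lemma nneseries_poisson_ffact (R : realType) (l : R) j : 0 <= l ->
  (\sum_(k <oo) ((k ^_ j)%:R * (expR (- l) * l ^+ k / k`!%:R))%:E = (l ^+ j)%:E)%E.
Proof.
move=> l0; have f0 k : (0 <= ((k ^_ j)%:R * (expR (- l) * l ^+ k / k`!%:R))%:E)%E.
  by rewrite lee_fin !mulr_ge0 ?invr_ge0 ?exprn_ge0 ?expR_ge0.
rewrite (nneseries_split 0%N j)//.
rewrite add0n big_nat big1 ?add0e; last first.
  by move=> k /andP[_ kj]; rewrite ffact_small// mul0r.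
rewrite -nneseries_addn//.
rewrite (eq_eseriesr (g := fun k => (expR (- l) * l ^+ j)%:E * (exp_coeff l k)%:E)%E).
  rewrite nneseriesZl; last by move=> k _; rewrite lee_fin exp_coeff_ge0.
  have -> : (\sum_(k <oo) (exp_coeff l k)%:E = (expR l)%:E)%E.
    rewrite /expR -EFin_lim; last exact: is_cvg_series_exp_coeff.
    by apply/congr_lim/funext => n /=; rewrite sumEFin.
  by rewrite -EFinM mulrAC -expRD addNr expR0 mul1r.
move=> k _; rewrite -EFinM; congr EFin; rewrite /exp_coeff /=.
have -> : ((k + j)`!%:R = ((k + j) ^_ j)%:R * k`!%:R :> R).
  by rewrite -natrM -(@ffact_fact (k + j) j) ?leq_addl// addnK.
have ff0 : ((k + j) ^_ j)%:R != 0 :> R by rewrite pnatr_eq0 -lt0n ffact_gt0 leq_addl.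
have k0 : k`!%:R != 0 :> R by rewrite pnatr_eq0 -lt0n fact_gt0.
by rewrite exprD; field; rewrite ff0 k0.
Qed.

Section factorial_moments.
Variables (R : realType) (d : nat) (X : point_process R d).

Definition pp_tuple k w (t : k.-tuple 'I_(pp_size X w)) : k.-tuple (Rn R d) :=
  map_tuple (fun i : 'I_(pp_size X w) => pp_point X i w) t.

(** The indices are distinct, not necessarily the points. Coincident points are therefore counted,
    and the diagonal detects them. *)
Definition factorial_count k (B : set (k.-tuple (Rn R d))) (w : pp_space X) : R :=
  \sum_(t : k.-tuple 'I_(pp_size X w) | uniq t) \1_B (pp_tuple t).

(** The number of points varies with w, so the sample space is cut along the values of [pp_size]. *)
Lemma measurable_pp_size dT (T : measurableType dT) (F : nat -> pp_space X -> T) :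
  (forall n, measurable_fun setT (F n)) ->
  measurable_fun setT (fun w => F (pp_size X w) w).
Proof.
move=> mF _ Y mY; rewrite setTI.
rewrite (_ : _ @^-1` _ = \bigcup_n ((pp_size X @^-1` [set n]) `&` (F n @^-1` Y))).
  apply: bigcup_measurable => n _; apply: measurableI; first exact: measurable_funPTI.
  by rewrite -[X in measurable X]setTI; exact: mF.
by apply/seteqP; split => [w Yw|w [n _ [/= ->]]//]; exists (pp_size X w).
Qed.

Lemma measurable_factorial_count k (B : set (k.-tuple (Rn R d))) : measurable B ->
  measurable_fun setT (factorial_count B).
Proof.
move=> mB; pose F n (w : pp_space X) : R := \sum_(t : k.-tuple 'I_n | uniq t)
  \1_B (map_tuple (fun i : 'I_n => pp_point X i w) t).
suff mF n : measurable_fun setT (F n) by exact: measurable_pp_size mF.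
rewrite /F; under eq_fun do rewrite big_mkcond /=.
apply: measurable_sum => t; case: (uniq t) => //.
apply: (measurableT_comp (measurable_indic mB)).
apply/measurable_fun_tnthP => i.
rewrite (_ : _ \o _ = pp_point X (tnth t i)); first exact: measurable_funP.
by apply/funext => w /=; rewrite tnth_map.
Qed.

Lemma factorial_count_ge0 k (B : set (k.-tuple (Rn R d))) w : 0 <= factorial_count B w.
Proof. by apply: sumr_ge0 => t _; rewrite indicE. Qed.

Definition factorial_moment k (B : set (k.-tuple (Rn R d))) : \bar R :=
  (\int[pp_prob X]_w (factorial_count B w)%:E)%E.

Section measure_instance.
Variable k : nat.

Let factorial_moment0 : factorial_moment (set0 : set (k.-tuple (Rn R d))) = 0%E.
Proof.
rewrite /factorial_moment; under eq_integral do rewrite /factorial_count big1// ?indic0//.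
by rewrite integral0.
Qed.

Let factorial_moment_ge0 (B : set (k.-tuple (Rn R d))) : (0 <= factorial_moment B)%E.
Proof. by apply: integral_ge0 => w _; rewrite lee_fin factorial_count_ge0. Qed.

Let factorial_moment_sigma_additive : semi_sigma_additive (@factorial_moment k).
Proof.
move=> F mF tF mUF.
have -> : factorial_moment (\bigcup_n F n) = (\sum_(n <oo) factorial_moment (F n))%E.
  rewrite -integral_nneseries//; last 2 first.
  - by move=> n; apply/measurable_EFinP; exact: measurable_factorial_count.
  - by move=> n w _; rewrite lee_fin factorial_count_ge0.
  apply: eq_integral => w _; rewrite /factorial_count -sumEFin.
  under [RHS]eq_eseriesr do rewrite -sumEFin.
  rewrite nneseries_sum//; apply: eq_bigr => t _.
  (* At a fixed tuple of points the indicator is, as a function of the set, a Dirac measure. *)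
  rewrite -diracE measure_semi_bigcup//.
apply: is_cvg_nneseries => n _ _; exact: factorial_moment_ge0.
Qed.

HB.instance Definition _ := isMeasure.Build _ _ _ (@factorial_moment k)
  factorial_moment0 factorial_moment_ge0 factorial_moment_sigma_additive.

End measure_instance.

End factorial_moments.

Section density_measure.
Context dT (T : measurableType dT) (R : realType) (mu : {measure set T -> \bar R}).
Variables (g : T -> \bar R) (mg : measurable_fun setT g) (g0 : forall x, (0 <= g x)%E).

(** The two proofs are arguments so that the measure structure can be attached to the term
    itself. *)
Definition density_measure of measurable_fun setT g & (forall x, (0 <= g x)%E) :=
  fun B => (\int[mu]_(x in B) g x)%E.

Local Notation nu := (density_measure mg g0).

Let nu0 : nu set0 = 0%E. Proof. exact: integral_set0. Qed.

Let nu_ge0 B : (0 <= nu B)%E. Proof. by apply: integral_ge0 => x _. Qed.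

Let nu_sigma_additive : semi_sigma_additive nu.
Proof. exact: semi_sigma_additive_nng_induced. Qed.

HB.instance Definition _ := isMeasure.Build _ _ _ nu nu0 nu_ge0 nu_sigma_additive.

End density_measure.

Definition rectangle T k (A : 'I_k -> set T) : set (k.-tuple T) :=
  [set t | forall i, A i (tnth t i)].

Lemma indic_rectangle (R : realType) T k (A : 'I_k -> set T) (t : k.-tuple T) :
  \1_(rectangle A) t = \prod_(i < k) \1_(A i) (tnth t i) :> R.
Proof.
rewrite indicE; case: (boolP (t \in rectangle A)) => [|].
  rewrite inE => At; rewrite big1// => i _; rewrite indicE mem_set//; exact: At.
rewrite notin_setE => /existsNP[i Ai].
by rewrite (bigD1 i)//= indicE memNset// mul0r.
Qed.

Lemma measurable_rectangle dT (T : measurableType dT) k (A : 'I_k -> set T) :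
  (forall i, measurable (A i)) -> measurable (rectangle A).
Proof.
move=> mA.
rewrite (_ : rectangle A = \bigcap_(i in [set: 'I_k]) ((fun t => tnth t i) @^-1` A i)).
  apply: fin_bigcap_measurable => // i _; rewrite -[X in measurable X]setTI.
  exact: measurable_tnth.
by apply/seteqP; split => t At; [move=> i _; exact: At|move=> i; exact: At].
Qed.

Section density.
Variables (R : realType) (d : nat) (f : Rn R d -> R).
Hypothesis hf : bounded_density f.

Let mf : measurable_fun setT f. Proof. by case: hf. Qed.
Let f0 x : 0 <= f x. Proof. by case: hf. Qed.
Let f1 : (\int[lebesgue_tuple]_x (f x)%:E = 1)%E. Proof. by case: hf. Qed.

Lemma massE A : measurable A ->
  (\int[lebesgue_tuple]_(x in A) (f x)%:E = (mass f A)%:E)%E.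
Proof.
move=> mA; rewrite /mass /Rintegral fineK// ge0_fin_numE; last first.
  by apply: integral_ge0 => x _; rewrite lee_fin.
apply: (@le_lt_trans _ _ (\int[lebesgue_tuple]_x (f x)%:E)%E); last by rewrite f1 ltry.
by apply: ge0_subset_integral => // [|x _]; [exact/measurable_EFinP|rewrite lee_fin].
Qed.

Lemma mass_indicE A : measurable A ->
  (\int[lebesgue_tuple]_x (\1_A x * f x)%:E = (mass f A)%:E)%E.
Proof.
move=> mA; rewrite -massE// [RHS]integral_mkcond; apply: eq_integral => x _.
by rewrite patchE indicE; case: ifP => _; rewrite ?mul1r ?mul0r.
Qed.

Lemma mass_ge0 A : measurable A -> 0 <= mass f A.
Proof.
by move=> mA; rewrite -lee_fin -massE//; apply: integral_ge0 => x _; rewrite lee_fin.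
Qed.

Lemma massT : mass f setT = 1.
Proof. by apply: EFin_inj; rewrite -massE// f1. Qed.

Lemma measurable_prod_density k :
  measurable_fun setT (fun t : k.-tuple (Rn R d) => (\prod_(i < k) f (tnth t i))%:E).
Proof.
apply/measurable_EFinP; apply: measurable_prod => i _.
by apply: (measurableT_comp mf); exact: measurable_tnth.
Qed.

Lemma prod_density_ge0 k (t : k.-tuple (Rn R d)) :
  (0 <= (\prod_(i < k) f (tnth t i))%:E)%E.
Proof. by rewrite lee_fin prodr_ge0. Qed.

Lemma integral_rectangle k (A : 'I_k -> set (Rn R d)) :
  (forall i, measurable (A i)) ->
  (\int[tuple_measure lebesgue_tuple k]_(t in rectangle A)
     (\prod_(i < k) f (tnth t i))%:E = (\prod_(i < k) mass f (A i))%:E)%E.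
Proof.
move=> mA; rewrite -(@ge0_integral_tuple_prod _ _ _ lebesgue_tuple _
  (fun i x => \1_(A i) x * f x)).
- rewrite integral_mkcond; apply: eq_integral => t _.
  rewrite big_split /= -indic_rectangle patchE indicE.
  by case: ifP => _; rewrite ?mul1r ?mul0r.
- by move=> i; apply: measurable_funM => //; exact: measurable_indic.
- by move=> i x; rewrite mulr_ge0.
- by move=> i; exact: mass_indicE.
Qed.

(** The common interface of the two settings: the expected Euler characteristic is computed from
    this property alone, for any nonnegative a with convergent series of a (k + 1) / (k + 1)!. *)
Definition has_factorial_moments (a : nat -> R) (X : point_process R d) :=
  forall k (B : set (k.-tuple (Rn R d))), measurable B ->
  (factorial_moment X B = (a k)%:E *
    \int[tuple_measure lebesgue_tuple k]_(t in B) (\prod_(i < k) f (tnth t i))%:E)%E.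

(** Both sides are measures in B, of finite total mass, so [tuple_measure_unique] reduces their
    equality to rectangles. *)
Lemma has_factorial_momentsP (a : nat -> R) (X : point_process R d) :
  (forall k, 0 <= a k) ->
  (forall k (A : 'I_k -> set (Rn R d)), (forall i, measurable (A i)) ->
    factorial_moment X (rectangle A) = (a k * \prod_(i < k) mass f (A i))%:E) ->
  has_factorial_moments a X.
Proof.
move=> a0 rect k B mB.
pose nu : {measure set (k.-tuple (Rn R d)) -> \bar R} :=
  mscale (NngNum (a0 k)) (density_measure (tuple_measure lebesgue_tuple k)
    (@measurable_prod_density k) (@prod_density_ge0 k)).
have -> : factorial_moment X B = nu B.
  apply: tuple_measure_unique => //.
    have -> : [set: k.-tuple (Rn R d)] = rectangle (fun=> setT) by apply/seteqP.
    by rewrite /= rect// ltry.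
  by move=> A mA; rewrite /= rect// /nu /= /mscale/= /density_measure integral_rectangle.
by [].
Qed.

Lemma factorial_moment_rectangleE k (X : point_process R d) (A : 'I_k -> set (Rn R d)) :
  factorial_moment X (rectangle A) =
  (\int[pp_prob X]_w (\sum_(t : k.-tuple 'I_(pp_size X w) | uniq t)
    \prod_(j < k) \1_(A j) (pp_point X (tnth t j) w))%:E)%E.
Proof.
apply: eq_integral => w _; congr EFin; apply: eq_bigr => t _.
by rewrite indic_rectangle; apply: eq_bigr => j _; rewrite tnth_map.
Qed.

(** By independence each of the n ^_ k repetition-free tuples of indices contributes the same
    product of masses. *)
Lemma iid_sample_factorial_moments n (X : point_process R d) :
  iid_sample f n X -> has_factorial_moments (fun k => (n ^_ k)%:R) X.
Proof.
move=> [Xn XF Xind]; apply: has_factorial_momentsP => // k A mA.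
rewrite factorial_moment_rectangleE.
transitivity (\int[pp_prob X]_w
    (\sum_(t <- [seq t : k.-tuple 'I_n <- index_enum _ | uniq t])
    (\prod_(j < k) \1_(A j) (pp_point X (tnth t j) w))%:E))%E.
  by apply: eq_integral => w _; rewrite Xn big_filter sumEFin.
have mXA i B : measurable B -> measurable (pp_point X i @^-1` B).
  by move=> mB; exact: measurable_funPTI.
rewrite ge0_integral_sum//; last 2 first.
- move=> t; apply/measurable_EFinP; apply: measurable_prod => j _.
  by apply: (measurableT_comp (measurable_indic (mA j))); exact: measurable_funP.
- by move=> t w _; rewrite lee_fin prodr_ge0.
rewrite big_filter (eq_bigr (fun=> (\prod_(i < k) mass f (A i))%:E)).
  rewrite sumEFin sumr_const -[X in X%:E = _]mulr_natl; congr (_%:R * _)%:E.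
  rewrite -[in RHS](card_ord n) -card_uniq_tuples; apply: eq_card => t.
  by rewrite !inE all_predT.
(* The constraint on the i-th point: the set A j if i is the j-th entry of t, and the whole space if
   i is not in t. Independence of all n points then applies. *)
move=> t ut; pose A' (i : 'I_n) := \bigcap_(j in [set j | tnth t j = i]) A j.
have mA' i : measurable (A' i) by apply: fin_bigcap_measurable.
pose E := \bigcap_(i in [set: 'I_n]) pp_point X i @^-1` A' i.
have mE : measurable E by apply: fin_bigcap_measurable => // i _; exact: mXA.
transitivity (\int[pp_prob X]_w (\1_E w)%:E)%E.
  apply: eq_integral => w _; congr EFin.
  have [/set_mem Ew|Ew] := boolP (w \in E).
    rewrite indicE mem_set// big1// => j _.
    by rewrite indicE mem_set//; exact: (Ew (tnth t j) I j erefl).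
  rewrite indicE (negbTE Ew).
  have /existsNP[j Aj] : ~ forall j, A j (pp_point X (tnth t j) w).
    by move=> Aw; move/negP: Ew; apply; rewrite inE => i _ j /= <-; exact: Aw.
  by rewrite (bigD1 j)//= indicE memNset// mul0r.
rewrite integral_indic// setIT; apply: (eq_trans (Xind A' mA')); congr EFin.
have A'T (i : 'I_n) : i \notin t -> fine (pp_prob X (pp_point X i @^-1` A' i)) = 1.
  move=> it; rewrite (_ : A' i = setT) ?preimage_setT ?probability_setT//.
  apply/seteqP; split => // x _ j /= tj.
  by move: it; rewrite -tj mem_tnth.
rewrite (bigID (mem t)) /= [X in _ * X]big1 ?mulr1; last exact: A'T.
rewrite -big_uniq//= big_tuple; apply: eq_bigr => j _.
rewrite XF//=; congr (mass f _); apply/seteqP; split => x; first by apply.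
move=> Ax j' /= /eqP; rewrite -(inj_eq val_inj) => jj'.
by have /tuple_uniqP/(_ j' j) -> := ut => //; exact/val_inj/eqP.
Qed.

End density.

(** * Factorial moments of a Poisson sample *)

Section poisson.
Variables (R : realType) (d : nat) (f : Rn R d -> R).
Hypothesis hf : bounded_density f.
Variables (n : nat) (X : point_process R d).
Hypothesis hX : poisson_sample f n X.

Section labels.
Variables (k : nat) (A : 'I_k -> set (Rn R d)).
Hypothesis mA : forall i, measurable (A i).

Let L := {ffun 'I_k -> bool}.
Let l (x : Rn R d) : L := [ffun j => x \in A j].
Let E (a : L) := [set x | l x = a].
Let lam (a : L) := n%:R * mass f (E a).

Let mE a : measurable (E a).
Proof.
rewrite (_ : E a = \bigcap_(j in [set: 'I_k]) (if a j then A j else ~` A j)).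
  apply: fin_bigcap_measurable => // j _; case: (a j) => //; exact: measurableC.
apply/seteqP; split => x /=.
  move=> <- j _; rewrite ffunE; case: (boolP (x \in A j)); first by rewrite inE.
  by rewrite notin_setE.
move=> xa; apply/ffunP => j; rewrite ffunE; have := xa j I.
case: (a j); first by move=> ?; rewrite mem_set.
by move=> ?; rewrite memNset.
Qed.

Let lam_ge0 a : 0 <= lam a.
Proof. by rewrite mulr_ge0// (mass_ge0 hf). Qed.

(** The cells [E a] with a j true partition A j. *)
Let sum_lam j : \sum_(a : L) (a j)%:R * lam a = n%:R * mass f (A j).
Proof.
rewrite (eq_bigr (fun a : L => n%:R * ((a j)%:R * mass f (E a)))); last first.
  by move=> a _; rewrite /lam mulrCA.
rewrite -mulr_sumr; congr (_ * _); apply: EFin_inj.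
rewrite -(mass_indicE hf (mA j)) -sumEFin.
have [mf f0 _ _] := hf.
transitivity (\sum_(a : L) \int[lebesgue_tuple]_x ((a j)%:R * (\1_(E a) x * f x))%:E)%E.
  apply: eq_bigr => a _; under eq_integral do rewrite EFinM.
  rewrite ge0_integralZl_EFin//.
  - by rewrite mass_indicE.
  - by move=> x _; rewrite lee_fin mulr_ge0.
  - by apply/measurable_EFinP; apply: measurable_funM => //; exact: measurable_indic.
rewrite -ge0_integral_sum//; last 2 first.
- move=> a; apply/measurable_EFinP; apply: measurable_funM => //.
  by apply: measurable_funM => //; exact: measurable_indic.
- by move=> a x _; rewrite lee_fin !mulr_ge0.
apply: eq_integral => x _; rewrite sumEFin; congr EFin.
rewrite (bigD1 (l x))//= big1 ?addr0.
  by rewrite ffunE !indicE [x \in E _]mem_set// mul1r.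
by move=> a al; rewrite indicE memNset ?mul0r ?mulr0// => /= la; rewrite la eqxx in al.
Qed.

(** The tuples are grouped by the sequence s of the labels of their points. Within a group the
    product of indicators is constant, and [card_uniq_label] gives the size of the group. *)
Let sum_uniq_label w :
  \sum_(t : k.-tuple 'I_(pp_size X w) | uniq t)
    \prod_(j < k) \1_(A j) (pp_point X (tnth t j) w) =
  \sum_(s : {ffun 'I_k -> L}) (\prod_(j < k) (s j j)%:R) *
    \prod_(a : L) (pp_count (E a) w ^_ #|[pred j | s j == a]|)%:R :> R.
Proof.
rewrite (partition_big (fun t : k.-tuple 'I_(pp_size X w) =>
  [ffun j => l (pp_point X (tnth t j) w)]) predT)//=.
apply: eq_bigr => s _.
rewrite (eq_bigr (fun=> \prod_(j < k) (s j j)%:R)); last first.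
  move=> t /andP[_ /eqP <-]; apply: eq_bigr => j _.
  by rewrite !ffunE indicE.
rewrite sumr_const -mulr_natr; congr (_ * _).
rewrite -natr_prod; congr (_%:R).
pose lab (i : 'I_(pp_size X w)) := l (pp_point X i w).
transitivity (\sum_(t : k.-tuple 'I_(pp_size X w))
  [&& uniq t, all (mem [set: 'I_(pp_size X w)]%SET) t
    & [forall j, lab (tnth t j) == s j]])%N.
  rewrite -sum1_card big_mkcond; apply: eq_bigr => t _. rewrite unfold_in /=.
  have -> : all (mem [set: 'I_(pp_size X w)]%SET) t by apply/allP => i _; rewrite inE.
  rewrite /=; have -> : [forall j, lab (tnth t j) == s j] =
      ([ffun j => l (pp_point X (tnth t j) w)] == s).
    apply/forallP/eqP => [ts|<- j]; last by rewrite ffunE.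
    by apply/ffunP => j; rewrite ffunE; exact/eqP/ts.
  by case: (_ && _).
rewrite card_uniq_label; apply: eq_bigr => a _; congr (_ ^_ _); last by rewrite cardsE.
rewrite /pp_count -sum1_card big_mkcond; apply: eq_bigr => i _; rewrite !inE /=.
rewrite /lab; case: eqP => [la|la]; first by rewrite mem_set.
by rewrite memNset.
Qed.

Let measurable_count (B : set (Rn R d)) j :
  measurable B -> measurable [set w : pp_space X | pp_count B w = j].
Proof.
move=> mB.
pose F m (w : pp_space X) : R := \sum_(i < m) \1_B (pp_point X i w).
have FE w : F (pp_size X w) w = (pp_count B w)%:R.
  by rewrite /F natr_sum; apply: eq_bigr => i _; rewrite indicE.
have mF m : measurable_fun setT (F m).
  apply: measurable_sum => i.
  by apply: (measurableT_comp (measurable_indic mB)); exact: measurable_funP.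
have := measurable_pp_size mF measurableT (measurable_set1 j%:R); rewrite setTI.
congr measurable; apply/seteqP; split => w /=; rewrite FE; last by move=> ->.
by move/eqP; rewrite eqr_nat => /eqP.
Qed.

Let integral_prod_ffact (c : L -> nat) :
  (\int[pp_prob X]_w (\prod_(a : L) (pp_count (E a) w ^_ c a)%:R)%:E =
   (\prod_(a : L) lam a ^+ c a)%:E)%E.
Proof.
have [law indep] := hX.
(* Independence is given for families indexed by ordinals, hence the enumeration of the labels. *)
pose e := @enum_val L predT : 'I_#|L| -> L.
have bige (F : L -> R) : \prod_(a : L) F a = \prod_(i < #|L|) F (e i).
  by rewrite (reindex e)//; exact/onW_bij/enum_val_bij.
rewrite bige; under eq_integral do rewrite bige.
rewrite (@ge0_integral_indep_prod _ _ _ (pp_prob X) _ (fun i => pp_count (E (e i)))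
  (fun i j => (j ^_ c (e i))%:R)
  (fun i j => expR (- lam (e i)) * lam (e i) ^+ j / j`!%:R)
  (fun i => lam (e i) ^+ c (e i)) 1)//.
- by rewrite mul1r.
- by move=> i j; exact: measurable_count.
- by move=> i j; rewrite !mulr_ge0 ?invr_ge0 ?exprn_ge0 ?expR_ge0.
- move=> j; rewrite setTI mul1r; apply: (eq_trans (indep _ (fun i => E (e i)) j _ _)).
  + by move=> i; exact: mE.
  + apply/trivIsetP => i i' _ _ ii'; rewrite -subset0 => x [/= xi xi'].
    by move/eqP : ii'; apply; apply: (@enum_val_inj _ predT); rewrite -/e -xi -xi'.
  congr EFin; apply: eq_bigr => i _.
  by rewrite law.
- by move=> i; exact: nneseries_poisson_ffact.
Qed.

Lemma poisson_factorial_moment_rectangle :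
  factorial_moment X (rectangle A) = (n%:R ^+ k * \prod_(i < k) mass f (A i))%:E.
Proof.
rewrite factorial_moment_rectangleE.
under eq_integral do rewrite sum_uniq_label -sumEFin.
rewrite ge0_integral_sum//; last 2 first.
- move=> s; apply/measurable_EFinP; apply: measurable_funM => //.
  apply: measurable_prod => a _.
  apply: (@measurable_comp_nat _ _ _ _ (pp_count (E a))
    (fun i => (i ^_ #|[pred j | s j == a]|)%:R : R)) => i.
  exact: measurable_count.
- by move=> s w _; rewrite lee_fin mulr_ge0// prodr_ge0.
transitivity (\sum_(s : {ffun 'I_k -> L}) (\prod_(j < k) ((s j j)%:R * lam (s j)))%:E)%E.
  apply: eq_bigr => s _; under eq_integral do rewrite EFinM.
  rewrite ge0_integralZl_EFin//; last 3 first.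
  - by move=> w _; rewrite lee_fin prodr_ge0.
  - apply/measurable_EFinP; apply: measurable_prod => a _.
    apply: (@measurable_comp_nat _ _ _ _ (pp_count (E a))
      (fun i => (i ^_ #|[pred j | s j == a]|)%:R : R)) => i.
    exact: measurable_count.
  - by rewrite prodr_ge0.
  rewrite integral_prod_ffact -EFinM big_split /=; congr (_ * _)%:E.
  (* Grouping the j by the value of s j collects the factors lam (s j) into powers of the lam a. *)
  rewrite (partition_big s predT)//=; apply: eq_bigr => a _.
  by rewrite (eq_bigr (fun=> lam a)) ?prodr_const// => j /eqP ->.
(* By distributivity the sum over all s becomes a product over j of sums over labels, evaluated by
   [sum_lam]. *)
rewrite sumEFin -(bigA_distr_bigA (fun j (a : L) => (a j)%:R * lam a)); congr EFin.
rewrite (eq_bigr (fun j => n%:R * mass f (A j))); last by move=> j _; exact: sum_lam.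
by rewrite big_split /= prodr_const card_ord.
Qed.

End labels.

Lemma poisson_sample_factorial_moments : has_factorial_moments f (fun k => n%:R ^+ k) X.
Proof.
apply: has_factorial_momentsP => // k A mA.
exact: poisson_factorial_moment_rectangle.
Qed.

End poisson.

(** * Euler characteristic of the Cech complex *)

Lemma cvg_sumr (R : realType) T (F : set_system T) (FF : Filter F) J (s : seq J)
    (f : J -> T -> R) (l : J -> R) : (forall j, f j x @[x --> F] --> l j) ->
  (\sum_(j <- s) f j x) @[x --> F] --> \sum_(j <- s) l j.
Proof.
move=> fl; elim: s => [|j s IH].
  by under eq_fun do rewrite big_nil; rewrite big_nil; exact: cvg_cst.
by under eq_fun do rewrite big_cons; rewrite big_cons; exact: cvgD.
Qed.

(** * Measurability and scaling of the condition that balls meet *)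

Section balls.
Variables (R : realType) (d : nat).
Implicit Types (x y : Rn R d) (r : R).

Definition sqdist x y : R := \sum_(i < d) ((tnth x i : R) - tnth y i) ^+ 2.

Lemma eucl_dist_le x y r : 0 <= r -> (eucl_dist x y <= r) = (sqdist x y <= r ^+ 2).
Proof. by move=> r0; rewrite -{1}(ger0_norm r0) -sqrtr_sqr ler_sqrt// sqr_ge0. Qed.

Lemma sqdist_coord x y (s : R) i : sqdist x y <= s -> (tnth x i - tnth y i) ^+ 2 <= s.
Proof.
apply: le_trans; rewrite /sqdist (bigD1 i)//= lerDl.
by apply: sumr_ge0 => j _; rewrite sqr_ge0.
Qed.

Lemma sqdist_coord_le x y r i : 0 <= r -> sqdist x y <= r ^+ 2 -> `|tnth x i - tnth y i| <= r.
Proof.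
by move=> r0 /(@sqdist_coord _ _ _ i); rewrite -real_normK ?num_real// ler_pXn2r// nnegrE.
Qed.

Definition balls_meet r k : set (k.-tuple (Rn R d)) :=
  [set t | exists y, forall i, sqdist (tnth t i) y <= r ^+ 2].

Let grid m (q : d.-tuple int) : Rn R d := [tuple (tnth q i)%:~R / m.+1%:R | i < d].

(* Moving the common point of the balls to a point of the grid of mesh 1 / (m + 1)
   increases the squared distances to the centres by at most [slack r m]; this
   makes [balls_meet] a countable intersection of countable unions. *)
Let slack r m : R := d%:R * (2 * r / m.+1%:R + m.+1%:R^-1 ^+ 2).

Let slack_le r m n : 0 <= r -> (m <= n)%N -> slack r n <= slack r m.
Proof.
move=> r0 mn; have imn : n.+1%:R^-1 <= m.+1%:R^-1 :> R by rewrite lef_pV2 ?posrE// ler_nat.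
rewrite ler_wpM2l// lerD//; first by rewrite ler_wpM2l// mulr_ge0.
by rewrite ler_pXn2r// nnegrE invr_ge0.
Qed.

Let slack_cvg r : slack r m @[m --> \oo] --> 0.
Proof.
have h : (m.+1%:R^-1 : R) @[m --> \oo] --> 0 := @cvg_harmonic R.
rewrite (_ : 0 = d%:R * (2 * r * 0 + 0 * 0)); last by rewrite !mulr0 addr0 mulr0.
apply: cvgM; first exact: cvg_cst.
apply: cvgD; first by apply: cvgM => //; exact: cvg_cst.
by under eq_fun do rewrite expr2; exact: cvgM.
Qed.

(** In each coordinate |x - y| <= r and 0 <= y - q <= e with e = 1 / (m + 1) give (x - q)^2 <= (x -
    y)^2 + 2 r e + e^2. Summing over the d coordinates yields [slack]. *)
Let grid_approx r m x y : 0 <= r -> sqdist x y <= r ^+ 2 ->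
  sqdist x (grid m [tuple Num.floor (tnth y i * m.+1%:R) | i < d]) <= r ^+ 2 + slack r m.
Proof.
move=> r0 xy.
have -> : slack r m = \sum_(i < d) (2 * r / m.+1%:R + m.+1%:R^-1 ^+ 2).
  by rewrite sumr_const card_ord -[RHS]mulr_natl.
apply: (@le_trans _ _ (sqdist x y + \sum_(i < d) (2 * r / m.+1%:R + m.+1%:R^-1 ^+ 2))).
  rewrite {2}/sqdist -big_split /=; apply: ler_sum => i _; rewrite !tnth_mktuple.
  have m0 : (0 : R) < m.+1%:R by [].
  set q := (Num.floor _)%:~R / m.+1%:R; set e : R := m.+1%:R^-1.
  have /andP[ql qu] := floor_itv (tnth y i * m.+1%:R).
  have q1 : q <= tnth y i by rewrite ler_pdivrMr.
  have q2 : tnth y i - q <= e.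
    rewrite lerBlDl -(ler_pM2r m0) mulrDl divfK ?gt_eqF// mulVf ?gt_eqF//.
    by move: qu; rewrite intrD => /ltW.
  have := sqdist_coord_le i r0 xy; rewrite ler_norml => /andP[a1 a2].
  nra.
by rewrite lerD2r.
Qed.

Lemma balls_meetE r k : 0 <= r -> @balls_meet r k.+1 =
  \bigcap_m \bigcup_(q : d.-tuple int)
    [set t | forall i, sqdist (tnth t i) (grid m q) <= r ^+ 2 + slack r m].
Proof.
move=> r0; apply/seteqP; split => [t [y ty] m _|t tm].
  by exists [tuple Num.floor (tnth y i * m.+1%:R) | i < d] => // i; exact: grid_approx.
have {tm} /choice[q tq] m : exists q, forall i,
    sqdist (tnth t i) (grid m q) <= r ^+ 2 + slack r m.
  by have [q _ tq] := tm m I; exists q.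
(* The grid points are moved to row vectors for their topology. They stay in a box around the first
   centre, so they have a cluster point, which will be the common point of the balls. *)
pose v m : 'rV[R]_d := \row_j tnth (grid m (q m)) j.
(* If x^2 <= B - 1 then |x| <= B, because 2 |x| <= x^2 + 1. *)
pose B : R := r ^+ 2 + slack r 0 + 1.
pose J j : set R := `[tnth (tnth t ord0) j - B, tnth (tnth t ord0) j + B]%classic.
pose K : set 'rV[R]_d := [set w | forall j, J j (w ord0 j)].
have cK : compact K by apply: (@rV_compact _ _ J) => j; exact: segment_compact.
have Kv : (v @ \oo) K.
  exists 0%N => // m _ j; rewrite mxE /J /= in_itv/=.
  have := sqdist_coord j (tq m ord0).
  have := slack_le r0 (leq0n m).
  rewrite /B; set a := slack r m; set b := slack r 0 => ab h.
  set x := (X in X ^+ 2) in h; have := sqr_ge0 (x - 1); have := sqr_ge0 (x + 1).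
  have := sqr_ge0 x; rewrite sqrrD sqrrB expr1n !mulr1 => x0 h1 h2.
  have : -(r ^+ 2 + b + 1) <= x <= r ^+ 2 + b + 1 by apply/andP; split; lra.
  by rewrite /x; move=> /andP[x1 x2]; apply/andP; split; lra.
have [y [_ cy]] := cK (v @ \oo) _ Kv.
pose yt : Rn R d := [tuple y ord0 j | j < d].
exists yt => i.
(* For fixed M the bound is a closed condition, satisfied by all grid points of index m >= M because
   [slack] decreases; it passes to the cluster point. Then M tends to infinity. *)
have yM M : sqdist (tnth t i) yt <= r ^+ 2 + slack r M.
  pose C : set 'rV[R]_d := [set w |
    \sum_(j < d) (tnth (tnth t i) j - w ord0 j) ^+ 2 <= r ^+ 2 + slack r M].
  have cC : closed C.
    pose phi (w : 'rV[R]_d) : R := \sum_(j < d) (tnth (tnth t i) j - w ord0 j) ^+ 2.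
    suff : closed (phi @^-1` [set x | x <= r ^+ 2 + slack r M]) by [].
    apply: preimage_closed; last exact: closed_le.
    move=> w _; apply: (@cvg_sumr R _ (nbhs w) _) => j.
    have h : (tnth (tnth t i) j : R) - w' ord0 j @[w' --> w] -->
        (tnth (tnth t i) j : R) - w ord0 j.
      by apply: cvgB; [exact: cvg_cst|exact: coord_continuous].
    by rewrite expr2; under eq_fun do rewrite expr2; exact: cvgM.
  have : C y.
    rewrite [C](closure_id _).1//; move=> U Uy; apply: cy => //.
    exists M => // m /= Mm; rewrite /C /=.
    under eq_bigr do rewrite mxE.
    by apply: (le_trans (tq m i)); rewrite lerD2l slack_le.
  by rewrite /C /= /sqdist; under [X in _ -> X <= _]eq_bigr do rewrite tnth_mktuple.
have cs : r ^+ 2 + slack r M @[M --> \oo] --> r ^+ 2.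
  by rewrite -[X in _ --> X]addr0; apply: cvgD => //; exact: cvg_cst.
rewrite -(cvg_lim _ cs)//; apply: limr_ge; first by apply: cvgP cs.
exact: nearW.
Qed.

Lemma measurable_sqdist y : measurable_fun setT (sqdist ^~ y).
Proof.
apply: measurable_sum => i; apply: measurable_funX; apply: measurable_funB => //.
exact: measurable_tnth.
Qed.

Lemma measurable_balls_meet r k : 0 <= r -> measurable (@balls_meet r k.+1).
Proof.
move=> r0; rewrite balls_meetE//; apply: bigcap_measurable => // m _.
apply: countable_bigcupT_measurable => // q.
rewrite (_ : [set _ | _] = \bigcap_(i in [set: 'I_k.+1])
  ((fun t => sqdist (tnth t i) (grid m q)) @^-1` `]-oo, r ^+ 2 + slack r m]%classic)).
  apply: fin_bigcap_measurable => // i _.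
  rewrite -[X in measurable X]setTI.
  apply: (measurableT_comp (@measurable_sqdist (grid m q))) => //.
  exact: measurable_tnth.
apply/seteqP; split => t tS; first by move=> i _ /=; rewrite in_itv/=; exact: tS.
by move=> i; have := tS i I; rewrite /= in_itv.
Qed.

Lemma balls_meet_aff x r k (t : k.-tuple (Rn R d)) : 0 < r ->
  balls_meet r (map_tuple (aff x r) t) <-> balls_meet 1 t.
Proof.
move=> r0; have sq z y : sqdist (aff x r z) (aff x r y) = r ^+ 2 * sqdist z y.
  rewrite /sqdist mulr_sumr; apply: eq_bigr => i _; rewrite !tnth_mktuple; ring.
have r20 : 0 < r ^+ 2 by rewrite exprn_gt0.
split=> -[y ty].
  pose y' : Rn R d := [tuple (tnth y i - tnth x i) / r | i < d].
  have yE : aff x r y' = y.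
    apply: eq_from_tnth => j; rewrite !tnth_mktuple.
    by rewrite mulrCA divff ?gt_eqF// mulr1 addrC subrK.
  exists y' => i; rewrite -(ler_pM2l r20) -sq expr1n mulr1 yE.
  by have := ty i; rewrite tnth_map.
exists (aff x r y) => i; rewrite tnth_map sq.
by rewrite -[leRHS]mulr1 ler_pM2l//; have := ty i; rewrite expr1n.
Qed.

(** Each coordinate of the common point is within 1 of that of the origin and of that of z_i. *)
Lemma balls_meet_bound k (z : k.-tuple (Rn R d)) i j :
  balls_meet 1 (consp ([tuple 0 | _ < d] : Rn R d, z)) -> `|tnth (tnth z i) j| <= 2.
Proof.
move=> [y zy].
have := sqdist_coord_le j ler01 (zy ord0).
have := sqdist_coord_le j ler01 (zy (lift ord0 i)).
rewrite tnth0 tnthS tnth_mktuple sub0r normrN => h1 h2.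
rewrite -[X in `|X|](subrK (tnth y j)) (le_trans (ler_normD _ _))//.
by rewrite [leRHS](_ : 2 = 1 + 1)// lerD.
Qed.

End balls.

Arguments balls_meet {R d} r {k}.

(** A set of k elements is enumerated by k! repetition-free tuples. *)
Lemma sum_uniq_tuple_set (R : pzRingType) (J : finType) k (g : {set J} -> R) :
  \sum_(t : k.-tuple J | uniq t) g [set i in t]%SET =
  k`!%:R * \sum_(S : {set J} | #|S| == k) g S.
Proof.
rewrite (partition_big (fun t : k.-tuple J => [set i in t]%SET) (fun S => #|S| == k))/=.
  rewrite mulr_sumr; apply: eq_bigr => S /eqP Sk.
  rewrite (eq_bigr (fun=> g S)); last by move=> t /andP[_ /eqP ->].
  rewrite sumr_const mulr_natl; congr (_ *+ _).
  have -> : k`! = (#|S| ^_ k)%N by rewrite Sk ffactnn.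
  rewrite -card_uniq_tuples; apply: eq_card => t.
  rewrite !inE unfold_in /= andbC; have [ut|] := boolP (uniq t); last by rewrite !andbF.
  rewrite !andbT; apply/eqP/allP => [<- i it|tS].
    by suff : i \in [set x in t]%SET by []; rewrite inE.
  apply/eqP; rewrite eqEcard Sk; apply/andP; split.
    by apply/fintype.subsetP => i; rewrite inE; exact: tS.
  by rewrite cardsE (card_uniqP ut) size_tuple.
move=> t ut; rewrite cardsE; apply/eqP.
by rewrite (card_uniqP ut) size_tuple.
Qed.

(** * The Euler characteristic as a sum over tuples of indices *)

Section euler.
Variables (R : realType) (d N : nat) (p : 'I_N -> Rn R d) (r : R).
Hypotheses (p_inj : injective p) (r0 : 0 <= r).

Let meet (S : {set 'I_N}) := `[< exists y, forall i, i \in S -> sqdist (p i) y <= r ^+ 2 >].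

Let img (S : {set 'I_N}) : {fset Rn R d} := [fset x in [seq p i | i <- enum S]]%fset.

Let img_inj : injective img.
Proof.
move=> S S' SS'; apply/setP => i; have := congr1 (fun s : {fset Rn R d} => p i \in s) SS'.
by rewrite !inE /= !(mem_map p_inj) !mem_enum.
Qed.

Let card_img S : #|` img S| = #|S|.
Proof.
rewrite card_fseq undup_id ?size_map -?cardE//.
by rewrite map_inj_uniq// enum_uniq.
Qed.

(** Injectivity of p makes simplices correspond to sets of indices. Only membership in C counts, so
    that the lemma applies to [pp_config]. *)
Let cechE (C : {fset Rn R d}) : C =i [seq p i | i <- enum 'I_N] ->
  perm_eq (cech r C) [seq img A | A <- enum [pred A : {set 'I_N} | (A != finset.set0) && meet A]].
Proof.
move=> CE; apply: uniq_perm; first exact: fset_uniq.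
  by rewrite map_inj_uniq// enum_uniq.
move=> s; apply/idP/mapP.
  rewrite !inE /= => /andP[]; rewrite fpowersetE => /fsubsetP sC /andP[s0 /asboolP[y sy]].
  exists [set i | p i \in s]%SET; last first.
    apply/fsetP => x; rewrite !inE /=; apply/idP/mapP => [xs|[i]].
      have := sC x xs; rewrite CE => /mapP[i _ xi].
      by exists i; rewrite // mem_enum inE -xi.
    by rewrite mem_enum inE => pis ->.
  rewrite mem_enum !inE; apply/andP; split.
    move/fset0Pn : s0 => [x xs]; apply/finset.set0Pn.
    have := sC x xs; rewrite CE => /mapP[i _ xi].
    by exists i; rewrite inE -xi.
  apply/asboolP; exists y => i; rewrite inE => pis.
  by rewrite -eucl_dist_le//; exact: sy.
move=> [S]; rewrite mem_enum !inE /= => /andP[/finset.set0Pn[i iS] /asboolP[y Sy]] ->.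
apply/andP; split.
  rewrite fpowersetE; apply/fsubsetP => x; rewrite !inE /= => /mapP[j jS ->].
  by rewrite CE map_f// mem_enum.
apply/andP; split.
  by apply/fset0Pn; exists (p i); rewrite !inE /= map_f// mem_enum.
apply/asboolP; exists y => x /=; rewrite !inE /= => /mapP[j]; rewrite mem_enum => jS ->.
by rewrite /eucl_ball /= eucl_dist_le//; exact: Sy.
Qed.

Lemma euler_cech (C : {fset Rn R d}) : C =i [seq p i | i <- enum 'I_N] ->
  euler (cech r C) = \sum_(k < N) (-1) ^+ k / k.+1`!%:R *
    \sum_(t : k.+1.-tuple 'I_N | uniq t) \1_(@balls_meet R d r k.+1) (map_tuple p t).
Proof.
move=> /cechE CE; rewrite /euler (perm_big _ CE) /= big_map.
under eq_bigr do rewrite card_img.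
rewrite big_enum_cond /=.
transitivity (\sum_(S : {set 'I_N} | (S != finset.set0)) (-1) ^+ #|S|.-1 * (meet S)%:R : R).
  rewrite [LHS]big_mkcond [RHS]big_mkcond; apply: eq_bigr => S _ /=.
  rewrite unfold_in /=.
  by case: (S != finset.set0) => //=; case: (meet S); rewrite ?mulr1 ?mulr0.
(* The inner sum has the single index k = |S| - 1, and none when S is empty. *)
transitivity (\sum_(S : {set 'I_N}) \sum_(k < N | #|S| == k.+1) (-1) ^+ k * (meet S)%:R : R).
  rewrite big_mkcond; apply: eq_bigr => S _; case: (eqVneq S finset.set0) => [->|S0].
    by rewrite big_pred0// => k; rewrite cards0.
  have S1 : (0 < #|S|)%N by rewrite card_gt0.
  have SN : (#|S|.-1 < N)%N by rewrite prednK// -[leqRHS]card_ord max_card.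
  rewrite (big_pred1 (Ordinal SN))//= => k.
  by apply/eqP/eqP => [Sk|->]; [apply: val_inj; rewrite /= Sk|rewrite /= prednK].
rewrite (exchange_big_dep predT)//=; apply: eq_bigr => k _.
rewrite -big_distrr/= -mulrA; congr (_ * _).
rewrite (eq_bigr (fun t : k.+1.-tuple 'I_N => (meet [set i in t]%SET)%:R)).
  by rewrite (sum_uniq_tuple_set _ (fun S => (meet S)%:R)) mulrA mulVf ?mul1r//.
move=> t _; rewrite indicE; congr (_%:R); congr nat_of_bool.
apply/idP/asboolP => [/set_mem[y ty]|[y Sy]].
  by exists y => i; rewrite inE => /tnthP[j ->]; rewrite -tnth_map.
by apply/mem_set; exists y => i; rewrite tnth_map; apply: Sy; rewrite inE mem_tnth.
Qed.

End euler.

(** * Comparing integrals off a null set *)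

Section integral_ae.
Context d (T : measurableType d) (R : realType) (mu : {measure set T -> \bar R}).
Import HBNNSimple.

(** The integral of a nonnegative function is a supremum over the simple functions below it. Setting
    a simple function below f to zero on N puts it below g and keeps its integral. *)
Let ge0_le_integral_off_null (N : set T) (f g : T -> \bar R) :
  measurable N -> mu N = 0%E -> (forall x, (0 <= f x)%E) -> (forall x, (0 <= g x)%E) ->
  (forall x, ~ N x -> f x = g x) -> (\int[mu]_x f x <= \int[mu]_x g x)%E.
Proof.
move=> mN N0 f0 g0 fg; rewrite !ge0_integralTE//.
apply: ge_ereal_sup => _ [h hf <-].
have mNC : measurable (~` N) by exact: measurableC.
pose h' : {nnsfun T >-> R} := mul_nnsfun h (indic_nnsfun R mNC).
apply: (@le_trans _ _ (sintegral mu h')).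
  rewrite -!integralT_nnsfun le_eqVlt; apply/orP; left; apply/eqP.
  apply: ge0_ae_eq_integral => //.
  - by apply/measurable_EFinP; exact: measurable_funP.
  - by apply/measurable_EFinP; exact: measurable_funP.
  - by move=> x _; rewrite lee_fin.
  - by move=> x _; rewrite lee_fin.
  exists N; split => // x /=; apply: contra_notP => Nx _ /=.
  by rewrite mindicE mem_set// mulr1.
apply: ereal_sup_ubound; exists h' => //= x.
have [Nx|Nx] := pselect (N x).
  by rewrite mindicE memNset ?mulr0//; exact.
by rewrite mindicE mem_set// mulr1 -fg//; exact: hf.
Qed.

(* Neither function is assumed to be measurable. *)
Lemma eq_integral_off_null (N : set T) (f g : T -> \bar R) :
  measurable N -> mu N = 0%E -> (forall x, ~ N x -> f x = g x) ->
  (\int[mu]_x f x = \int[mu]_x g x)%E.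
Proof.
move=> mN N0 fg; rewrite integralE [RHS]integralE; congr (_ - _)%E.
  apply/eqP; rewrite eq_le; apply/andP.
  by split; apply: (ge0_le_integral_off_null mN N0) => // x /fg; rewrite !funeposE => ->.
apply/eqP; rewrite eq_le; apply/andP.
  by split; apply: (ge0_le_integral_off_null mN N0) => // x /fg; rewrite !funenegE => ->.
Qed.

End integral_ae.

Lemma integral_indicT d (T : measurableType d) (R : realType)
    (mu : {measure set T -> \bar R}) (A : set T) : measurable A ->
  (\int[mu]_x (\1_A x)%:E = mu A)%E.
Proof. by move=> mA; rewrite integral_indic// setIT. Qed.

(** * The diagonal is a null set *)

Section diagonal.
Variables (R : realType) (d : nat).
Hypothesis d0 : (0 < d)%N.

Lemma measurable_Rn_set1 e (x : Rn R e) : measurable [set x].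
Proof.
rewrite (_ : [set x] = \bigcap_(i in [set: 'I_e])
    (fun t : Rn R e => tnth t i) @^-1` [set tnth x i]).
  apply: fin_bigcap_measurable => // i _; rewrite -[X in measurable X]setTI.
  exact: measurable_tnth.
apply/seteqP; split => t /=; first by move=> ->.
by move=> tx; apply: eq_from_tnth => i; exact: tx.
Qed.

(** The first coordinate alone has measure zero. In dimension 0 the only point has mass 1, which is
    why d is positive. *)
Lemma lebesgue_tuple_set1 (x : Rn R d) : lebesgue_tuple [set x] = 0%E.
Proof.
case: d d0 x => // e _ x.
rewrite /= /lebesgue_step /pushforward.
rewrite (_ : _ @^-1` _ = [set (tuncons x).1] `*` [set (tuncons x).2]).
  rewrite product_measure1E//; last exact: measurable_Rn_set1.
  by rewrite [X in (X * _)%E]lebesgue_measure_set1 mul0e.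
apply/seteqP; split => -[y t]; rewrite /preimage /mkset.
  by move=> <-; split; rewrite tunconsK.
by move=> [/= yx tx]; rewrite yx tx -[RHS]tconsK.
Qed.

Definition diag2 : set (2.-tuple (Rn R d)) :=
  [set t | tnth t ord0 = tnth t ord_max].

Lemma measurable_diag2 : measurable diag2.
Proof.
rewrite (_ : diag2 = \bigcap_(i in [set: 'I_d])
    (fun t : 2.-tuple (Rn R d) => (tnth (tnth t ord0) i : R) - tnth (tnth t ord_max) i) @^-1` [set 0]).
  apply: fin_bigcap_measurable => // i _; rewrite -[X in measurable X]setTI.
  have mi j : measurable_fun setT (fun t : 2.-tuple (Rn R d) => tnth (tnth t j) i : R).
    by apply: (measurableT_comp (@measurable_tnth _ _ _ i)); exact: measurable_tnth.
  by apply: (measurable_funB (mi _) (mi _)).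
apply/seteqP; split => t; first by move=> /= tt i _ /=; rewrite tt subrr.
by move=> tt; apply: eq_from_tnth => i; apply/eqP; rewrite -GRing.Theory.subr_eq0; apply/eqP; exact: tt.
Qed.

Lemma tuple_measure_diag2 : tuple_measure lebesgue_tuple 2 diag2 = 0%E.
Proof.
have mD := measurable_diag2.
have m1 : measurable_fun setT (fun t => (\1_diag2 t)%:E : \bar R).
  by apply/measurable_EFinP; exact: measurable_indic.
have m1x (x : Rn R d) : measurable_fun setT
    (fun t : 1.-tuple (Rn R d) => (\1_diag2 (consp (x, t)))%:E : \bar R).
  apply: (measurableT_comp m1).
  exact: (measurableT_comp (@measurable_consp _ _ _) (pair1_measurable _)).
apply: (eq_trans (esym (integral_indicT _ mD))).
rewrite ge0_integral_tupleS//.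
rewrite integral0_eq// => x _; rewrite ge0_integral_tupleS//.
transitivity (\int[lebesgue_tuple]_y (\1_[set x] y)%:E)%E; last first.
  exact: (eq_trans (integral_indicT _ (measurable_Rn_set1 x)) (lebesgue_tuple_set1 x)).
apply: eq_integral => y _; rewrite integral_tuple0; congr EFin.
rewrite !indicE; congr (_%:R); congr nat_of_bool.
have max1 : ord_max = lift ord0 ord0 :> 'I_2 by exact: val_inj.
apply/idP/idP => /set_mem; rewrite /diag2 /= => h; apply/mem_set => /=.
  by move: h; rewrite max1 tnthS !tnth0.
by rewrite max1 tnthS !tnth0 h.
Qed.

End diagonal.

Arguments diag2 {R d}.

Section expected_euler.
Variables (R : realType) (d : nat) (f : Rn R d -> R).
Hypotheses (d0 : (0 < d)%N) (hf : bounded_density f).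
Variables (a : nat -> R) (X : point_process R d).
Hypotheses (hX : has_factorial_moments f a X) (a0 : forall k, 0 <= a k).
Hypothesis a_cvg : cvgn (series (fun k => a k.+1 / k.+1`!%:R)).
Variable r : R.
Hypothesis r0 : 0 <= r.

(* The second factorial moment of the diagonal vanishes. *)
Lemma negligible_coincidence : exists N : set (pp_space X),
  [/\ measurable N, pp_prob X N = 0%E & forall w, ~ N w ->
   injective (fun i : 'I_(pp_size X w) => pp_point X i w)].
Proof.
have mD := @measurable_diag2 R d.
have mc := @measurable_factorial_count R d X _ _ mD.
have : (\int[pp_prob X]_w `|(factorial_count (@diag2 R d) w)%:E| = 0)%E.
  under eq_integral do rewrite gee0_abs ?lee_fin ?factorial_count_ge0//.
  apply: (eq_trans (hX mD)).
  rewrite null_set_integral ?mule0//; last exact: tuple_measure_diag2.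
  by apply: (measurable_funS measurableT) => //; exact: measurable_prod_density.
move=> /ae_eq_integral_abs -/(_ measurableT)[|N [mN N0 subN]].
  exact/measurable_EFinP.
exists N; split => // w Nw i j ij; apply/eqP/negPn/negP => ij'.
apply: Nw; apply: subN => /= H; have : factorial_count (@diag2 R d) w = 0 by apply: EFin_inj; exact: H Logic.I.
rewrite /factorial_count.
(* Two distinct indices with the same point contribute 1 to the count of the diagonal. *)
have ut : uniq [tuple i; j] by rewrite /= inE ij'.
rewrite (bigD1 [tuple i; j])//= => /eqP.
rewrite gt_eqF// ltr_pwDl//; last by apply: sumr_ge0 => t _; rewrite indicE.
rewrite indicE mem_set//; exact: ij.
Qed.

Definition good_mass k : R :=
  fine (\int[tuple_measure lebesgue_tuple k.+1]_(t in balls_meet r)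
    (\prod_(i < k.+1) f (tnth t i))%:E).

Lemma good_massE k :
  (\int[tuple_measure lebesgue_tuple k.+1]_(t in balls_meet r)
    (\prod_(i < k.+1) f (tnth t i))%:E = (good_mass k)%:E)%E.
Proof.
have [_ f0 _ _] := hf.
rewrite /good_mass fineK// ge0_fin_numE; last first.
  by apply: integral_ge0 => t _; exact: prod_density_ge0.
apply: (@le_lt_trans _ _ (\int[tuple_measure lebesgue_tuple k.+1]_(t in rectangle (fun=> setT))
    (\prod_(i < k.+1) f (tnth t i))%:E)%E).
  apply: ge0_subset_integral => //.
  - exact: measurable_balls_meet.
  - exact: measurable_rectangle.
  - by apply: (measurable_funS measurableT) => //; exact: measurable_prod_density.
  - by move=> t _; exact: prod_density_ge0.
by rewrite integral_rectangle// ltry.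
Qed.

Lemma good_mass_ge0 k : 0 <= good_mass k.
Proof.
by rewrite fine_ge0// integral_ge0// => t _; apply: prod_density_ge0.
Qed.

Lemma good_mass_le1 k : good_mass k <= 1.
Proof.
rewrite -lee_fin -good_massE.
have <- : (\int[tuple_measure lebesgue_tuple k.+1]_(t in rectangle (fun=> setT))
    (\prod_(i < k.+1) f (tnth t i))%:E = 1%:E)%E.
  by rewrite integral_rectangle// big1// => i _; rewrite massT.
apply: ge0_subset_integral => //.
- exact: measurable_balls_meet.
- exact: measurable_rectangle.
- by apply: (measurable_funS measurableT) => //; exact: measurable_prod_density.
- by move=> t _; exact: prod_density_ge0.
Qed.

Let q k := a k.+1 / k.+1`!%:R * good_mass k.

(** When the points are distinct, the number of simplices of dimension k, each counted once instead
    of (k + 1)! times. *)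
Let N k (w : pp_space X) : R := factorial_count (balls_meet r : set (k.+1.-tuple _)) w / k.+1`!%:R.

Let N_ge0 k w : 0 <= N k w.
Proof. by rewrite mulr_ge0 ?invr_ge0// factorial_count_ge0. Qed.

Let measurable_N k : measurable_fun setT (N k).
Proof.
apply: measurable_funM => //; apply: measurable_factorial_count.
exact: measurable_balls_meet.
Qed.

Let N_eq0 k w : (pp_size X w <= k)%N -> N k w = 0.
Proof.
move=> wk; rewrite /N /factorial_count big_pred0 ?mul0r// => t.
apply/negbTE/negP => ut; have : (#|t| <= #|'I_(pp_size X w)|)%N by exact: max_card.
by rewrite card_ord (card_uniqP ut) size_tuple ltnNge wk.
Qed.

Let integral_N k : (\int[pp_prob X]_w (N k w)%:E = (q k)%:E)%E.
Proof.
under eq_integral do rewrite /N EFinM.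
rewrite ge0_integralZr//; last 2 first.
- apply/measurable_EFinP; apply: measurable_factorial_count; exact: measurable_balls_meet.
- by move=> w _; rewrite lee_fin factorial_count_ge0.
have := hX (@measurable_balls_meet R d r k r0).
rewrite /factorial_moment => ->; rewrite good_massE -!EFinM; congr EFin.
by rewrite /q; ring.
Qed.

Let sumN_lty : (\sum_(k <oo) (q k)%:E < +oo)%E.
Proof.
apply: (@le_lt_trans _ _ (\sum_(k <oo) (a k.+1 / k.+1`!%:R)%:E)%E).
  apply: lee_nneseries => k _.
    by rewrite lee_fin mulr_ge0 ?good_mass_ge0// mulr_ge0// invr_ge0.
  by rewrite lee_fin ler_piMr ?good_mass_le1// mulr_ge0// invr_ge0.
rewrite (_ : (\sum_(k <oo) _)%E = (limn (series (fun k => a k.+1 / k.+1`!%:R)))%:E) ?ltry//.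
rewrite -EFin_lim//; apply/congr_lim/funext => n /=.
by rewrite sumEFin.
Qed.

(** Dominated convergence exchanges the expectation with the sum over dimensions; [a_cvg] makes the
    majorant integrable. *)
Lemma expected_euler :
  ('E_(pp_prob X)[fun w => euler (cech r (pp_config w))] =
   (limn (series (fun k => (-1) ^+ k * (a k.+1 / k.+1`!%:R * good_mass k))))%:E)%E.
Proof.
rewrite unlock.
pose F w : R := \sum_(k < pp_size X w) (-1) ^+ k * N k w.
(* Cutting at a dimension K independent of w gives a finite sum of integrable terms, equal to F w as
   soon as K reaches the number of points. *)
pose S K w : R := \sum_(0 <= k < K) (-1) ^+ k * N k w.
have SF w K : (pp_size X w <= K)%N -> S K w = F w.
  move=> wK; rewrite /S (big_cat_nat _ wK)//= big_mkord [X in _ + X]big_nat.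
  by rewrite [X in _ + X]big1 ?addr0// => k /andP[wk _]; rewrite N_eq0// mulr0.
have mS K : measurable_fun setT (S K).
  by apply: measurable_sum => k; exact: measurable_funM.
have [D [mD D0 Dinj]] := negligible_coincidence.
rewrite (@eq_integral_off_null _ _ _ _ D _ (fun w => (F w)%:E))//; last first.
  move=> w /Dinj winj; congr EFin.
  rewrite (@euler_cech _ _ _ (fun i : 'I_(pp_size X w) => pp_point X i w))//.
    by apply: eq_bigr => k _; rewrite /N /factorial_count mulrAC mulrA.
  move=> x; rewrite !inE /=.
  by rewrite -val_enum_ord -map_comp.
(* The majorant is the total number of simplices. *)
pose G w := (\sum_(k <oo) (N k w)%:E)%E.
have mG : measurable_fun setT G.
  apply: ge0_emeasurable_sum => k; first by move=> w _ _; rewrite lee_fin.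
  by move=> _; exact/measurable_EFinP.
have G0 w : (0 <= G w)%E by apply: nneseries_ge0 => k _ _; rewrite lee_fin.
have iG : (pp_prob X).-integrable setT G.
  apply/integrableP; split => //.
  under eq_integral do rewrite gee0_abs//.
  rewrite integral_nneseries//; last 2 first.
  - by move=> k; exact/measurable_EFinP.
  - by move=> k w _; rewrite lee_fin.
  by under eq_eseriesr do rewrite integral_N.
have SG w K : (`|(S K w)%:E| <= G w)%E.
  apply: (@le_trans _ _ (\sum_(0 <= k < K) (N k w)%:E)%E).
    rewrite sumEFin lee_fin (le_trans (ler_norm_sum _ _ _))//.
    by apply: ler_sum => k _; rewrite normrM normrX normrN1 expr1n mul1r ger0_norm.
  by apply: nneseries_lim_ge => k _ _; rewrite lee_fin.
have mF : measurable_fun setT (fun w => (F w)%:E).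
  apply/measurable_EFinP.
  apply: (measurable_pp_size (F := fun n w => \sum_(k < n) (-1) ^+ k * N k w)) => n.
  by apply: measurable_sum => k; exact: measurable_funM.
have [//| | | iF _ SFcvg] := @dominated_convergence _ _ _ (pp_prob X) setT measurableT
  (fun K w => (S K w)%:E) (fun w => (F w)%:E) G _ mF _ iG.
- by move=> K; exact/measurable_EFinP.
- apply: aeW => w _; apply: cvg_near_cst; near=> K.
  rewrite SF//; near: K; exact: nbhs_infty_ge.
- by apply: aeW => w K _; exact: SG.
have intS K : (\int[pp_prob X]_w (S K w)%:E =
    (series (fun k => (-1) ^+ k * q k) K)%:E)%E.
  have iN k : (pp_prob X).-integrable setT (fun w => (N k w)%:E).
    apply/integrableP; split; first exact/measurable_EFinP.
    by under eq_integral do rewrite gee0_abs ?lee_fin//; rewrite integral_N ltry.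
  rewrite /S /series /= -sumEFin.
  under eq_integral do rewrite -sumEFin.
  rewrite integral_sum//; last first.
    by move=> k; under eq_fun do rewrite EFinM; exact: integrableZl.
  apply: eq_bigr => k _; under eq_integral do rewrite EFinM.
  by rewrite integralZl// integral_N -EFinM.
have Ifin : (\int[pp_prob X]_w (F w)%:E \is a fin_num)%E by exact: integrable_fin_num.
rewrite -(fineK Ifin); congr EFin; apply/esym/cvg_lim => //.
have h : (series (fun k => (-1) ^+ k * q k) K)%:E @[K --> \oo] -->
    (fine (\int[pp_prob X]_w (F w)%:E))%:E.
  rewrite fineK//; apply: cvg_trans SFcvg.
  by apply: near_eq_cvg; apply: nearW => K; exact: intS.
exact: (fine_cvg h).
Unshelve. all: by end_near. Qed.

End expected_euler.

(** * Small radius limit *)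

Section cube.
Variable R : realType.

Definition cube d (a b : R) : set (Rn R d) := [set x | forall j, a <= tnth x j <= b].

Lemma measurable_cube d a b : measurable (@cube d a b).
Proof.
rewrite (_ : @cube d a b = \bigcap_(i in [set: 'I_d])
    (fun t : Rn R d => tnth t i) @^-1` `[a, b]%classic).
  apply: fin_bigcap_measurable => // i _; rewrite -[X in measurable X]setTI.
  by apply: measurable_tnth => //; exact: measurable_itv.
apply/seteqP; split => t tab; first by move=> i _ /=; rewrite in_itv/=; exact: tab.
by move=> i; have := tab i Logic.I; rewrite /= in_itv.
Qed.

Lemma lebesgue_cube d a b : a <= b -> lebesgue_tuple (@cube d a b) = ((b - a) ^+ d)%:E.
Proof.
move=> ab; elim: d => [|d IH].
  rewrite expr0 (_ : cube a b = setT); first exact: diracT.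
  by apply/seteqP; split => // t _ [].
transitivity ((@lebesgue_measure R \x lebesgue_tuple) (`[a, b]%classic `*` @cube d a b))%E.
  rewrite /= /lebesgue_step /pushforward; congr (_ _).
  apply/seteqP; split => -[y t] /=; rewrite /preimage /mkset.
    move=> xab; split; first by have := xab ord0; rewrite tnth0 /= in_itv.
    by move=> j; have := xab (lift ord0 j); rewrite tnthS.
  move=> [/= yab tab] j; case: (unliftP ord0 j) => [i|] ->; first by rewrite tnthS.
  by rewrite tnth0; move: yab; rewrite in_itv.
rewrite product_measure1E//; last exact: measurable_cube.
rewrite IH [X in (X * _)%E]lebesgue_measure_itv/= lte_fin.
move: ab; rewrite le_eqVlt => /predU1P[<-|->]; last by rewrite -EFinB -EFinM -exprS.
by rewrite ltxx mul0e subrr expr0n.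
Qed.

End cube.

Section cech_const.
Variables (R : realType) (d : nat).

Definition origin : Rn R d := [tuple 0 | _ < d].

Lemma aff_origin (x : Rn R d) r : aff x r origin = x.
Proof. by apply: eq_from_tnth => i; rewrite !tnth_mktuple mulr0 addr0. Qed.

Definition cech_indic k (z : k.-tuple (Rn R d)) : R := \1_(balls_meet 1) (consp (origin, z)).

Lemma cech_indic_ge0 k (z : k.-tuple (Rn R d)) : 0 <= cech_indic z.
Proof. by rewrite /cech_indic indicE. Qed.

Lemma measurable_cech_indic k : measurable_fun setT (@cech_indic k).
Proof.
apply: (measurableT_comp (measurable_indic (measurable_balls_meet ler01))).
exact: (measurableT_comp (@measurable_consp _ _ _) (pair1_measurable _)).
Qed.

(** The volume of the set of (z_1, ..., z_k) such that the unit balls centred at 0, z_1, ..., z_k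
    meet: the c_k of the overview. *)
Definition cech_const k : R := fine (\int[tuple_measure lebesgue_tuple k]_z (cech_indic z)%:E).

Lemma integral_cech_indic_le k :
  (\int[tuple_measure lebesgue_tuple k]_z (cech_indic z)%:E <= ((4 ^+ d) ^+ k)%:E)%E.
Proof.
have mc := @measurable_cube R d (- 2) 2.
pose g (_ : 'I_k) (x : Rn R d) : R := \1_(cube (- 2) 2) x.
have := @ge0_integral_tuple_prod _ _ _ (@lebesgue_tuple R d) k g (fun=> 4 ^+ d).
rewrite prodr_const card_ord => <-//.
- apply: ge0_le_integral => //.
  + by move=> z _; rewrite lee_fin cech_indic_ge0.
  + by apply/measurable_EFinP; exact: measurable_cech_indic.
  + apply/measurable_EFinP; apply: measurable_prod => i _.
    by apply: (measurableT_comp (measurable_indic mc)); exact: measurable_tnth.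
  move=> z _; rewrite lee_fin -(@indic_rectangle R _ k (fun=> cube (-2) 2) z).
  rewrite /cech_indic !indicE; case: (boolP (_ \in balls_meet 1)) => // /set_mem zb.
  rewrite mem_set// => i j; rewrite -ler_norml.
  exact: balls_meet_bound zb.
- by move=> i; exact: measurable_indic.
- move=> i; apply: (eq_trans (integral_indicT _ mc)).
  have -> : 4 = 2 - (- 2) :> R by lra.
  by apply: lebesgue_cube; lra.
Qed.

Lemma cech_constE k :
  (\int[tuple_measure lebesgue_tuple k]_z (cech_indic z)%:E = (cech_const k)%:E)%E.
Proof.
rewrite /cech_const fineK// ge0_fin_numE; last first.
  by apply: integral_ge0 => z _; rewrite lee_fin cech_indic_ge0.
exact: (le_lt_trans (integral_cech_indic_le k) (ltry _)).
Qed.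

Lemma cech_const_ge0 k : 0 <= cech_const k.
Proof.
by rewrite fine_ge0// integral_ge0// => z _; rewrite lee_fin cech_indic_ge0.
Qed.

Lemma cech_const_le k : cech_const k <= (4 ^+ d) ^+ k.
Proof. by rewrite -lee_fin -cech_constE integral_cech_indic_le. Qed.

Lemma cech_const0 : cech_const 0 = 1.
Proof.
rewrite /cech_const integral_tuple0 /= /cech_indic indicE mem_set//.
exists origin => i; rewrite ord1 tnth0.
by rewrite /sqdist big1 ?expr1n// => j _; rewrite subrr expr0n.
Qed.

Lemma unit_ball_volume_gt0 : (0 < d)%N -> 0 < unit_ball_volume R d.
Proof.
move=> d0.
pose B := eucl_ball origin 1.
have BE x : B x <-> sqdist origin x <= 1.
  by rewrite /B /eucl_ball /= eucl_dist_le// expr1n.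
have mB : measurable B.
  rewrite (_ : B = sqdist origin @^-1` `]-oo, 1]%classic).
    rewrite -[X in measurable X]setTI.
    suff : measurable_fun setT (sqdist origin) by apply.
    apply: measurable_sum => i; apply: measurable_funX; apply: measurable_funB => //.
    exact: measurable_tnth.
  by apply/seteqP; split => x /=; rewrite in_itv/=; have [] := BE x.
(* Finiteness matters as much as positivity, since [fine] sends +oo to 0. *)
have ltB : (lebesgue_tuple B < +oo)%E.
  apply: (@le_lt_trans _ _ (lebesgue_tuple (@cube R d (- 1) 1))).
    apply: le_measure; rewrite ?inE//; first exact: measurable_cube.
    move=> x /BE xB j; rewrite -ler_norml.
    have := @sqdist_coord_le _ _ origin x 1 j ler01.
    by rewrite expr1n tnth_mktuple sub0r normrN; apply.
  by rewrite lebesgue_cube ?ltry//; lra.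
rewrite fine_gt0// ltB andbT.
(* The cube [0, 1 / d]^d lies in the ball: s <= 1 gives x_j^2 <= s for each coordinate, and the d
   bounds s add up to 1. *)
pose s : R := d%:R^-1.
have s0 : 0 < s by rewrite invr_gt0 ltr0n.
apply: (@lt_le_trans _ _ (lebesgue_tuple (@cube R d 0 s))).
  by rewrite lebesgue_cube ?ltW// subr0 lte_fin exprn_gt0.
apply: le_measure; rewrite ?inE//; first exact: measurable_cube.
move=> x xs; apply/BE.
apply: (@le_trans _ _ (\sum_(j < d) s)).
  apply: ler_sum => j _; rewrite tnth_mktuple sub0r sqrrN.
  have /andP[x0 x1] := xs j.
  have s1 : s <= 1 by rewrite invf_le1 ?ler1n// ltr0n.
  rewrite expr2; nra.
by rewrite sumr_const card_ord -[_ *+ _]mulr_natl divff// pnatr_eq0 -lt0n.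
Qed.

End cech_const.

(** The factors are exchanged one at a time; 1 <= M allows the same power of M in every term. *)
Lemma ler_norm_prodB (R : realType) (M : R) I (r : seq I) (a b : I -> R) :
  1 <= M -> (forall i, 0 <= a i <= M) -> (forall i, 0 <= b i <= M) ->
  `|\prod_(i <- r) a i - \prod_(i <- r) b i| <= M ^+ size r * \sum_(i <- r) `|a i - b i|.
Proof.
move=> M1 ha hb; have M0 : 0 <= M by exact: le_trans M1.
elim: r => [|i r IH]; first by rewrite !big_nil subrr normr0 mulr0.
rewrite !big_cons /=.
set A := \prod_(j <- r) a j in IH *; set B := \prod_(j <- r) b j in IH *.
set S := \sum_(j <- r) _ in IH *.
have -> : a i * A - b i * B = a i * (A - B) + (a i - b i) * B by ring.
have /andP[a0 aM] := ha i.
have BM : `|B| <= M ^+ size r.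
  rewrite ger0_norm; last by apply: prodr_ge0 => j _; have /andP[] := hb j.
  rewrite /B; elim: (r) => [|j r' IH']; first by rewrite big_nil expr0.
  have /andP[b0 bM] := hb j; rewrite big_cons /= exprS ler_pM//.
  by apply: prodr_ge0 => l _; have /andP[] := hb l.
rewrite (le_trans (ler_normD _ _))// !normrM (ger0_norm a0) mulrDr addrC exprS.
have Mr0 : 0 <= M ^+ size r by rewrite exprn_ge0.
apply: lerD.
  rewrite mulrC ler_wpM2r//; apply: (le_trans BM).
  by rewrite ler_peMl.
by rewrite -mulrA ler_pM.
Qed.

Lemma cvg_integral_L1 d (T : measurableType d) (R : realType)
    (mu : {measure set T -> \bar R}) (u : nat -> T -> R) (g : T -> R) :
  (forall n, mu.-integrable setT (EFin \o u n)) -> mu.-integrable setT (EFin \o g) ->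
  (\int[mu]_x `|u n x - g x|%:E)%E @[n --> \oo] --> 0%E ->
  (\int[mu]_x (u n x)%:E)%E @[n --> \oo] --> (\int[mu]_x (g x)%:E)%E.
Proof.
move=> iu ig ug.
have gfin : (\int[mu]_x (g x)%:E \is a fin_num)%E by exact: integrable_fin_num.
rewrite -[X in _ --> X]add0e.
have -> : (fun n => \int[mu]_x (u n x)%:E)%E =
    (fun n => \int[mu]_x ((u n x)%:E - (g x)%:E) + \int[mu]_x (g x)%:E)%E.
  apply/funext => n; rewrite integralB//; last exact: iu.
  by rewrite subeK.
apply: cvgeD => //; last exact: cvg_cst.
apply/cvg_abse0P; apply: squeeze_cvge (cvg_cst 0%E) ug.
apply: nearW => n; rewrite abse_ge0 /=.
apply: le_abse_integral => //.
have /integrableP[mun _] := iu n; have /integrableP[mg _] := ig.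
exact: (emeasurable_funB mun mg).
Qed.

Section local_limit.
Variables (R : realType) (d : nat) (f : Rn R d -> R) (M : R).
Hypotheses (hf : bounded_density f) (M1 : 1 <= M) (fM : forall x, f x <= M).

Let mf : measurable_fun setT f. Proof. by case: hf. Qed.
Let f0 x : 0 <= f x. Proof. by case: hf. Qed.
Let f1 : (\int[lebesgue_tuple]_x (f x)%:E = 1)%E. Proof. by case: hf. Qed.
Let M0 : 0 <= M. Proof. exact: le_trans M1. Qed.

Definition moment k : R := fine (\int[lebesgue_tuple]_x (f x ^+ k.+1)%:E).

Let prod_aff k r (z : k.-tuple (Rn R d)) x := f x * \prod_(i < k) f (aff x r (tnth z i)).

Let prod_aff_ge0 k r (z : k.-tuple (Rn R d)) x : 0 <= prod_aff r z x.
Proof. by rewrite mulr_ge0// prodr_ge0. Qed.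

Let prod_le k (g : 'I_k -> R) : (forall i, 0 <= g i <= M) -> \prod_(i < k) g i <= M ^+ k.
Proof.
move=> gM; rewrite -[X in _ ^+ X](card_ord k) -prodr_const.
exact: ler_prod.
Qed.

Let measurable_prod_aff k r : measurable_fun setT
  (fun p : Rn R d * k.-tuple (Rn R d) => prod_aff r p.2 p.1).
Proof.
apply: measurable_funM; first exact: measurableT_comp.
apply: measurable_prod => i _; apply: (measurableT_comp mf).
apply: (measurableT_comp (@measurable_aff R d) (g := fun p => (p.1, r, tnth p.2 i))).
apply: measurable_fun_pair; first by apply: measurable_fun_pair.
by apply: (measurableT_comp (@measurable_tnth _ _ _ i)).
Qed.

Let integrable_le (g : Rn R d -> R) c : measurable_fun setT g -> 0 <= c ->
  (forall x, 0 <= g x <= c * f x) -> lebesgue_tuple.-integrable setT (EFin \o g).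
Proof.
move=> mg c0 gf; apply/integrableP; split; first exact/measurable_EFinP.
apply: (@le_lt_trans _ _ (\int[lebesgue_tuple]_x (c%:E * (f x)%:E))%E).
  apply: ge0_le_integral => //.
  - by apply/measurable_EFinP; apply: measurableT_comp.
  - by apply/measurable_EFinP; apply: measurable_funM.
  - by move=> x _; rewrite -EFinM lee_fin; have /andP[g0 gc] := gf x; rewrite ger0_norm.
rewrite ge0_integralZl//.
- by rewrite f1 mule1 ltry.
- exact/measurable_EFinP.
- by move=> x _; rewrite lee_fin.
Qed.

Let prod_aff_le k r (z : k.-tuple (Rn R d)) x : prod_aff r z x <= M ^+ k * f x.
Proof.
rewrite /prod_aff mulrC ler_wpM2r//; apply: prod_le => i; exact/andP.
Qed.

Let measurable_prod_affl k r (z : k.-tuple (Rn R d)) : measurable_fun setT (prod_aff r z).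
Proof. exact: (measurableT_comp (@measurable_prod_aff k r) (pair2_measurable _)). Qed.

Let integrable_prod_aff k r (z : k.-tuple (Rn R d)) :
  lebesgue_tuple.-integrable setT (EFin \o prod_aff r z).
Proof.
apply: (@integrable_le _ (M ^+ k)) => //; first by rewrite exprn_ge0.
by move=> x; rewrite prod_aff_ge0 prod_aff_le.
Qed.

Let integrable_power k : lebesgue_tuple.-integrable setT (fun x => (f x ^+ k.+1)%:E).
Proof.
apply: (@integrable_le (fun x => f x ^+ k.+1) (M ^+ k)); first exact: measurable_funX.
  by rewrite exprn_ge0.
move=> x; rewrite exprn_ge0//= exprSr ler_wpM2r//.
by case: k => [|k]; rewrite ?expr0// lerXn2r// ?nnegrE.
Qed.

Lemma momentE k : (\int[lebesgue_tuple]_x (f x ^+ k.+1)%:E = (moment k)%:E)%E.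
Proof. by rewrite /moment fineK//; exact: integrable_fin_num. Qed.

Lemma moment_ge0 k : 0 <= moment k.
Proof. by rewrite fine_ge0// integral_ge0// => x _; rewrite lee_fin exprn_ge0. Qed.

(** By [ler_norm_prodB] and f <= M, the L^1 distance to f^(k+1) is at most M^(k+1) times the sum of
    the k translation errors of f. *)
Lemma cvg_integral_prod_aff k (r : R^nat) (z : k.-tuple (Rn R d)) : r n @[n --> \oo] --> 0 ->
  (\int[lebesgue_tuple]_x (prod_aff (r n) z x)%:E)%E @[n --> \oo] --> (moment k)%:E.
Proof.
move=> r0; rewrite -momentE.
apply: (@cvg_integral_L1 _ _ _ _ (fun n => prod_aff (r n) z) (fun x => f x ^+ k.+1)) => //.
  exact: integrable_power.
have mabs n i : measurable_fun setT (fun x => `|f (aff x (r n) (tnth z i)) - f x|%:E).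
  apply/measurable_EFinP; apply: measurableT_comp => //; apply: measurable_funB => //.
  by apply: (measurableT_comp mf); exact: measurable_affl.
have h : ((M ^+ k.+1)%:E * (\sum_(i < k)
    \int[lebesgue_tuple]_x `|f (aff x (r n) (tnth z i)) - f x|%:E))%E @[n --> \oo] --> 0%E.
  rewrite -[X in _ --> X](mule0 (M ^+ k.+1)%:E); apply: cvgeZl => //.
  suff h : (\sum_(i < k) \int[lebesgue_tuple]_x
      `|f (aff x (r n) (tnth z i)) - f x|%:E)%E @[n --> \oo] --> (\sum_(i < k) 0)%E.
    by rewrite [X in _ --> X]big1 in h.
  apply: cvg_nnesum => i _; first by apply: nearW => n; exact: integral_ge0.
  apply: cvg_L1_aff => //.
  by under eq_integral do rewrite ger0_norm//; rewrite f1 ltry.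
apply: squeeze_cvge (cvg_cst 0%E) h.
apply: nearW => n; apply/andP; split; first exact: integral_ge0.
rewrite -ge0_integral_sum// -ge0_integralZl//; last 3 first.
- exact: emeasurable_sum.
- by move=> x _; apply: sume_ge0.
- by rewrite lee_fin exprn_ge0.
apply: ge0_le_integral => //.
- apply/measurable_EFinP; apply: measurableT_comp => //; apply: measurable_funB.
    exact: measurable_prod_affl.
  exact: measurable_funX.
- by apply: measurable_funeM; exact: emeasurable_sum.
move=> x _; rewrite sumEFin -EFinM lee_fin exprS -mulrBr normrM ger0_norm// exprS -mulrA.
rewrite ler_pM// -[X in _ ^+ X](card_ord k) -prodr_const.
have := @ler_norm_prodB R M _ (index_enum 'I_k) (fun i => f (aff x (r n) (tnth z i)))
  (fun=> f x) M1.
rewrite /index_enum -enumT -cardE card_ord; apply => i; exact/andP.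
Qed.

(** After the substitution for the last k points, the condition that the balls meet depends neither
    on x nor on r, so Tonelli lets x be integrated first. *)
Lemma good_mass_scaling k r : 0 < r ->
  (\int[tuple_measure lebesgue_tuple k.+1]_(t in balls_meet r)
    (\prod_(i < k.+1) f (tnth t i))%:E =
   ((r ^+ d) ^+ k)%:E * \int[tuple_measure lebesgue_tuple k]_z
     ((cech_indic z)%:E * \int[lebesgue_tuple]_x (prod_aff r z x)%:E))%E.
Proof.
move=> r0; have mB := @measurable_balls_meet R d r k (ltW r0).
pose g (t : k.+1.-tuple (Rn R d)) := (\1_(balls_meet r) t * \prod_(i < k.+1) f (tnth t i))%:E.
have g0 t : (0 <= g t)%E by rewrite lee_fin mulr_ge0// prodr_ge0.
have mg : measurable_fun setT g.
  apply/measurable_EFinP; apply: measurable_funM; first exact: measurable_indic.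
  by apply: measurable_prod => i _; apply: (measurableT_comp mf); exact: measurable_tnth.
transitivity (\int[tuple_measure lebesgue_tuple k.+1]_t g t)%E.
  rewrite integral_mkcond; apply: eq_integral => t _.
  by rewrite patchE /g indicE; case: ifP; rewrite ?mul1r ?mul0r.
have rd0 : 0 <= r ^+ d by rewrite exprn_ge0// ltW.
rewrite ge0_integral_tupleS//.
pose h (p : Rn R d * k.-tuple (Rn R d)) := (cech_indic p.2 * prod_aff r p.2 p.1)%:E.
have h0 p : (0 <= h p)%E by rewrite lee_fin mulr_ge0// ?cech_indic_ge0.
have mh : measurable_fun setT h.
  apply/measurable_EFinP; apply: measurable_funM; last exact: measurable_prod_aff.
  by apply: (measurableT_comp (@measurable_cech_indic R d k)).
transitivity (\int[lebesgue_tuple]_x (((r ^+ d) ^+ k)%:E *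
    \int[tuple_measure lebesgue_tuple k]_z h (x, z)))%E.
  apply: eq_integral => x _.
  have mgx : measurable_fun setT (fun t => g (consp (x, t))).
    exact: (measurableT_comp (measurableT_comp mg (@measurable_consp _ _ k)) (pair1_measurable _)).
  have chvar (u : Rn R d -> \bar R) : measurable_fun setT u -> (forall y, 0 <= u y)%E ->
      (\int[lebesgue_tuple]_y u y = (r ^+ d)%:E * \int[lebesgue_tuple]_z u (aff x r z))%E.
    by move=> mu u0; exact: ge0_integral_aff.
  rewrite (ge0_integral_map_tuple rd0 (@measurable_affr _ _ x r) chvar mgx)//.
  congr (_ * _)%E; apply: eq_integral => z _; rewrite /g /h /=; congr (_ * _)%:E.
    rewrite /cech_indic !indicE; congr (_%:R); congr nat_of_bool.
    (* The first point x is itself the image of the origin, so [balls_meet_aff] applies to the whole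
       tuple. *)
    have -> : consp (x, map_tuple (aff x r) z) = map_tuple (aff x r) (consp (origin R d, z)).
      by apply: val_inj; rewrite /= aff_origin.
    by apply/idP/idP => /set_mem/(balls_meet_aff x _ r0) ?; apply/mem_set.
  rewrite big_ord_recl tnth0; congr (_ * _).
  by apply: eq_bigr => i _; rewrite tnthS tnth_map.
rewrite ge0_integralZl//; last 3 first.
- exact: measurable_fun_fubini_tonelli_F.
- by move=> x _; exact: integral_ge0.
- by rewrite lee_fin exprn_ge0.
rewrite (fubini_tonelli h)//; congr (_ * _)%E; apply: eq_integral => z _.
rewrite -ge0_integralZl//.
- by apply/measurable_EFinP; exact: measurable_prod_affl.
- by move=> x _; rewrite lee_fin.
- by rewrite lee_fin cech_indic_ge0.
Qed.

(* The integral defining [good_mass], divided by r ^ (d k), once the last k points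
   are written x + r z_i. *)
Definition local_mass k r : R := fine (\int[tuple_measure lebesgue_tuple k]_z
  ((cech_indic z)%:E * \int[lebesgue_tuple]_x (prod_aff r z x)%:E))%E.

Let inner_le k r (z : k.-tuple (Rn R d)) :
  (\int[lebesgue_tuple]_x (prod_aff r z x)%:E <= (M ^+ k)%:E)%E.
Proof.
apply: (@le_trans _ _ (\int[lebesgue_tuple]_x ((M ^+ k)%:E * (f x)%:E))%E).
  apply: ge0_le_integral => //.
  - by move=> x _; rewrite lee_fin.
  - by apply/measurable_EFinP; exact: measurable_prod_affl.
  - by apply/measurable_EFinP; apply: measurable_funM.
  - by move=> x _; rewrite -EFinM lee_fin.
rewrite ge0_integralZl//.
- by rewrite f1 mule1.
- exact/measurable_EFinP.
- by move=> x _; rewrite lee_fin.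
- by rewrite lee_fin exprn_ge0.
Qed.

Let inner_ge0 k r (z : k.-tuple (Rn R d)) :
  (0 <= \int[lebesgue_tuple]_x (prod_aff r z x)%:E)%E.
Proof. by apply: integral_ge0 => x _; rewrite lee_fin. Qed.

Let measurable_local k r : measurable_fun setT (fun z : k.-tuple (Rn R d) =>
  (cech_indic z)%:E * \int[lebesgue_tuple]_x (prod_aff r z x)%:E)%E.
Proof.
apply: emeasurable_funM; first by apply/measurable_EFinP; exact: measurable_cech_indic.
have mp : measurable_fun setT
    (fun p : Rn R d * k.-tuple (Rn R d) => (prod_aff r p.2 p.1)%:E).
  by apply/measurable_EFinP; exact: measurable_prod_aff.
by apply: (measurable_fun_fubini_tonelli_G _ mp) => p; rewrite lee_fin.
Qed.

Let local_le k r (z : k.-tuple (Rn R d)) :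
  ((cech_indic z)%:E * \int[lebesgue_tuple]_x (prod_aff r z x)%:E <=
    (M ^+ k)%:E * (cech_indic z)%:E)%E.
Proof.
rewrite muleC; apply: lee_wpmul2r; first by rewrite lee_fin cech_indic_ge0.
exact: inner_le.
Qed.

Let integral_bound k : (\int[tuple_measure lebesgue_tuple k]_z
  ((M ^+ k)%:E * (@cech_indic R d k z)%:E) = (M ^+ k * cech_const R d k)%:E)%E.
Proof.
rewrite ge0_integralZl//.
- by rewrite cech_constE.
- by apply/measurable_EFinP; exact: measurable_cech_indic.
- by move=> z _; rewrite lee_fin cech_indic_ge0.
- by rewrite lee_fin exprn_ge0.
Qed.

Let integral_local_le k r : (\int[tuple_measure lebesgue_tuple k]_z
  ((cech_indic z)%:E * \int[lebesgue_tuple]_x (prod_aff r z x)%:E) <=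
  (M ^+ k * cech_const R d k)%:E)%E.
Proof.
rewrite -integral_bound; apply: ge0_le_integral => //.
- by move=> z _; rewrite mule_ge0// lee_fin cech_indic_ge0.
- exact: measurable_local.
- by apply: measurable_funeM; apply/measurable_EFinP; exact: measurable_cech_indic.
Qed.

Let local_ge0 k r : (0 <= \int[tuple_measure lebesgue_tuple k]_z
  ((cech_indic z)%:E * \int[lebesgue_tuple]_x (prod_aff r z x)%:E))%E.
Proof. by apply: integral_ge0 => z _; rewrite mule_ge0// lee_fin cech_indic_ge0. Qed.

Let local_fin k r : (\int[tuple_measure lebesgue_tuple k]_z
  ((cech_indic z)%:E * \int[lebesgue_tuple]_x (prod_aff r z x)%:E) \is a fin_num)%E.
Proof. by rewrite ge0_fin_numE// (le_lt_trans (integral_local_le _ _) (ltry _)). Qed.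

Lemma local_mass_ge0 k r : 0 <= local_mass k r.
Proof. by rewrite fine_ge0. Qed.

Lemma local_mass_le k r : local_mass k r <= M ^+ k * cech_const R d k.
Proof. by rewrite -lee_fin fineK. Qed.

Lemma good_mass_local k r : 0 < r -> good_mass f r k = (r ^+ d) ^+ k * local_mass k r.
Proof.
move=> r0; apply: EFin_inj; rewrite EFinM -(good_massE hf (ltW r0)) good_mass_scaling//.
by rewrite fineK.
Qed.

(** Dominated convergence in z: the inner integral is at most M^k, and [cech_indic] has finite
    integral. *)
Lemma cvg_local_mass k (r : R^nat) : r n @[n --> \oo] --> 0 ->
  local_mass k (r n) @[n --> \oo] --> cech_const R d k * moment k.
Proof.
move=> r0.
have mc : measurable_fun setT (fun z : k.-tuple (Rn R d) => (cech_indic z)%:E).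
  by apply/measurable_EFinP; exact: measurable_cech_indic.
have c0 (z : k.-tuple (Rn R d)) : (0 <= (cech_indic z)%:E)%E.
  by rewrite lee_fin cech_indic_ge0.
have ig : (tuple_measure lebesgue_tuple k).-integrable setT
    (fun z => (M ^+ k)%:E * (@cech_indic R d k z)%:E)%E.
  apply/integrableP; split; first exact: measurable_funeM.
  under eq_integral do rewrite gee0_abs ?mule_ge0// ?lee_fin ?exprn_ge0//.
  by rewrite integral_bound ltry.
have mlim : measurable_fun setT (fun z => (@cech_indic R d k z)%:E * (moment k)%:E)%E.
  exact: emeasurable_funM.
have [| | _ _ cv] := @dominated_convergence _ _ _ (tuple_measure lebesgue_tuple k)
  setT measurableT
  (fun n z => (cech_indic z)%:E * \int[lebesgue_tuple]_x (prod_aff (r n) z x)%:E)%E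
  (fun z => (cech_indic z)%:E * (moment k)%:E)%E _ (fun n => @measurable_local k (r n))
  mlim _ ig.
- apply: aeW => z _; apply: cvgeZl => //; exact: cvg_integral_prod_aff.
- apply: aeW => z n _; rewrite gee0_abs; first exact: local_le.
  by rewrite mule_ge0.
have E : (\int[tuple_measure lebesgue_tuple k]_z ((@cech_indic R d k z)%:E * (moment k)%:E) =
    (cech_const R d k * moment k)%:E)%E.
  under eq_integral do rewrite muleC.
  rewrite ge0_integralZl// ?lee_fin ?moment_ge0//.
  by rewrite cech_constE -EFinM mulrC.
rewrite E in cv; exact: (fine_cvg cv).
Qed.

End local_limit.

(** * The thermodynamic limit *)

Section tannery.
Variable R : realType.
Implicit Types u v D : R^nat.

Lemma dominated_series_cvg u D : (forall k, `|u k| <= D k) -> cvgn (series D) -> cvgn (series u).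
Proof.
move=> uD cD; apply: normed_cvg.
apply: (series_le_cvg _ _ uD cD) => k //.
exact: le_trans (normr_ge0 _) (uD k).
Qed.

Lemma dominated_series_tail u D K : (forall k, `|u k| <= D k) -> cvgn (series D) ->
  `|limn (series u) - series u K| <= limn (series D) - series D K.
Proof.
move=> uD cD; have cu := dominated_series_cvg uD cD.
have c1 : `|series u m - series u K| @[m --> \oo] --> `|limn (series u) - series u K|.
  by apply: cvg_norm; apply: cvgB => //; exact: cvg_cst.
have c2 : series D m - series D K @[m --> \oo] --> limn (series D) - series D K.
  by apply: cvgB => //; exact: cvg_cst.
rewrite -(cvg_lim _ c1)// -(cvg_lim _ c2)//; apply: ler_lim.
- by apply: cvgP c1.
- by apply: cvgP c2.
near=> m; have Km : (K <= m)%N by near: m; exact: nbhs_infty_ge.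
rewrite !sub_series_geq// (le_trans (ler_norm_sum _ _ _))//.
exact: ler_sum.
Unshelve. all: by end_near. Qed.

(** The tail of D beyond K bounds the tails of all u n and of v; with it at most e / 3, only K terms
    remain to be compared. *)
Lemma tannery (u : nat -> R^nat) v D :
  (forall k, u n k @[n --> \oo] --> v k) -> (forall n k, `|u n k| <= D k) ->
  cvgn (series D) ->
  limn (series (u n)) @[n --> \oo] --> limn (series v).
Proof.
move=> uv uD cD.
have vD k : `|v k| <= D k.
  have c1 : `|u n k| @[n --> \oo] --> `|v k| by exact: cvg_norm.
  rewrite -(cvg_lim _ c1)//; apply: limr_le; first by apply: cvgP c1.
  by apply: nearW => n; exact: uD.
apply/cvgrPdist_le => e e0; have e30 : 0 < e / 3 by rewrite divr_gt0.
have [K DK] : exists K, limn (series D) - series D K <= e / 3.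
  suff /filter_ex : \forall K \near \oo, limn (series D) - series D K <= e / 3 by [].
  have /cvgrPdist_le/(_ _ e30) := cD; apply: filterS => K.
  exact/le_trans/ler_norm.
have /cvgrPdist_le/(_ _ e30) : series (u n) K @[n --> \oo] --> series v K.
  exact: cvg_sumr.
apply: filterS => n uvn.
have t1 := dominated_series_tail K vD cD.
have t2 := dominated_series_tail K (uD n) cD.
have -> : limn (series v) - limn (series (u n)) = (limn (series v) - series v K) +
  (series v K - series (u n) K) - (limn (series (u n)) - series (u n) K) by ring.
rewrite (le_trans (ler_normB _ _))//.
have := ler_normD (limn (series v) - series v K) (series v K - series (u n) K).
lra.
Qed.

End tannery.

Lemma cvg_invn (R : realType) : (n%:R^-1 : R) @[n --> \oo] --> (0 : R).
Proof.
rewrite -(cvg_shiftS (fun n : nat => n%:R^-1 : R)).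
exact: (@cvg_harmonic R).
Qed.

Section eecc.
Variables (R : realType) (d : nat) (f : Rn R d -> R).
Hypotheses (d0 : (0 < d)%N) (hf : bounded_density f).

Definition sample_moment (s : setting) (n k : nat) : R :=
  match s with Bernoulli => (n ^_ k)%:R | Poisson => n%:R ^+ k end.

Lemma is_sample_factorial_moments s n (X : point_process R d) :
  is_sample s f n X -> has_factorial_moments f (sample_moment s n) X.
Proof.
by case: s; [exact: iid_sample_factorial_moments|exact: poisson_sample_factorial_moments].
Qed.

Lemma sample_moment_ge0 s n k : 0 <= sample_moment s n k.
Proof. by case: s => //=; rewrite exprn_ge0. Qed.

Lemma ffact_le_expn n k : (n ^_ k <= n ^ k)%N.
Proof.
by rewrite ffact_prod -[k in leqRHS]card_ord -prod_nat_const leq_prod// => i _; exact: leq_subr.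
Qed.

Lemma sample_moment_le s n k : sample_moment s n k <= n%:R ^+ k.
Proof. by case: s => //=; rewrite -natrX ler_nat ffact_le_expn. Qed.

Lemma cvg_sample_moment s k : sample_moment s n k / n%:R ^+ k @[n --> \oo] --> (1 : R).
Proof.
case: s; last first.
  apply: cvg_near_cst; near=> n; rewrite divff// expf_neq0// pnatr_eq0 -lt0n.
  by near: n; exact: nbhs_infty_gt.
elim: k => [|k IH]; first by apply: cvg_near_cst; apply: nearW => n /=; rewrite ffactn0 expr0 divr1.
have h := @cvg_invn R.
have h1 : 1 - k%:R * (n%:R^-1 : R) @[n --> \oo] --> (1 : R).
  rewrite -[X in _ --> X]subr0 -[X in _ - X](mulr0 k%:R).
  by apply: cvgB; [exact: cvg_cst|apply: cvgM => //; exact: cvg_cst].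
rewrite -[X in _ --> X](mulr1 (1 : R)).
apply: cvg_trans (cvgM IH h1).
apply: near_eq_cvg; near=> n => /=.
have kn : (k <= n)%N by near: n; exact: nbhs_infty_ge.
have n0 : n%:R != 0 :> R by rewrite pnatr_eq0 -lt0n; near: n; exact: nbhs_infty_gt.
rewrite ffactnSr natrM natrB// exprSr.
have nk0 : n%:R ^+ k != 0 :> R by rewrite expf_neq0.
by field; rewrite n0 nk0.
Unshelve. all: by end_near. Qed.

Definition eecc_coeff (k : nat) : R :=
  (-1) ^+ k * (cech_const R d k / (unit_ball_volume R d ^+ k * k.+1`!%:R)).

Let om := unit_ball_volume R d.
Let om0 : 0 < om. Proof. exact: unit_ball_volume_gt0. Qed.

Lemma cvg_radius0 (r : R^nat) (L : R) : (forall n, 0 < r n) ->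
  n%:R * om * r n ^+ d @[n --> \oo] --> L -> r n @[n --> \oo] --> (0 : R).
Proof.
move=> r0 rL.
have rd : r n ^+ d @[n --> \oo] --> (0 : R).
  rewrite -(mulr0 (L / om)); apply: (@cvg_trans _ (n%:R * om * r n ^+ d / om * n%:R^-1 @[n --> \oo])).
    apply: near_eq_cvg; near=> n.
    have n0 : n%:R != 0 :> R by rewrite pnatr_eq0 -lt0n; near: n; exact: nbhs_infty_gt.
    by field; rewrite n0 gt_eqF.
  by apply: cvgM; [apply: cvgM => //; exact: cvg_cst|exact: cvg_invn].
apply/cvgr0Pnorm_lt => e e0.
have ed : 0 < e ^+ d by rewrite exprn_gt0.
have /cvgr0Pnorm_lt/(_ _ ed) := rd; apply: filterS => n.
by rewrite !gtr0_norm// ?exprn_gt0// ltr_pXn2r// nnegrE ltW.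
Unshelve. all: by end_near. Qed.

Lemma eecc_limit s (X : nat -> point_process R d) (r : R^nat) (L : R) :
  (forall n, is_sample s f n (X n)) -> (forall n, 0 < r n) ->
  n%:R * om * r n ^+ d @[n --> \oo] --> L ->
  ((n%:R^-1)%:E * 'E_(pp_prob (X n))[fun w => euler (cech (r n) (pp_config w))])%E
    @[n --> \oo] --> (limn (pseries (fun k => eecc_coeff k * moment f k) L))%:E.
Proof.
move=> hX r0 rL.
have [M M1 fM] : exists2 M : R, 1 <= M & forall x, f x <= M.
  have [_ _ [M fM] _] := hf; exists (Num.max 1 M); first by rewrite le_max lexx.
  by move=> x; rewrite le_max fM orbT.
have M0 : 0 <= M by exact: le_trans M1.
have [H H0 rH] := cvgn_norm_bound rL.
pose a n := sample_moment s n.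
pose w n k := (-1) ^+ k * (a n k.+1 / k.+1`!%:R * good_mass f (r n) k).
(* A crude bound for fixed n, enough for convergence of each series. It grows with n; the bound
   uniform in n also uses the radii. *)
have a_le n k : a n k.+1 / k.+1`!%:R <= n%:R * exp_coeff n%:R k.
  rewrite /exp_coeff /= mulrA -exprS ler_pM// ?sample_moment_ge0// ?invr_ge0//.
    exact: sample_moment_le.
  by rewrite lef_pV2 ?posrE ?ltr0n ?fact_gt0// ler_nat factS leq_pmull.
have a_ge0 n k : 0 <= a n k.+1 / k.+1`!%:R.
  by rewrite mulr_ge0 ?invr_ge0// sample_moment_ge0.
have cexp n : cvgn (series (fun k => n%:R * exp_coeff (n%:R : R) k)).
  exact: (is_cvg_seriesZ (k := n%:R) (is_cvg_series_exp_coeff (n%:R : R))).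
have a_cvg n : cvgn (series (fun k => a n k.+1 / k.+1`!%:R)).
  by apply: dominated_series_cvg (cexp n) => k; rewrite ger0_norm.
have w_cvg n : cvgn (series (w n)).
  apply: dominated_series_cvg (cexp n) => k; apply: le_trans (a_le n k).
  rewrite /w normrM normrX normrN1 expr1n mul1r normrM !ger0_norm//; last exact: good_mass_ge0.
  by rewrite ler_piMr// (good_mass_le1 hf (ltW (r0 n))).
have EE n : ('E_(pp_prob (X n))[fun w => euler (cech (r n) (pp_config w))] =
    (limn (series (w n)))%:E)%E.
  apply: expected_euler => //.
  - exact: is_sample_factorial_moments.
  - by move=> k; exact: sample_moment_ge0.
  - exact/ltW.
pose u n k := n%:R^-1 * w n k.
have uE n : ((n%:R^-1)%:E * 'E_(pp_prob (X n))[fun w => euler (cech (r n) (pp_config w))] =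
    (limn (series (u n)))%:E)%E.
  rewrite EE -EFinM; congr EFin; have := lim_seriesZ n%:R^-1 (w_cvg n).
  by rewrite /GRing.scale /= => <-.
suff ul : limn (series (u n)) @[n --> \oo] -->
    limn (pseries (fun k => eecc_coeff k * moment f k) L).
  apply: cvg_EFin; first by apply: nearW => n; rewrite uE.
  apply: cvg_trans ul; apply: near_eq_cvg; apply: nearW => n.
  by rewrite /= uE.
have r_0 := cvg_radius0 r0 rL.
have wE n k : w n k = (-1) ^+ k / k.+1`!%:R * (a n k.+1 * (r n ^+ d) ^+ k) * local_mass f k (r n).
  by rewrite /w (good_mass_local hf M1 fM)//; ring.
(* The majorant collects a_n(k+1) / n <= n^k, (n r^d)^k <= (H / om)^k, [local_mass] <= (M 4^d)^k and
   1 / (k+1)! <= 1 / k!. *)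
apply: (@tannery _ u _ (exp_coeff (H / om * M * 4 ^+ d))).
- move=> k.
  have l1 := cvg_sample_moment s k.+1.
  have l2 : (n%:R * om * r n ^+ d) ^+ k @[n --> \oo] --> L ^+ k.
    exact: (cvg_comp _ _ rL (@exprn_continuous _ k L)).
  have l3 := cvg_local_mass hf M1 fM (k := k) r_0.
  rewrite [X in _ --> X](_ : _ =
    (-1) ^+ k / (om ^+ k * k.+1`!%:R) * (1 * L ^+ k * (cech_const R d k * moment f k))); last first.
    rewrite /eecc_coeff -/om /=; set v := (om ^+ k * _)^-1; ring.
  apply: cvg_trans (cvgM (cvg_cst _) (cvgM (cvgM l1 l2) l3)).
  apply: near_eq_cvg; near=> n => /=.
  have n0 : n%:R != 0 :> R by rewrite pnatr_eq0 -lt0n; near: n; exact: nbhs_infty_gt.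
  rewrite /u wE /a !exprMn exprS.
  have nk0 : n%:R ^+ k != 0 :> R by rewrite expf_neq0.
  have omk0 : om ^+ k != 0 by rewrite expf_neq0// gt_eqF.
  have f0 : k.+1`!%:R != 0 :> R by rewrite pnatr_eq0 -lt0n fact_gt0.
  by field; rewrite n0 nk0 omk0 f0.
- move=> n k; rewrite /u wE.
  (* For n = 0 the term vanishes, because the inverse of 0 is 0. *)
  have [->|n0] := posnP n.
    rewrite invr0 mul0r normr0 exp_coeff_ge0// !mulr_ge0// ?invr_ge0 ?exprn_ge0// ltW//.
  have n0' : (0 : R) < n%:R by rewrite ltr0n.
  have f0 : (0 : R) < k.+1`!%:R by rewrite ltr0n fact_gt0.
  have rd0 : 0 <= r n ^+ d by rewrite exprn_ge0// ltW.
  have lm0 := local_mass_ge0 hf k (r n).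
  have an0 : 0 <= a n k.+1 by exact: sample_moment_ge0.
  have rdk0 : 0 <= (r n ^+ d) ^+ k by rewrite exprn_ge0.
  rewrite !normrM normfV normrX normrN1 expr1n mul1r normfV.
  rewrite (gtr0_norm n0') (gtr0_norm f0) !ger0_norm//.
  have h1 : n%:R^-1 * a n k.+1 <= n%:R ^+ k.
    by rewrite ler_pdivrMl// -exprS sample_moment_le.
  have h2 : local_mass f k (r n) <= M ^+ k * (4 ^+ d) ^+ k.
    rewrite (le_trans (local_mass_le hf M1 fM _ _))// ler_wpM2l ?exprn_ge0//.
    exact: cech_const_le.
  have h3 : n%:R * r n ^+ d <= H / om.
    by rewrite ler_pdivlMr// mulrAC (le_trans (ler_norm _) (rH n)).
  have -> : n%:R^-1 * (k.+1`!%:R^-1 * (a n k.+1 * (r n ^+ d) ^+ k) * local_mass f k (r n)) =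
     (n%:R^-1 * a n k.+1) * (r n ^+ d) ^+ k * local_mass f k (r n) * k.+1`!%:R^-1 by ring.
  rewrite /exp_coeff /= !exprMn -[X in _ <= X * _]mulrA.
  apply: ler_pM.
  - by rewrite !mulr_ge0.
  - by rewrite invr_ge0 ltW.
  - apply: ler_pM => //.
      by rewrite !mulr_ge0.
    rewrite -exprMn; apply: (@le_trans _ _ ((n%:R * r n ^+ d) ^+ k)).
      by rewrite [leRHS]exprMn; apply: ler_wpM2r.
    by rewrite lerXn2r// nnegrE ?mulr_ge0// ?invr_ge0 ltW.
  - by rewrite lef_pV2 ?posrE ?ltr0n ?fact_gt0// ler_nat factS leq_pmull.
- exact: is_cvg_series_exp_coeff.
Unshelve. all: by end_near. Qed.

End eecc.

Lemma moment0 (R : realType) d (f : Rn R d -> R) : bounded_density f -> moment f 0 = 1.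
Proof.
move=> [_ _ _ f1]; rewrite /moment; under eq_integral do rewrite expr1.
by rewrite f1.
Qed.

Lemma unit_cubeE (R : realType) d : @unit_cube R d = cube 0 1.
Proof. by []. Qed.

Lemma integral_unit_cube (R : realType) d :
  (\int[lebesgue_tuple]_x (\1_(@unit_cube R d) x)%:E = 1)%E.
Proof.
rewrite unit_cubeE; apply: (eq_trans (integral_indicT _ (@measurable_cube R d 0 1))).
by have := @lebesgue_cube R d 0 1 ler01; rewrite subr0 expr1n.
Qed.

Lemma bounded_density_uniform (R : realType) d : bounded_density (@uniform_density R d).
Proof.
split.
- by apply: measurable_indic; rewrite unit_cubeE; exact: measurable_cube.
- by move=> x; rewrite /uniform_density indicE.
- by exists 1 => x; rewrite /uniform_density indicE; case: (_ \in _).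
- exact: integral_unit_cube.
Qed.

Lemma moment_uniform (R : realType) d k : moment (@uniform_density R d) k = 1.
Proof.
rewrite /moment (eq_integral (fun x => (\1_(@unit_cube R d) x)%:E)).
  by rewrite integral_unit_cube.
move=> x _; congr EFin; rewrite /uniform_density indicE.
by case: (_ \in _); rewrite ?expr1n// expr0n.
Qed.

(** * The EECC as a power series *)

Section eecc_formula.
Variables (R : realType) (d : nat).
Hypothesis d0 : (0 < d)%N.
Let om := unit_ball_volume R d.
Let om0 : 0 < om. Proof. exact: unit_ball_volume_gt0. Qed.

Lemma EECC_pseries (f : Rn R d -> R) s (X : nat -> point_process R d) (L : R) :
  bounded_density f -> (forall n, is_sample s f n (X n)) -> 0 <= L ->
  EECC X L = limn (pseries (fun k => eecc_coeff R d k * moment f k) L).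
Proof.
move=> hf hX L0; rewrite /EECC; have [->|L1] := eqVneq L 0.
  (* At L = 0 only the term k = 0 survives, and it equals 1 by [cech_const0] and [moment0]. *)
  apply/esym/cvg_lim => //; apply: cvg_near_cst; near=> n.
  have n0 : (0 < n)%N by near: n; exact: nbhs_infty_gt.
  rewrite /pseries /series /= big_ltn// big_nat big1 => [|k /andP[k0 _]].
    rewrite addr0 expr0 mulr1 moment0// mulr1 /eecc_coeff cech_const0.
    by rewrite !expr0 !mul1r factS fact0 muln1 invr1.
  by rewrite expr0n gtn_eqF// mulr0.
have {L1}L0 : 0 < L by rewrite lt_neqAle eq_sym L1.
set S := (X in get X); pose l := limn (pseries (fun k => eecc_coeff R d k * moment f k) L).
have Sl : S l by move=> r r0 rL; exact: eecc_limit rL.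
(* S is not empty by [eecc_limit]. To conclude that [get S] is l, some sequence of radii must
   satisfy the hypotheses in S, since otherwise every real would belong to S. *)
have Sg : S (get S) by apply: getPex; exists l.
(* The radius for which n om r^d is exactly L; the value at n = 0 only has to be positive. *)
pose r n : R := if n == 0%N then 1 else (L / (n%:R * om)) `^ d%:R^-1.
have r0 n : 0 < r n.
  rewrite /r; case: eqP => // /eqP n0; apply: powR_gt0.
  by rewrite divr_gt0// mulr_gt0// ltr0n lt0n.
have rL : n%:R * unit_ball_volume R d * r n ^+ d @[n --> \oo] --> L.
  apply: cvg_near_cst; near=> n.
  have n0 : (0 < n)%N by near: n; exact: nbhs_infty_gt.
  have n0' : (0 : R) < n%:R by rewrite ltr0n.
  rewrite /r gtn_eqF// -powR_mulrn ?powR_ge0// -powRrM mulVf ?pnatr_eq0 -?lt0n// powRr1.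
    by rewrite mulrC divfK// gt_eqF// mulr_gt0.
  by rewrite ltW// divr_gt0// mulr_gt0.
exact: EFin_inj (cvg_unique _ (Sg r r0 rL) (Sl r r0 rL)).
Unshelve. all: by end_near. Qed.

Lemma eecc_coeff_bound k : `|eecc_coeff R d k| <= exp_coeff (4 ^+ d / om) k.
Proof.
rewrite /eecc_coeff normrM normrX normrN1 expr1n mul1r ger0_norm; last first.
  by rewrite divr_ge0 ?cech_const_ge0// mulr_ge0// exprn_ge0// ltW.
have -> : exp_coeff (4 ^+ d / om) k = (4 ^+ d) ^+ k / om ^+ k / k`!%:R.
  by rewrite /exp_coeff /= exprMn exprVn.
rewrite invfM mulrA; apply: ler_pM.
- by rewrite divr_ge0 ?cech_const_ge0// exprn_ge0// ltW.
- by rewrite invr_ge0.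
- by rewrite ler_pM2r ?invr_gt0 ?exprn_gt0// cech_const_le.
- by rewrite lef_pV2 ?posrE ?ltr0n ?fact_gt0// ler_nat factS leq_pmull.
Qed.

Lemma EECC_uniform_pseries s (U : nat -> point_process R d) (L : R) :
  (forall n, is_sample s (@uniform_density R d) n (U n)) -> 0 <= L ->
  EECC U L = limn (pseries (eecc_coeff R d) L).
Proof.
move=> hU L0; rewrite (EECC_pseries (@bounded_density_uniform R d) hU L0).
by congr (limn (pseries _ L)); apply/funext => k; rewrite moment_uniform mulr1.
Qed.

Lemma integral_density_pseries (f : Rn R d -> R) (L : R) : bounded_density f -> 0 <= L ->
  (\int[lebesgue_tuple]_x (f x * limn (pseries (eecc_coeff R d) (L * f x)))%:E =
   (limn (pseries (fun k => eecc_coeff R d k * moment f k) L))%:E)%E.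
Proof.
move=> hf L0; have [mf f0 [M' fM'] f1] := hf.
have [M M1 fM] : exists2 M : R, 1 <= M & forall x, f x <= M.
  exists (Num.max 1 M'); first by rewrite le_max lexx.
  by move=> x; rewrite le_max fM' orbT.
have M0 : 0 <= M by exact: le_trans M1.
(* As f <= M, the terms of the series at L f x are dominated by the exponential series at A,
   uniformly in x. *)
pose e := eecc_coeff R d; pose A := 4 ^+ d / om * (L * M).
have term_le k x : `|e k * (L * f x) ^+ k| <= exp_coeff A k.
  have -> : exp_coeff A k = exp_coeff (4 ^+ d / om) k * (L * M) ^+ k.
    by rewrite /A /exp_coeff /= [in LHS]exprMn mulrAC.
  rewrite normrM; apply: ler_pM => //; first exact: eecc_coeff_bound.
  rewrite ger0_norm ?exprn_ge0 ?mulr_ge0//.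
  by rewrite lerXn2r// ?nnegrE ?mulr_ge0// ler_wpM2l.
pose S K x := f x * pseries e (L * f x) K.
have Scvg x : S K x @[K --> \oo] --> f x * limn (pseries e (L * f x)).
  apply: cvgM; first exact: cvg_cst.
  exact: dominated_series_cvg (term_le ^~ x) (is_cvg_series_exp_coeff A).
have mS K : measurable_fun setT (S K).
  apply: measurable_funM => //; apply: measurable_sum => k.
  by apply: measurable_funM => //; apply: measurable_funX; exact: measurable_funM.
have mlim : measurable_fun setT (fun x => f x * limn (pseries e (L * f x))).
  by apply: (measurable_fun_cvg mS) => x _; exact: Scvg.
have S_le x K : `|S K x| <= expR A * f x.
  rewrite normrM (ger0_norm (f0 x)) mulrC ler_wpM2r//.
  rewrite (le_trans (ler_norm_sum _ _ _))//.
  apply: (@le_trans _ _ (series (exp_coeff A) K)).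
    by apply: ler_sum => k _; exact: term_le.
  apply: nondecreasing_cvgn_le; last exact: is_cvg_series_exp_coeff.
  apply: nondecreasing_series => k _ _.
  exact: le_trans (normr_ge0 _) (term_le k point).
have ig : lebesgue_tuple.-integrable setT (fun x => (expR A * f x)%:E).
  apply/integrableP; split; first by apply/measurable_EFinP; exact: measurable_funM.
  under eq_integral do rewrite gee0_abs ?lee_fin ?mulr_ge0 ?expR_ge0// EFinM.
  rewrite ge0_integralZl//.
  - by rewrite f1 mule1 ltry.
  - exact/measurable_EFinP.
  - by move=> x _; rewrite lee_fin.
have [| | | |iF _ cv] := @dominated_convergence _ _ _ (@lebesgue_tuple R d) setT measurableT
  (fun K x => (S K x)%:E) (fun x => (f x * limn (pseries e (L * f x)))%:E) _ _ _ _ ig.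
- by move=> K; exact/measurable_EFinP.
- exact/measurable_EFinP.
- by apply: aeW => x _; apply: cvg_EFin; [exact: nearW|exact: Scvg].
- by apply: aeW => x K _; rewrite /= lee_fin; exact: S_le.
have momE k : (\int[lebesgue_tuple]_x (f x ^+ k.+1)%:E = (moment f k)%:E)%E.
  exact: (momentE hf M1 fM).
have ipow k : lebesgue_tuple.-integrable setT (fun x => (f x ^+ k.+1)%:E).
  apply/integrableP; split; first by apply/measurable_EFinP; exact: measurable_funX.
  under eq_integral do rewrite gee0_abs ?lee_fin ?exprn_ge0//.
  by rewrite momE ltry.
have intS K : (\int[lebesgue_tuple]_x (S K x)%:E =
    (pseries (fun k => e k * moment f k) L K)%:E)%E.
  transitivity (\int[lebesgue_tuple]_x
      (\sum_(0 <= k < K) (e k * L ^+ k)%:E * (f x ^+ k.+1)%:E))%E.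
    apply: eq_integral => x _; under eq_bigr do rewrite -EFinM.
    rewrite sumEFin; congr EFin; rewrite /S /pseries /series /= mulr_sumr.
    by apply: eq_bigr => k _; rewrite exprMn exprS; ring.
  rewrite integral_sum//; last by move=> k; exact: integrableZl.
  rewrite /pseries /series /= -sumEFin; apply: eq_bigr => k _.
  by rewrite integralZl// momE -EFinM; congr EFin; ring.
have Ifin := integrable_fin_num measurableT iF.
rewrite -(fineK Ifin); congr EFin; apply/esym/cvg_lim => //.
have h : (pseries (fun k => e k * moment f k) L K)%:E @[K --> \oo] -->
    (fine (\int[lebesgue_tuple]_x (f x * limn (pseries e (L * f x)))%:E))%:E.
  rewrite fineK//; apply: cvg_trans cv.
  by apply: near_eq_cvg; apply: nearW => K; exact: intS.
exact: (fine_cvg h).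
Qed.

Lemma EECC_integral (f : Rn R d -> R) s (X U : nat -> point_process R d) (L : R) :
  bounded_density f -> (forall n, is_sample s f n (X n)) ->
  (forall n, is_sample s (@uniform_density R d) n (U n)) -> 0 <= L ->
  ((EECC X L)%:E = \int[lebesgue_tuple]_x (f x * EECC U (L * f x))%:E)%E.
Proof.
move=> hf hX hU L0; rewrite (EECC_pseries hf hX L0) -integral_density_pseries//.
apply: eq_integral => x _; rewrite (EECC_uniform_pseries hU)// mulr_ge0//.
by case: hf.
Qed.

End eecc_formula.

(** * Integration against the derivative of the excess mass *)

Section exponentially_dominated_pseries.
Variable R : realType.
Implicit Types (c : R^nat) (A B x y : R).

(** A class of entire series stable under formal differentiation, B becoming B * A. Term-by-term
    differentiation asks for convergence of the series and of its first two formal derivatives. *)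
Definition exp_dominated c := exists A B, 0 <= A /\ forall k, `|c k| <= B * exp_coeff A k.

Lemma exp_dominated_diffs c : exp_dominated c -> exp_dominated (pseries_diffs c).
Proof.
move=> [A [B [A0 cAB]]]; exists A, (B * A); split=> // k.
rewrite /pseries_diffs normrM ger0_norm//.
rewrite (le_trans (ler_wpM2l _ (cAB k.+1)))// /exp_coeff /= factS natrM exprS.
have: k.+1%:R != 0 :> R by rewrite pnatr_eq0.
have: k`!%:R != 0 :> R by rewrite pnatr_eq0 -lt0n fact_gt0.
by move: k.+1%:R k`!%:R => n m m0 n0; rewrite le_eqVlt; apply/orP; left; apply/eqP; field; rewrite m0 n0.
Qed.

Lemma is_cvg_pseries_exp c y : exp_dominated c -> cvgn (pseries c y).
Proof.
move=> [A [B [A0 cAB]]].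
apply: (@dominated_series_cvg _ _ (fun k => B * exp_coeff (A * `|y|) k)) => [k|].
  rewrite normrM normrX /exp_coeff /= exprMn.
  rewrite (le_trans (ler_wpM2r _ (cAB k)))// /exp_coeff /=.
  by rewrite [leRHS](_ : _ = B * (A ^+ k / k`!%:R) * `|y| ^+ k)//; ring.
exact: is_cvg_seriesZ (is_cvg_series_exp_coeff _).
Qed.

Lemma is_derive_pseries c y : exp_dominated c ->
  is_derive y (1 : R) (fun x => limn (pseries c x)) (limn (pseries (pseries_diffs c) y)).
Proof.
move=> cE; apply: (@pseries_snd_diffs _ c (`|y| + 1)).
- exact: is_cvg_pseries_exp.
- exact/is_cvg_pseries_exp/exp_dominated_diffs.
- exact/is_cvg_pseries_exp/exp_dominated_diffs/exp_dominated_diffs.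
- by rewrite [ltRHS]ger0_norm ?addr_ge0// ltrDl.
Qed.

Lemma is_derive_pseries_scale c (L y : R) : exp_dominated c ->
  is_derive y (1 : R) (fun x => limn (pseries c (L * x)))
    (L * limn (pseries (pseries_diffs c) (L * y))).
Proof.
move=> cE; have h := is_derive_pseries (L * y) cE.
have g : is_derive y (1 : R) (fun x => L * x) L.
  have := is_deriveZ L (is_derive_id y (1 : R)). rewrite /GRing.scale /= mulr1. done.
by rewrite mulrC; apply: is_derive_eq (is_derive1_comp h g) _; rewrite mulrC.
Qed.

Lemma continuous_pseries_scale c (L : R) : exp_dominated c ->
  continuous (fun y => limn (pseries c (L * y))).
Proof.
move=> cE y; apply: differentiable_continuous.
by apply/derivable1_diffP; case: (is_derive_pseries_scale L y cE).
Qed.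

End exponentially_dominated_pseries.

(** Used for y |-> EECC U (L * y), which is identified with the power series only for y >= 0;
    interior points see the same derivative. *)
Lemma is_derive_eq_itv (R : realType) (phi psi : R -> R) (a b y l : R) :
  {in `[a, b], phi =1 psi} -> is_derive y (1 : R) psi l -> y \in `]a, b[ ->
  is_derive y (1 : R) phi l.
Proof.
move=> phipsi Dpsi yab; apply: near_eq_is_derive Dpsi.
near=> z; apply/esym/phipsi/subset_itv_oo_cc.
by near: z; exact: near_in_itvoo.
Unshelve. all: by end_near. Qed.

(** * The second formula by Fubini *)

Section layer_cake.
Variables (R : realType) (d : nat) (f : Rn R d -> R).
Hypothesis hf : bounded_density f.
Notation lambda := (@lebesgue_measure R).

Lemma ae_le_sup_norm : {ae (@lebesgue_tuple R d), forall x, f x <= sup_norm f}.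
Proof.
have [mf f0 [M fM] f1] := hf.
(* [Lnorm] at +oo is the essential supremum when the whole space has positive measure; the density
   of integral 1 guarantees this. *)
have T0 : (0 < @lebesgue_tuple R d setT)%E.
  rewrite lt0e measure_ge0 andbT; apply/eqP => T0.
  have := f1; rewrite null_set_integral//; last exact/measurable_EFinP.
  by move/eqP; rewrite eq_sym onee_eq0.
have Nle : ('N[@lebesgue_tuple R d]_+oo[EFin \o f] <= M%:E)%E.
  rewrite unlock /Lnorm T0; apply/ess_supP/aeW => x /=.
  by rewrite lee_fin ger0_norm.
have Nfin : ('N[@lebesgue_tuple R d]_+oo[EFin \o f] \is a fin_num)%E.
  by rewrite ge0_fin_numE ?Lnorm_ge0// (le_lt_trans Nle) ?ltry.
have := ess_sup_ge (@lebesgue_tuple R d) (abse \o (EFin \o f)).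
apply: filterS => x /=; rewrite ger0_norm// => fx.
rewrite /sup_norm -lee_fin fineK//; apply: le_trans fx _.
by rewrite unlock /Lnorm T0.
Qed.

Lemma sup_norm_ge0 : 0 <= sup_norm f.
Proof. by rewrite fine_ge0// Lnorm_ge0. Qed.

Lemma excess_mass_integral (M : R) (psi dpsi : R -> R) : 0 <= M ->
  {ae (@lebesgue_tuple R d), forall x, f x <= M} ->
  continuous dpsi -> (forall y, is_derive y (1 : R) psi (dpsi y)) ->
  (\int[lebesgue_measure]_(y in `[0%R, M]) (excess_mass f y * dpsi y)%:E =
   \int[lebesgue_tuple]_x (f x * (psi (f x) - psi 0))%:E)%E.
Proof.
move=> M0 fM cdpsi Dpsi; have [mf f0 _ f1] := hf.
pose I : set R := `[0, M]%classic.
have mI : measurable I by exact: measurable_itv.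
have mdpsi : measurable_fun setT dpsi by exact: continuous_measurable_fun.
pose P : set (measurableTypeR R * Rn R d) := [set p | p.1 <= f p.2].
have mP : measurable P.
  rewrite -[P]setTI; apply: measurable_fun_le => //.
  exact: measurableT_comp.
have mA y : measurable [set x | y <= f x].
  by rewrite -[X in measurable X]setTI; exact: measurable_fun_le.
pose F (p : measurableTypeR R * Rn R d) : R := \1_I p.1 * dpsi p.1 * (\1_P p * f p.2).
have mF : measurable_fun setT (EFin \o F).
  apply/measurable_EFinP; apply: measurable_funM.
    apply: measurable_funM; last exact: measurableT_comp.
    by apply: measurableT_comp => //; exact: measurable_indic.
  by apply: measurable_funM; [exact: measurable_indic|exact: measurableT_comp].
have PE y x : \1_P (y, x) = \1_[set x | y <= f x] x :> R.
  by rewrite !indicE; congr (nat_of_bool _)%:R; apply/idP/idP; rewrite !inE.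
have idpsi : lambda.-integrable I (EFin \o dpsi).
  apply: continuous_compact_integrable; first exact: segment_compact.
  exact: continuous_subspaceT.
have iexc y : (\int[lebesgue_tuple]_x (\1_[set x | (y <= f x)%R] x * f x)%:E =
    (excess_mass f y)%:E)%E by exact: mass_indicE.
have exc0 y : 0 <= excess_mass f y by exact: mass_ge0.
have exc1 y : excess_mass f y <= 1.
  rewrite -lee_fin -iexc -f1; apply: ge0_le_integral => //.
  - by move=> x _; rewrite lee_fin mulr_ge0// indicE.
  - apply/measurable_EFinP; apply: measurable_funM => //; exact: measurable_indic.
  - exact/measurable_EFinP.
  - by move=> x _; rewrite lee_fin indicE; case: (_ \in _); rewrite ?mul1r ?mul0r.
have int1 c y : (\int[lebesgue_tuple]_x (c * (\1_P (y, x) * f x))%:E =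
    (c * excess_mass f y)%:E)%E.
  transitivity (\int[lebesgue_tuple]_x (c%:E * (\1_[set x | (y <= f x)%R] x * f x)%:E))%E.
    by apply: eq_integral => x _; rewrite -EFinM -PE.
  rewrite integralZl// ?iexc//.
  apply/integrableP; split.
    by apply/measurable_EFinP; apply: measurable_funM => //; exact: measurable_indic.
  under eq_integral do rewrite gee0_abs ?lee_fin ?mulr_ge0 ?indicE//.
  by under eq_integral do rewrite -indicE; rewrite iexc ltry.
have mexc : measurable_fun setT (excess_mass f).
  apply/measurable_EFinP.
  rewrite (_ : _ \o _ = fun y => (\int[lebesgue_tuple]_x (\1_P (y, x) * f x)%:E)%E).
    have mPf : measurable_fun setT (fun p => (\1_P p * f p.2)%:E).
      apply/measurable_EFinP; apply: measurable_funM; first exact: measurable_indic.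
      exact: measurableT_comp.
    apply: (measurable_fun_fubini_tonelli_F _ mPf) => p.
    by rewrite lee_fin mulr_ge0// indicE.
  by apply/funext => y /=; rewrite -iexc; apply: eq_integral => x _; rewrite PE.
(* Integrating the absolute value over x first leaves |dpsi y| times the excess mass, at most |dpsi
   y| on [0, M]. *)
have iF : (lambda \x @lebesgue_tuple R d)%E.-integrable setT (EFin \o F).
  apply/integrable12ltyP => //.
  under eq_integral => y _.
    rewrite (_ : (fun x => _) = (fun x => (`|\1_I y * dpsi y| * (\1_P (y, x) * f x))%:E)); last first.
      apply/funext => x /=; congr EFin; rewrite /F normrM; congr *%R.
      by rewrite ger0_norm// mulr_ge0// indicE.
    rewrite int1; over.
  move/integrableP : idpsi => [_]; apply: le_lt_trans.
  rewrite [leRHS]integral_mkcond; apply: ge0_le_integral => //.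
  - by move=> y _; rewrite lee_fin mulr_ge0.
  - apply/measurable_EFinP; apply: measurable_funM => //; apply: measurableT_comp => //.
    by apply: measurable_funM => //; exact: measurable_indic.
  - by apply/(measurable_restrictT _ _).1 => //; apply/measurable_EFinP/measurableT_comp => //; exact: measurable_funTS.
  - move=> y _; rewrite patchE indicE; case: ifP => yI; rewrite /= ?mul1r ?mul0r ?normr0 ?mul0r//.
    by rewrite lee_fin ler_piMr.
transitivity (\int[lambda]_y \int[lebesgue_tuple]_x (EFin \o F) (y, x))%E.
  rewrite integral_mkcond; apply: eq_integral => y _.
  transitivity (\1_I y * dpsi y * excess_mass f y)%:E; last by rewrite -int1.
  rewrite patchE indicE; case: ifP => _; first by rewrite mul1r mulrC.
  by rewrite !mul0r.
rewrite Fubini//; have [N [mN N0 fN]] := fM.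
(* Where f x <= M, the restriction to [0, M] removes nothing from [0, f x]; the other x form a null
   set. *)
apply: (eq_integral_off_null mN N0) => x Nx.
have {Nx}fxM : f x <= M by apply: contrapT => fx; apply: Nx; exact: fN.
transitivity ((f x)%:E * \int[lambda]_(y in `[0%R, f x]) (dpsi y)%:E)%E.
  rewrite -integralZl//; last first.
    apply: continuous_compact_integrable; first exact: segment_compact.
    exact: continuous_subspaceT.
  rewrite [RHS]integral_mkcond; apply: eq_integral => y _.
  have -> : (EFin \o F) (y, x) = ((\1_I y * \1_P (y, x)) * (dpsi y * f x))%:E.
    by rewrite /F /=; congr EFin; ring.
  rewrite patchE (_ : \1_I y * \1_P (y, x) = \1_(`[0, f x]%classic : set R) y).
    by rewrite indicE; case: ifP => _; rewrite ?mul0r// mul1r mulrC.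
  rewrite !indicE -natrM mulnb; congr (nat_of_bool _)%:R.
  apply/andP/idP => [[]|]; rewrite !inE /I /P /= !in_itv /=.
    by move=> /andP[-> _] ->.
  by move=> /andP[-> yf]; split => //; exact: le_trans yf fxM.
(* The fundamental theorem is applied on [0, f x] with 0 < f x; at f x = 0 the outer factor f x
   makes both sides vanish. *)
rewrite EFinM; have := f0 x; rewrite le_eqVlt => /predU1P[<-|fx0]; first by rewrite !mul0e.
congr (_ * _)%E; rewrite EFinB; apply: continuous_FTC2 => //.
- exact: continuous_subspaceT.
- have cpsi : continuous psi.
    by move=> y; apply/differentiable_continuous/derivable1_diffP; case: (Dpsi y).
  split=> [y _||]; first by case: (Dpsi y).
  + exact/cvg_at_right_filter/cpsi.
  + exact/cvg_at_left_filter/cpsi.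
- by move=> y _; rewrite derive1E; apply: derive_val.
Qed.

(** As f has integral 1, the part - psi 0 in [excess_mass_integral] cancels the boundary term phi 0.
    The function psi extends phi smoothly beyond [0, M]. *)
Lemma distr_deriv_excess_mass (M : R) (phi psi dpsi : R -> R) : 0 <= M ->
  {ae (@lebesgue_tuple R d), forall x, f x <= M} ->
  continuous dpsi -> (forall y, is_derive y (1 : R) psi (dpsi y)) ->
  {in `[0, M], phi =1 psi} ->
  - distr_deriv_integral (excess_mass f) M phi =
  fine (\int[lebesgue_tuple]_x (f x * psi (f x))%:E)%E.
Proof.
move=> M0 fM cdpsi Dpsi phiE; have [mf f0 [M' fM'] f1] := hf.
have cpsi : continuous psi.
  by move=> y; apply/differentiable_continuous/derivable1_diffP; case: (Dpsi y).
have mpsif : measurable_fun setT (fun x => psi (f x)).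
  by apply: measurableT_comp => //; exact: continuous_measurable_fun.
have if_ : lebesgue_tuple.-integrable setT (EFin \o f).
  apply/integrableP; split; first exact/measurable_EFinP.
  by under eq_integral do rewrite gee0_abs ?lee_fin//; rewrite f1 ltry.
have ifpsi : lebesgue_tuple.-integrable setT (fun x => (f x * psi (f x))%:E).
  (* M' bounds f everywhere, so |psi (f x)| is at most the maximum of |psi| on [0, M']. *)
  have M'0 : 0 <= M' by exact: le_trans (f0 point) (fM' point).
  have [c _ psic] := @EVT_max _ (fun y => `|psi y|) 0 M' M'0
    (continuous_subspaceT (fun y => cvg_norm (cpsi y))).
  apply: (le_integrable measurableT _ _ (integrableZl measurableT `|psi c| if_)).
    by apply/measurable_EFinP; exact: measurable_funM.
  move=> x _ /=; rewrite lee_fin !normrM normr_id mulrC ler_wpM2r//.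
  by apply: psic; rewrite in_itv /= f0 fM'.
rewrite /distr_deriv_integral opprB opprK addrC phiE ?in_itv/= ?lexx//.
rewrite /Rintegral (_ : integral _ _ _ =
    \int[lebesgue_measure]_(y in `[0%R, M]) (excess_mass f y * dpsi y)%:E)%E; last first.
  rewrite integral_mkcond [RHS]integral_mkcond.
  (* At 0 and M the derivative of phi depends on its values outside [0, M], where phi is unknown;
     these two points are discarded as a null set. *)
  have N0 : lambda ([set 0] `|` [set M]) = 0%E.
    by apply: null_set_setU; do ?exact: measurable_set1; exact: lebesgue_measure_set1.
  apply: (eq_integral_off_null _ N0) => [|y yN]; first exact: measurableU.
  rewrite !patchE; case: ifPn => //; rewrite inE /= in_itv /= => /andP[y0 yM].
  have {}y0 : 0 < y by rewrite lt_neqAle y0 andbT; apply/eqP => y0'; apply: yN; left.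
  have {}yM : y < M by rewrite lt_neqAle yM andbT; apply/eqP => y0'; apply: yN; right.
  congr (_ * _)%:E; rewrite derive1E.
  by apply: derive_val; apply: is_derive_eq_itv phiE (Dpsi y) _; rewrite in_itv /= y0.
rewrite (excess_mass_integral M0 fM cdpsi Dpsi).
under eq_integral do rewrite mulrBr EFinB.
rewrite integralB//; last first.
  by under eq_fun do rewrite mulrC EFinM; exact: integrableZl.
under [X in (_ - X)%E]eq_integral do rewrite mulrC EFinM.
rewrite integralZl// f1 mule1 fineB// ?addrA; last exact: integrable_fin_num.
by rewrite /= addrAC subrr add0r.
Qed.

End layer_cake.

Lemma exp_dominated_eecc_coeff (R : realType) (d : nat) : (0 < d)%N ->
  exp_dominated (eecc_coeff R d).
Proof.
move=> d0; exists (4 ^+ d / unit_ball_volume R d), 1; split.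
  by rewrite divr_ge0 ?exprn_ge0// ltW// unit_ball_volume_gt0.
by move=> k; rewrite mul1r; exact: eecc_coeff_bound.
Qed.

Theorem theorem3p1 (R : realType) (d : nat) (hd : (0 < d)%N)
    (f : Rn R d -> R) (hf : bounded_density f)
    (s : setting) (X U : nat -> point_process R d)
    (hX : forall n, is_sample s f n (X n))
    (hU : forall n, is_sample s (uniform_density (d := d)) n (U n)) :
  (forall L : R, 0 <= L ->
     (EECC X L)%:E =
     (\int[lebesgue_tuple]_x (f x * EECC U (L * f x))%:E)%E) /\
  (forall L : R, 0 <= L ->
     C1_itv (sup_norm f) (fun y => EECC U (L * y)) /\
     EECC X L =
     - distr_deriv_integral (excess_mass f) (sup_norm f)
         (fun y => EECC U (L * y))).
Proof.
split=> [|L L0]; first by move=> L L0; exact: EECC_integral hU L0.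
have eE := exp_dominated_eecc_coeff R hd.
(* The power series stands in for y |-> EECC U (L * y): they agree for y >= 0, and the series is
   differentiable on the whole line. *)
pose psi (y : R) := limn (pseries (eecc_coeff R d) (L * y)).
pose dpsi (y : R) := L * limn (pseries (pseries_diffs (eecc_coeff R d)) (L * y)).
have Dpsi y : is_derive y (1 : R) psi (dpsi y) by exact: is_derive_pseries_scale.
have cdpsi : continuous dpsi.
  move=> y; apply: cvgM; first exact: cvg_cst.
  exact: continuous_pseries_scale (exp_dominated_diffs eE) y.
have UE y : 0 <= y -> EECC U (L * y) = psi y.
  by move=> y0; rewrite (EECC_uniform_pseries hd hU)// mulr_ge0.
have UM : {in `[0, sup_norm f], (fun y => EECC U (L * y)) =1 psi}.
  by move=> y; rewrite in_itv /= => /andP[y0 _]; exact: UE.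
split.
  exists dpsi; split.
  - apply: (@subspace_eq_continuous _ _ _ psi) => [y|]; first by rewrite inE => /UM.
    by apply: continuous_subspaceT; exact: continuous_pseries_scale.
  - exact: continuous_subspaceT.
  - by move=> y; exact: is_derive_eq_itv UM (Dpsi y).
rewrite (distr_deriv_excess_mass hf (sup_norm_ge0 f) (ae_le_sup_norm hf) cdpsi Dpsi UM).
by rewrite integral_density_pseries// (EECC_pseries hd hf hX L0).
Qed.
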